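(* Let $n\ge 1$, and let $\{(\Gamma_k\backslash \mathbb{H}_n,\langle\cdot,\cdot\rangle_k)\}_{k\in\mathbb{N}}$ be a sequence of compact Heisenberg manifolds with left invariant Riemannian metrics which converges in the Gromov--Hausdorff topology. Assume that there are constants $D,V>0$ and $K\in\mathbb{R}$ such that for all $k$: (1) $\mathrm{diam}(\Gamma_k\backslash \mathbb{H}_n,\langle\cdot,\cdot\rangle_k)\leq D$; (2) $\mathrm{meas}(\Gamma_k\backslash \mathbb{H}_n,\langle\cdot,\cdot\rangle_k)\geq V$; (3) $\mathrm{Ric}_{\langle\cdot,\cdot\rangle_k}\geq K$. Then the Gromov--Hausdorff limit is isometric to a compact Heisenberg manifold with a left invariant Riemannian metric, of the same dimension $2n+1$.
   Context: The Heisenberg Lie group $\mathbb{H}_n$ is $\mathbb{C}^n\times\mathbb{R}$ with product $(\mathbf{w},z)\cdot(\mathbf{w}',z')=(\mathbf{w}+\mathbf{w}',\,z+z'+\tfrac12\,\mathrm{Im}(\mathbf{w}\cdot\mathbf{w}'))$, where $\mathrm{Im}(\mathbf{w}\cdot\mathbf{w}')=\sum_i(x_iy_i'-y_ix_i')$ is the imaginary part of the Hermitian product for $\mathbf w=(x_i+\sqrt{-1}\,y_i)_i$, $\mathbf w'=(x'_i+\sqrt{-1}\,y'_i)_i$. A compact Heisenberg manifold is a quotient $\Gamma\backslash\mathbb{H}_n$ with $\Gamma<\mathbb{H}_n$ a lattice (discrete cocompact subgroup). A Riemannian metric on $\Gamma\backslash\mathbb{H}_n$ is called left invariant if its pullback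 to the universal cover $\mathbb{H}_n$ is left invariant. The quantity $\mathrm{meas}$ is the total Riemannian volume, and $\mathrm{Ric}\ge K$ means $\mathrm{Ric}(u,u)\ge K$ for all unit tangent vectors $u$. *)

(* Defs.v *)
From HB Require Import structures.
From mathcomp Require Import all_boot all_order all_algebra.
From mathcomp Require Import all_classical all_reals all_analysis.
From mathcomp Require Import ring.

Set Implicit Arguments.
Unset Strict Implicit.
Unset Printing Implicit Defensive.

Import Order.TTheory GRing.Theory Num.Theory.
Import numFieldNormedType.Exports.

Local Open Scope classical_set_scope.
Local Open Scope ring_scope.
Local Open Scope quotient_scope.

(** * Gromov--Hausdorff distance *)

Section GromovHausdorff.
Context {R : realType}.

Definition hausdorff_dist (Z : metricType R) (A B : set Z) : \bar R :=
  maxe (ereal_sup [set ereal_inf [set (mdist a b)%:E | b in B] | a in A])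
       (ereal_sup [set ereal_inf [set (mdist a b)%:E | a in A] | b in B]).

Definition dist_preserving (X Y : Type) (dX : X -> X -> R) (dY : Y -> Y -> R)
    (f : X -> Y) : Prop :=
  forall x x', dY (f x) (f x') = dX x x'.

Definition isometric (X Y : Type) (dX : X -> X -> R) (dY : Y -> Y -> R) : Prop :=
  exists f : X -> Y, bijective f /\ dist_preserving dX dY f.

Definition gh_dist (X Y : Type) (dX : X -> X -> R) (dY : Y -> Y -> R) : \bar R :=
  ereal_inf [set e | exists (Z : metricType R) (i : X -> Z) (j : Y -> Z),
    [/\ dist_preserving dX mdist i, dist_preserving dY mdist j
      & e = hausdorff_dist (range i) (range j)]].

Definition diameter (X : Type) (d : X -> X -> R) : \bar R :=
  ereal_sup [set (d x y)%:E | x in setT & y in setT].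

End GromovHausdorff.

(** * Riemannian metrics on R^N

    A metric is given by its matrix [g p] in the standard coordinates, tangent
    vectors at every point being identified with row vectors. *)

Section Riemannian.
Context {R : realType} {N : nat}.
Local Notation V := 'rV[R]_N.
Implicit Types (g : V -> 'M[R]_N) (p u v : V).

Definition partial (i : 'I_N) (f : V -> R) : V -> R :=
  fun p => 'D_(delta_mx 0 i) f p.

(* All iterated partial derivatives exist and are differentiable, i.e. C^oo. *)
Definition smooth (f : V -> R) : Prop :=
  forall (s : seq 'I_N) p, differentiable (foldr partial f s) p.

Definition tensor_form (T : V -> 'M[R]_N) p u v : R :=
  (u *m T p *m v^T) 0 0.

Definition riemannian_metric g : Prop :=
  [/\ forall p, (g p)^T = g p,
      forall p u, u != 0 -> 0 < tensor_form g p u u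
    & forall i j, smooth (fun p => g p i j)].

Definition C1_curve (c : R -> V) : Prop :=
  (forall t, derivable c t 1) /\ continuous (derive1 c).

(* [s] lists the break points [0 = t_0 < t_1 < ... < t_m = 1] without [t_0];
   on each closed piece the curve is the restriction of a C^1 curve. *)
Definition piecewise_C1 (c : R -> V) : Prop :=
  exists s : seq R,
    [/\ path <%R 0 s, last 0 s = 1
      & forall i, (i < size s)%N ->
          exists2 gamma, C1_curve gamma &
            forall t, nth 0 (0 :: s) i <= t <= nth 0 s i -> c t = gamma t].

(* At the finitely many break points [derive1 c] is a junk value, which does not
   affect the integral. *)
Definition curve_length g (c : R -> V) : R :=
  \int[lebesgue_measure]_(t in `[0, 1])
     Num.sqrt (tensor_form g (c t) (derive1 c t) (derive1 c t)).

(* [christoffel g k i j] is Gamma^k_{ij}. *)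
Definition christoffel g (k i j : 'I_N) : V -> R := fun p =>
  2^-1 * \sum_l invmx (g p) k l *
    (partial i (fun q => g q j l) p + partial j (fun q => g q i l) p
       - partial l (fun q => g q i j) p).

(* [riemann g l i j k] is the d_l-component of R(d_i, d_j) d_k, with
   R(X, Y) = [D_X, D_Y] - D_[X, Y]. *)
Definition riemann g (l i j k : 'I_N) : V -> R := fun p =>
  partial i (christoffel g l j k) p - partial j (christoffel g l i k) p
  + \sum_m (christoffel g l i m p * christoffel g m j k p
            - christoffel g l j m p * christoffel g m i k p).

(* Ric(v, u) is the trace of w |-> R(w, u) v; it is positive on spheres. *)
Definition ricci g : V -> 'M[R]_N := fun p =>
  \matrix_(j, k) \sum_i riemann g i i j k p.

Definition ricci_ge g (K : R) : Prop :=
  forall p u, tensor_form g p u u = 1 -> K <= tensor_form (ricci g) p u u.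

End Riemannian.

(* Lebesgue integral over R^N, written as an iterated integral; by Tonelli's
   theorem this is the integral against N-dimensional Lebesgue measure for every
   nonnegative Borel function. It is only used on such functions. *)
Fixpoint lebesgue_integral_rV (R : realType) (N : nat) :
    ('rV[R]_N -> \bar R) -> \bar R :=
  match N with
  | 0 => fun f => f 0
  | N'.+1 => fun f =>
      (\int[lebesgue_measure]_(x in [set: R])
         lebesgue_integral_rV
           (fun v : 'rV[R]_N' => f (row_mx (x%:M : 'rV[R]_1) v)))%E
  end.

Definition riemannian_volume (R : realType) (N : nat)
    (g : 'rV[R]_N -> 'M[R]_N) (F : set 'rV[R]_N) : \bar R :=
  lebesgue_integral_rV (fun p => (Num.sqrt (\det (g p)) * \1_F p)%:E).

(** * The Heisenberg group

    The point [(w, z)] with [w = x + sqrt(-1) y] is the row vector [(x, y, z)]. *)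

Section Heisenberg.
Context {R : realType} {n : nat}.

Local Notation H := 'rV[R]_(n + n + 1).
Implicit Types p q : H.

Definition heis_x p : 'rV[R]_n := lsubmx (lsubmx p).
Definition heis_y p : 'rV[R]_n := rsubmx (lsubmx p).
Definition heis_z p : R := rsubmx p 0 0.

Definition heis_mk (x y : 'rV[R]_n) (z : R) : H :=
  row_mx (row_mx x y) (z%:M : 'rV[R]_1).

Definition heis_im p q : R :=
  \sum_i (heis_x p 0 i * heis_y q 0 i - heis_y p 0 i * heis_x q 0 i).

Definition heis_mul p q : H :=
  heis_mk (heis_x p + heis_x q) (heis_y p + heis_y q)
          (heis_z p + heis_z q + 2^-1 * heis_im p q).

Definition heis_one : H := 0.
Definition heis_inv p : H := - p.

Lemma heis_mkK x y z :
  (heis_x (heis_mk x y z) = x) * (heis_y (heis_mk x y z) = y)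
  * (heis_z (heis_mk x y z) = z).
Proof.
by rewrite /heis_x /heis_y /heis_z !row_mxKl !row_mxKr mxE eqxx mulr1n.
Qed.

Lemma heis_ext p q :
  heis_x p = heis_x q -> heis_y p = heis_y q -> heis_z p = heis_z q -> p = q.
Proof.
move=> ex ey ez; rewrite -[p]hsubmxK -[q]hsubmxK; congr row_mx.
  by rewrite -[lsubmx p]hsubmxK -[lsubmx q]hsubmxK; congr row_mx.
by apply/matrixP => i j; rewrite !ord1.
Qed.

Lemma heis_mul1g p : heis_mul heis_one p = p.
Proof.
apply: heis_ext; rewrite heis_mkK.
- by rewrite /heis_x /heis_one !raddf0 add0r.
- by rewrite /heis_y /heis_one !raddf0 add0r.
rewrite /heis_im big1 => [|i _]; last first.
  by rewrite /heis_x /heis_y /heis_one !raddf0 !mxE !mul0r subrr.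
by rewrite /heis_z /heis_one raddf0 mxE add0r mulr0 addr0.
Qed.

Lemma heis_mulVg p : heis_mul (heis_inv p) p = heis_one.
Proof.
apply: heis_ext; rewrite heis_mkK.
- by rewrite /heis_x /heis_inv /heis_one !linearN !linear0 addNr.
- by rewrite /heis_y /heis_inv /heis_one !linearN !linear0 addNr.
rewrite /heis_im big1 => [|i _]; last first.
  rewrite /heis_x /heis_y /heis_inv !linearN !mxE !mulNr opprK.
  by rewrite [X in _ + X]mulrC addNr.
by rewrite /heis_z /heis_inv /heis_one !linearN !linear0 !mxE mulr0 addr0 addNr.
Qed.

Lemma heis_mulA p q r :
  heis_mul p (heis_mul q r) = heis_mul (heis_mul p q) r.
Proof.
apply: heis_ext; rewrite !heis_mkK ?addrA //.
have -> : heis_im p (heis_mul q r) = heis_im p q + heis_im p r.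
  rewrite -big_split; apply: eq_bigr => i _ /=.
  by rewrite !heis_mkK !mxE !mulrDr opprD addrACA.
have -> : heis_im (heis_mul p q) r = heis_im p r + heis_im q r.
  rewrite -big_split; apply: eq_bigr => i _ /=.
  by rewrite !heis_mkK !mxE !mulrDl opprD addrACA.
by ring.
Qed.

Record heis_subgroup : Type := HeisSubgroup {
  subgroup_set :> H -> Prop;
  subgroup_one : subgroup_set heis_one;
  subgroup_mul : forall p q,
    subgroup_set p -> subgroup_set q -> subgroup_set (heis_mul p q);
  subgroup_inv : forall p, subgroup_set p -> subgroup_set (heis_inv p) }.

(** The quotient [Gamma \ H_n] by left translations *)

Section Quotient.
Variable Gamma : heis_subgroup.

Definition orbit_rel : rel H := fun p q =>
  `[< exists2 gamma, Gamma gamma & q = heis_mul gamma p >].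

Lemma orbit_rel_refl : reflexive orbit_rel.
Proof.
move=> p; apply/asboolP; exists heis_one; first exact: subgroup_one.
by rewrite heis_mul1g.
Qed.

Lemma orbit_rel_sym : symmetric orbit_rel.
Proof.
suff imp p q : orbit_rel p q -> orbit_rel q p.
  by move=> p q; apply/idP/idP; exact: imp.
move=> /asboolP[gamma Gg ->]; apply/asboolP; exists (heis_inv gamma).
  exact: subgroup_inv.
by rewrite heis_mulA heis_mulVg heis_mul1g.
Qed.

Lemma orbit_rel_trans : transitive orbit_rel.
Proof.
move=> q p r /asboolP[a Ga ->] /asboolP[b Gb ->]; apply/asboolP.
by exists (heis_mul b a); [exact: subgroup_mul | rewrite heis_mulA].
Qed.

Canonical orbit_equiv_rel :=
  EquivRel orbit_rel orbit_rel_refl orbit_rel_sym orbit_rel_trans.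

Definition heis_quotient : Type := quotient_topology {eq_quot orbit_equiv_rel}.
HB.instance Definition _ := Topological.on heis_quotient.
HB.instance Definition _ := Quotient.on heis_quotient.

Definition quotient_proj (p : H) : heis_quotient := \pi_heis_quotient p.

Definition lattice : Prop :=
  (forall gamma, Gamma gamma -> \forall p \near gamma, Gamma p -> p = gamma) /\
  compact [set: heis_quotient].

(* The differential of the left translation by [p] at [q] is [u |-> 'D_u]. *)
Definition left_invariant (g : H -> 'M[R]_(n + n + 1)) : Prop :=
  forall p q u v,
    tensor_form g (heis_mul p q)
      ('D_u (heis_mul p) q) ('D_v (heis_mul p) q) = tensor_form g q u v.

(* Below, the metric of [Gamma \ H_n] is represented by its pullback [g] to
   [H_n]. Piecewise C^1 curves of the quotient are the projections of those of
   [H_n], with the same length. *)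
Definition quotient_dist (g : H -> 'M[R]_(n + n + 1)) (a b : heis_quotient) : R :=
  inf [set curve_length g c | c in
        [set c : R -> H | [/\ piecewise_C1 c, quotient_proj (c 0) = a
                            & quotient_proj (c 1) = b]]].

Definition fundamental_domain (F : set H) : Prop :=
  <<s (@open H) >> F /\ forall a : heis_quotient,
    exists! p, F p /\ quotient_proj p = a.

(* All Borel fundamental domains have the same volume, namely the total volume
   of the quotient, so that the infimum merely selects this common value. *)
Definition quotient_volume (g : H -> 'M[R]_(n + n + 1)) : \bar R :=
  ereal_inf [set riemannian_volume g F | F in fundamental_domain].

End Quotient.

Definition left_invariant_metric (g : H -> 'M[R]_(n + n + 1)) : Prop :=
  riemannian_metric g /\ left_invariant g.

End Heisenberg.

Arguments heis_subgroup R n : clear implicits.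

(* Main.v *)
(* Write [P] for a Cholesky factor of the metric at the origin. In the frame given
   by [P], the k-th manifold becomes a quotient [L \ (R^(2n+1), W)], where the
   product is [p + q + W(p, q) e / 2], [e] is the unit vector of the center and the
   left-invariant frame is orthonormal. For a unit vector [u] orthogonal to [e] one
   has [Ric(u, u) = - |u W|^2 / 2], so that [Ric >= K] bounds [W]. Hence the diameter
   bound makes the lattices [L] uniformly cobounded. A short element of [L] yields a
   thin domain meeting all orbits, so the volume bound makes them uniformly discrete;
   then the commutators of [L], which are integral multiples of one vector that is not
   short, keep the determinant of [W] away from 0.
   All these properties pass to the limits of [W], of [L] and of the quotient
   distances along an ultrafilter on the natural numbers. The limit bracket being
   nondegenerate, a symplectic basis identifies the limit group with the Heisenberg
   group, and Gromov--Hausdorff approximations converge to an isometry. *)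

Require Import Defs.
From mathcomp Require Import all_boot all_order all_algebra.
From mathcomp Require Import all_classical all_reals all_analysis.
From mathcomp Require Import perm measurable_realfun ring lra.

Set Implicit Arguments.
Unset Strict Implicit.
Unset Printing Implicit Defensive.

Import Order.TTheory GRing.Theory Num.Theory.
Import numFieldNormedType.Exports.

Local Open Scope classical_set_scope.
Local Open Scope ring_scope.

(** * Euclidean geometry of row vectors *)

(** The obstacle is degeneration: every bracket is nondegenerate, but a limit of nondegenerate
    brackets may be abelian, and a limit of lattices need not be discrete. Hence all bounds are
    explicit functions of [n], [D], [V], [K] alone. The determinant bound is arithmetic: pairing
    [2n] lattice elements by [W] gives [c] times an integral matrix with [c >= del], and a nonzero
    integral determinant is at least 1 in absolute value. These elements need not generate the
    lattice; it is enough that their horizontal parts are bounded and close to a multiple of the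
    standard basis. A Cholesky factor is preferred to other square roots of the metric because,
    being upper triangular, it maps [e] to a multiple of [e] and lets volumes be estimated one
    coordinate at a time. All groups then live on one vector space, where only [W] and [L] vary.
    Along an ultrafilter every bounded sequence converges, so that limits of all lattice elements,
    and of representatives of all points of the limit space, are available at once, without
    subsequences or diagonal arguments. *)

Section Euclid.
Context {R : realType} {N : nat}.
Implicit Types (u v w : 'rV[R]_N) (A B W : 'M[R]_N).

Definition dot u v : R := (u *m v^T) 0 0.
Definition enorm u : R := Num.sqrt (dot u u).
Definition bil W u v : R := dot (u *m W) v.

Lemma dotE u v : dot u v = \sum_i u 0 i * v 0 i.
Proof. by rewrite /dot mxE; apply: eq_bigr => i _; rewrite mxE. Qed.

Lemma dotC u v : dot u v = dot v u.
Proof. by rewrite !dotE; apply: eq_bigr => i _; rewrite mulrC. Qed.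

Lemma dotDl u v w : dot (u + v) w = dot u w + dot v w.
Proof. by rewrite /dot mulmxDl mxE. Qed.

Lemma dotDr u v w : dot u (v + w) = dot u v + dot u w.
Proof. by rewrite dotC dotDl !(dotC u). Qed.

Lemma dotZl a u v : dot (a *: u) v = a * dot u v.
Proof. by rewrite /dot -scalemxAl mxE. Qed.

Lemma dotZr a u v : dot u (a *: v) = a * dot u v.
Proof. by rewrite dotC dotZl dotC. Qed.

Lemma dotNl u v : dot (- u) v = - dot u v.
Proof. by rewrite -scaleN1r dotZl mulN1r. Qed.

Lemma dotNr u v : dot u (- v) = - dot u v.
Proof. by rewrite dotC dotNl dotC. Qed.

Lemma dotBl u v w : dot (u - v) w = dot u w - dot v w.
Proof. by rewrite dotDl dotNl. Qed.

Lemma dotBr u v w : dot u (v - w) = dot u v - dot u w.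
Proof. by rewrite dotDr dotNr. Qed.

Lemma dot0l u : dot 0 u = 0.
Proof. by rewrite /dot mul0mx mxE. Qed.

Lemma dot0r u : dot u 0 = 0.
Proof. by rewrite dotC dot0l. Qed.

Lemma dot_mulmx A u v : dot (u *m A) v = dot u (v *m A^T).
Proof. by rewrite /dot trmx_mul trmxK mulmxA. Qed.

Lemma dot_delta u i : dot u (delta_mx 0 i) = u 0 i.
Proof.
rewrite dotE (bigD1 i)//= mxE !eqxx mulr1 big1 ?addr0// => j ji.
by rewrite mxE (negPf ji) andbF mulr0.
Qed.

Lemma dot_ge0 u : 0 <= dot u u.
Proof. by rewrite dotE; apply: sumr_ge0 => i _; rewrite -expr2 sqr_ge0. Qed.

Lemma dot_eq0 u : (dot u u == 0) = (u == 0).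
Proof.
apply/idP/eqP => [|->]; last by rewrite dot0l.
rewrite dotE psumr_eq0 => [/allP h|i _]; last by rewrite -expr2 sqr_ge0.
apply/rowP => i; rewrite mxE; apply/eqP.
by have := h i (mem_index_enum i); rewrite /= -expr2 sqrf_eq0.
Qed.

Lemma dot_gt0 u : u != 0 -> 0 < dot u u.
Proof. by move=> u0; rewrite lt_def dot_ge0 dot_eq0 u0. Qed.

Lemma dot_CS u v : dot u v ^+ 2 <= dot u u * dot v v.
Proof.
have [->|v0] := eqVneq v 0; first by rewrite !dot0r mulr0 expr0n.
have := dot_ge0 (dot v v *: u - dot u v *: v).
rewrite !(dotBl, dotBr, dotZl, dotZr) (dotC v u) => h.
rewrite -(ler_pM2l (dot_gt0 v0)) -subr_ge0.
apply: le_trans h _; rewrite le_eqVlt; apply/orP; left; apply/eqP; ring.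
Qed.

Lemma enorm_ge0 u : 0 <= enorm u.
Proof. exact: sqrtr_ge0. Qed.

Lemma sqr_enorm u : enorm u ^+ 2 = dot u u.
Proof. by rewrite sqr_sqrtr ?dot_ge0. Qed.

Lemma enorm_le u c : 0 <= c -> (enorm u <= c) = (dot u u <= c ^+ 2).
Proof. by move=> c0; rewrite -sqr_enorm ler_pXn2r// nnegrE enorm_ge0. Qed.

Lemma normr_dot_le u v : `|dot u v| <= enorm u * enorm v.
Proof.
rewrite -(ler_pXn2r (n := 2))// ?nnegrE ?mulr_ge0 ?enorm_ge0//.
by rewrite real_normK ?num_real// exprMn !sqr_enorm dot_CS.
Qed.

Lemma enorm0 : enorm 0 = 0.
Proof. by rewrite /enorm dot0l sqrtr0. Qed.

Lemma enorm_eq0 u : (enorm u == 0) = (u == 0).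
Proof. by rewrite -dot_eq0 -sqr_enorm sqrf_eq0. Qed.

Lemma enormZ a u : enorm (a *: u) = `|a| * enorm u.
Proof. by rewrite /enorm dotZl dotZr mulrA -expr2 sqrtrM ?sqr_ge0// sqrtr_sqr. Qed.

Lemma enormN u : enorm (- u) = enorm u.
Proof. by rewrite /enorm dotNl dotNr opprK. Qed.

Lemma ler_enormD u v : enorm (u + v) <= enorm u + enorm v.
Proof.
rewrite enorm_le ?addr_ge0 ?enorm_ge0//.
rewrite !(dotDl, dotDr) (dotC v u) sqrrD !sqr_enorm.
have := le_trans (ler_norm _) (normr_dot_le u v); nra.
Qed.

Lemma normr_coord_le u i : `|u 0 i| <= enorm u.
Proof.
rewrite -dot_delta; apply: le_trans (normr_dot_le _ _) _.
suff -> : enorm (delta_mx 0 i) = 1 by rewrite mulr1.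
by rewrite /enorm dot_delta mxE !eqxx sqrtr1.
Qed.

Lemma enorm_le_norm u : enorm u <= N%:R * `|u|.
Proof.
rewrite enorm_le ?mulr_ge0// dotE.
have h i : u 0 i * u 0 i <= `|u| ^+ 2.
  apply: le_trans (ler_norm _) _; rewrite normrM -expr2.
  rewrite ler_pXn2r ?nnegrE// [leRHS]/Num.norm/= mx_normrE.
  by apply/bigmax_geP; right => /=; exists (0, i).
apply: le_trans (ler_sum _ (fun i _ => h i)) _.
rewrite sumr_const card_ord exprMn -[leLHS]mulr_natl ler_wpM2r ?sqr_ge0//.
by rewrite -natrX ler_nat; case: N => // m; rewrite leq_pmull.
Qed.

Lemma norm_le_enorm u : `|u| <= enorm u.
Proof.
rewrite [leLHS]/Num.norm/= mx_normrE; apply/bigmax_leP; split=> [|[i j] _ /=].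
  exact: enorm_ge0.
by rewrite ord1 normr_coord_le.
Qed.

Lemma bilDl W u v w : bil W (u + v) w = bil W u w + bil W v w.
Proof. by rewrite /bil mulmxDl dotDl. Qed.

Lemma bilDr W u v w : bil W w (u + v) = bil W w u + bil W w v.
Proof. by rewrite /bil dotDr. Qed.

Lemma bilZl W a u v : bil W (a *: u) v = a * bil W u v.
Proof. by rewrite /bil -scalemxAl dotZl. Qed.

Lemma bilZr W a u v : bil W u (a *: v) = a * bil W u v.
Proof. by rewrite /bil dotZr. Qed.

Lemma bilNl W u v : bil W (- u) v = - bil W u v.
Proof. by rewrite /bil mulNmx dotNl. Qed.

Lemma bilNr W u v : bil W u (- v) = - bil W u v.
Proof. by rewrite /bil dotNr. Qed.

Lemma bilBl W u v w : bil W (u - v) w = bil W u w - bil W v w.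
Proof. by rewrite bilDl bilNl. Qed.

Lemma bilBr W u v w : bil W w (u - v) = bil W w u - bil W w v.
Proof. by rewrite bilDr bilNr. Qed.

Lemma bil0l W u : bil W 0 u = 0.
Proof. by rewrite /bil mul0mx dot0l. Qed.

Lemma bil0r W u : bil W u 0 = 0.
Proof. by rewrite /bil dot0r. Qed.

Lemma bil_skew W u v : W^T = - W -> bil W u v = - bil W v u.
Proof. by move=> h; rewrite /bil dot_mulmx h mulmxN dotNr dotC. Qed.

Lemma bil_diag W u : W^T = - W -> bil W u u = 0.
Proof. by move=> h; have := bil_skew u u h; lra. Qed.

Lemma bil_delta W i j : bil W (delta_mx 0 i) (delta_mx 0 j) = W i j.
Proof. by rewrite /bil dot_delta -rowE mxE. Qed.

Lemma bilB_mx W W' u v : bil (W - W') u v = bil W u v - bil W' u v.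
Proof. by rewrite /bil mulmxBr dotBl. Qed.

(** One factor [N%:R] comes from comparing [enorm] with the maximum norm, the other from the sum in
    an entry of the product. The case [c <= 0] is treated apart, as [c] may be negative when [N] is
    0. *)
Lemma enorm_mulmx_le u A c : (forall i j, `|A i j| <= c) ->
  enorm (u *m A) <= N%:R ^+ 2 * c * enorm u.
Proof.
case: (ltrP 0 c) => c0; last first.
  move=> h; have -> : A = 0.
    apply/matrixP => i j; rewrite mxE; apply/eqP; rewrite -normr_le0.
    exact: le_trans c0.
  rewrite mulmx0 enorm0; have [i|] := pickP (@predT 'I_N); last first.
    move=> hN; rewrite [u](_ : _ = 0) ?enorm0 ?mulr0//.
    by apply/rowP => i; have := hN i.
  have -> : c = 0.
    by apply/eqP; rewrite eq_le c0 (le_trans _ (h i i)).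
  by rewrite mulr0 mul0r.
move=> h; apply: le_trans (enorm_le_norm _) _.
rewrite expr2 -!mulrA ler_wpM2l// [leLHS]/Num.norm/= mx_normrE.
apply/bigmax_leP; split=> [|[i j] _ /=].
  by rewrite mulr_ge0// mulr_ge0 ?enorm_ge0// ltW.
rewrite mxE; apply: le_trans (ler_norm_sum _ _ _) _.
have hk k : `|u i k * A k j| <= c * enorm u.
  by rewrite normrM mulrC ler_pM// ord1 normr_coord_le.
apply: le_trans (ler_sum _ (fun k _ => hk k)) _.
by rewrite sumr_const card_ord mulr_natl.
Qed.

Lemma normr_bil_le W u v c : (forall i j, `|W i j| <= c) ->
  `|bil W u v| <= N%:R ^+ 2 * c * enorm u * enorm v.
Proof.
move=> h; apply: le_trans (normr_dot_le _ _) _.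
by rewrite ler_wpM2r ?enorm_ge0// enorm_mulmx_le.
Qed.

End Euclid.

(** * Two-step groups on row vectors and their left-invariant metrics *)

(** Sylvester's identity: the same block matrix is factored in two ways into block triangular
    matrices. *)
Lemma det_add1_mulmx (R : comNzRingType) (m n : nat) (A : 'M[R]_(m, n))
    (B : 'M[R]_(n, m)) : \det (1%:M + A *m B) = \det (1%:M + B *m A).
Proof.
have := congr1 determinant (erefl (block_mx 1%:M (- A) B 1%:M)).
rewrite {1}(_ : block_mx _ _ _ _ =
  block_mx (1%:M + A *m B) (- A) 0 1%:M *m block_mx 1%:M 0 B 1%:M); last first.
  rewrite mulmx_block !(mulmx1, mulmx0, mul0mx, mul1mx, addr0, add0r) mulNmx.
  by rewrite addrK.
rewrite [in RHS](_ : block_mx _ _ _ _ =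
  block_mx 1%:M 0 B 1%:M *m block_mx 1%:M (- A) 0 (1%:M + B *m A)); last first.
  rewrite mulmx_block !(mulmx1, mulmx0, mul0mx, mul1mx, addr0, add0r) mulmxN.
  by rewrite addrCA addNr addr0.
by rewrite !det_mulmx !det_lblock !det_ublock !det1 !(mul1r, mulr1).
Qed.

Section Group.
Context {R : realType} {N : nat} (e : 'rV[R]_N).
Implicit Types (p q r u v : 'rV[R]_N) (W G P : 'M[R]_N).

Definition gmul W p q := p + q + (2^-1 * bil W p q) *: e.

(* [u *m frame W p] is the value at [p] of the left-invariant coframe on [u]. *)
Definition frame W p : 'M[R]_N := 1%:M - 2^-1 *: (W^T *m p^T *m e).
(** The metric equal to [G] at the origin and transported by the left-invariant coframe; [speed] is
    its norm for [G = 1%:M]. *)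
Definition gmetric W G p : 'M[R]_N := frame W p *m G *m (frame W p)^T.
Definition speed W p u : R := enorm (u - (2^-1 * bil W p u) *: e).

Lemma mulmx_frame W p u : u *m frame W p = u - (2^-1 * bil W p u) *: e.
Proof.
rewrite /frame mulmxBr mulmx1 -scalemxAr !mulmxA -scalerA; congr (_ - _ *: _).
rewrite [u *m _ *m _]mx11_scalar mul_scalar_mx; congr (_ *: _).
by rewrite /bil dot_mulmx dotC.
Qed.

Lemma tensor_form_gmetric W G p u v :
  tensor_form (gmetric W G) p u v = dot (u *m frame W p *m G) (v *m frame W p).
Proof. by rewrite /tensor_form /gmetric /dot trmx_mul !mulmxA. Qed.

Lemma tensor_form_gmetric1 W P p u :
  tensor_form (gmetric W (P *m P^T)) p u u = dot (u *m frame W p *m P) (u *m frame W p *m P).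
Proof. by rewrite tensor_form_gmetric mulmxA dot_mulmx trmxK. Qed.

Lemma sqrt_gmetric1 W p u :
  Num.sqrt (tensor_form (gmetric W 1%:M) p u u) = speed W p u.
Proof. by rewrite tensor_form_gmetric mulmx1 mulmx_frame. Qed.

(** These two conditions turn [gmul] into a two-step nilpotent group with [e] central and [- p]
    inverse to [p]. *)
Definition bracket_form W := W^T = - W /\ e *m W = 0.

Lemma gmul0g W p : gmul W 0 p = p.
Proof. by rewrite /gmul bil0l mulr0 scale0r addr0 add0r. Qed.

Lemma gmulg0 W p : gmul W p 0 = p.
Proof. by rewrite /gmul bil0r mulr0 scale0r !addr0. Qed.

Lemma gmul_frame W p q : gmul W p q = p + q *m frame W (- p).
Proof. by rewrite mulmx_frame bilNl mulrN scaleNr opprK addrA. Qed.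

Section Alternating.
Variables (W : 'M[R]_N) (altW : bracket_form W).

Lemma bil_axisl p : bil W e p = 0.
Proof. by rewrite /bil altW.2 dot0l. Qed.

Lemma bil_axisr p : bil W p e = 0.
Proof. by rewrite bil_skew ?bil_axisl ?oppr0//; case: altW. Qed.

Lemma bil_alt p : bil W p p = 0.
Proof. by rewrite bil_diag//; case: altW. Qed.

Lemma bil_gmull p q r : bil W (gmul W p q) r = bil W p r + bil W q r.
Proof. by rewrite /gmul !bilDl bilZl bil_axisl mulr0 addr0. Qed.

Lemma bil_gmulr p q r : bil W r (gmul W p q) = bil W r p + bil W r q.
Proof. by rewrite /gmul !bilDr bilZr bil_axisr mulr0 addr0. Qed.

Lemma gmulgN p : gmul W p (- p) = 0.
Proof. by rewrite /gmul bilNr bil_alt oppr0 mulr0 scale0r addr0 subrr. Qed.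

Lemma gmulNg p : gmul W (- p) p = 0.
Proof. by rewrite -{2}[p]opprK gmulgN. Qed.

Lemma gmulA p q r : gmul W p (gmul W q r) = gmul W (gmul W p q) r.
Proof.
rewrite {1}/gmul bil_gmulr [in RHS]/gmul bil_gmull /gmul !mulrDr !scalerDl !addrA.
apply/rowP => i; rewrite !mxE; ring.
Qed.

Lemma gmulKg p q : gmul W (- p) (gmul W p q) = q.
Proof. by rewrite gmulA gmulNg gmul0g. Qed.

Lemma gmulgK p q : gmul W (gmul W q p) (- p) = q.
Proof. by rewrite -gmulA gmulgN gmulg0. Qed.

Lemma gmul_eq0 p q : gmul W p q = 0 -> q = - p.
Proof. by move=> h; rewrite -(gmulKg p q) h gmulg0. Qed.

(** The correction terms point along [e], which [W] annihilates, so that a product of two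
    corrections vanishes. This makes every [frame W p] invertible, with inverse [frame W (- p)]. *)
Lemma frameD p q : frame W p *m frame W q = frame W (p + q).
Proof.
apply/row_matrixP => i; rewrite !rowE mulmxA !mulmx_frame bilBr bilZr bil_axisr.
rewrite mulr0 subr0 bilDl mulrDr scalerDl opprD addrA //.
Qed.

Lemma frame0 : frame W 0 = 1%:M.
Proof. by rewrite /frame trmx0 mulmx0 mul0mx scaler0 subr0. Qed.

Lemma frameK p : frame W p *m frame W (- p) = 1%:M.
Proof. by rewrite frameD subrr frame0. Qed.

Lemma frame_gmul p q u :
  u *m frame W (- p) *m frame W (gmul W p q) = u *m frame W q.
Proof.
rewrite -mulmxA frameD; congr (_ *m _).
apply/row_matrixP => i; rewrite !rowE !mulmx_frame bilDl bil_gmull bilNl.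
by rewrite addKr.
Qed.

(** A rank one perturbation of the identity: Sylvester's identity reduces the determinant to size 1,
    where [e *m W = 0] removes the perturbation. So left-invariant metrics have constant volume
    density. *)
Lemma det_frame p : \det (frame W p) = 1.
Proof.
rewrite /frame -scaleNr scalemxAl det_add1_mulmx -scalemxAr mulmxA.
rewrite altW.1 mulmxN altW.2 oppr0 mul0mx scaler0 addr0.
exact: det1.
Qed.

(** Left invariance, since [frame W (- p)] is the linear part of the left translation by [p]
    ([gmul_frame]). *)
Lemma gmetric_gmul G p q u v :
  tensor_form (gmetric W G) (gmul W p q) (u *m frame W (- p)) (v *m frame W (- p))
  = tensor_form (gmetric W G) q u v.
Proof.
rewrite (tensor_form_gmetric W G (gmul W p q)) (tensor_form_gmetric W G q).
by rewrite (frame_gmul p q u) (frame_gmul p q v).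
Qed.

End Alternating.
End Group.

(** * Cholesky frames and the volume of slabs *)

Section Cholesky.
Context {R : realType}.

(** [is_trig_mx] means lower triangular, whence the transpose. For row vectors, the first coordinate
    of [v *m P] then depends only on the first coordinate of [v]. *)
Definition pos_upper N (P : 'M[R]_N) : Prop :=
  is_trig_mx P^T /\ forall i, 0 < P i i.

Lemma det_pos_upper N (P : 'M[R]_N) : pos_upper P -> \det P = \prod_i P i i.
Proof.
by move=> [tP _]; rewrite -det_tr det_trig//; apply: eq_bigr => i _; rewrite mxE.
Qed.

Lemma pos_upper_det_gt0 N (P : 'M[R]_N) : pos_upper P -> 0 < \det P.
Proof. by move=> uP; rewrite det_pos_upper//; apply: prodr_gt0 => i _; apply: uP.2. Qed.

Lemma pos_upper_unit N (P : 'M[R]_N) : pos_upper P -> P \in unitmx.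
Proof. by move=> uP; rewrite unitmxE unitfE gt_eqF// pos_upper_det_gt0. Qed.

Lemma pos_upper_block N (P : 'M[R]_(1 + N)) :
  pos_upper P <-> [/\ dlsubmx P = 0, 0 < ulsubmx P 0 0 & pos_upper (drsubmx P)].
Proof.
split=> [[/is_trig_mxP tP dP]|[P0 d0 [/is_trig_mxP tP dP]]].
  split.
  - apply/matrixP => i j; rewrite ord1 !mxE.
    by have := tP (lshift N 0) (rshift 1 i) isT; rewrite mxE.
  - by rewrite !mxE; exact: dP.
  - split=> [|i]; last by rewrite !mxE.
    apply/is_trig_mxP => i j ij; rewrite !mxE.
    by have := tP (rshift 1 i) (rshift 1 j); rewrite mxE; apply.
split.
  apply/is_trig_mxP => i j; rewrite mxE.
  case: (split_ordP i) => i' ->; case: (split_ordP j) => j' -> /=.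
  - by rewrite !ord1.
  - by move=> _; have /matrixP/(_ j' i') := P0; rewrite !mxE.
  - by rewrite [j']ord1 ltn0.
  - by rewrite ltn_add2l => ij; have := tP i' j' ij; rewrite !mxE.
move=> i; case: (split_ordP i) => i' ->.
  by move: d0; rewrite !mxE ord1.
by have := dP i'; rewrite !mxE.
Qed.

Lemma pos_upperM N (P Q : 'M[R]_N) : pos_upper P -> pos_upper Q -> pos_upper (P *m Q).
Proof.
elim: N P Q => [P Q _ _|N IH].
  by split; [apply/is_trig_mxP => -[]|case].
change (forall P Q : 'M[R]_(1 + N), pos_upper P -> pos_upper Q -> pos_upper (P *m Q)).
move=> P Q.
move=> /pos_upper_block[P0 dP uP] /pos_upper_block[Q0 dQ uQ].
rewrite -[P]submxK -[Q]submxK P0 Q0 mulmx_block; apply/pos_upper_block.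
rewrite block_mxKdl block_mxKul block_mxKdr !(mulmx0, mul0mx, addr0, add0r).
split=> //; last exact: IH.
by rewrite mxE big_ord1 mulr_gt0.
Qed.

Lemma bil_block N (a : 'M[R]_1) (b : 'rV[R]_N) c (H : 'M[R]_N) (x : 'M[R]_1) v :
  bil (block_mx a b c H) (row_mx x v) (row_mx x v)
  = ((x *m a + v *m c) *m x^T + (x *m b + v *m H) *m v^T) 0 0.
Proof. by rewrite /bil mul_row_block /dot tr_row_mx mul_row_col. Qed.

(** Since the factor is upper triangular, the recursion starts from the lower right block: [r]
    solves the off-diagonal equation, and [d2] is the Schur complement. *)
Lemma cholesky N (G : 'M[R]_N) : G^T = G ->
  (forall u, u != 0 -> 0 < bil G u u) ->
  exists P, pos_upper P /\ G = P *m P^T.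
Proof.
elim: N G => [|N IH].
  move=> G _ _; exists 1%:M; split; last by apply/matrixP => -[].
  by split; [apply/is_trig_mxP => -[]|case].
change (forall G : 'M[R]_(1 + N), G^T = G ->
  (forall u, u != 0 -> 0 < bil G u u) -> exists P, pos_upper P /\ G = P *m P^T).
move=> G Gt Gpos.
have Ht : (drsubmx G)^T = drsubmx G by rewrite trmx_drsub Gt.
have [v v0|P [uP HP]] := IH _ Ht.
  have v0' : row_mx (0 : 'rV_1) v != 0.
    by apply: contraNneq v0 => /eqP; rewrite row_mx_eq0 => /andP[_ ->].
  have := Gpos _ v0'; rewrite -{1}[G]submxK bil_block.
  by rewrite !mul0mx !add0r trmx0 mulmx0 add0r.
have Pu := pos_upper_unit uP.
pose r := ursubmx G *m (invmx P)^T.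
pose d2 := ulsubmx G - r *m r^T.
have rPt : r *m P^T = ursubmx G.
  by rewrite /r -mulmxA -trmx_mul mulmxV// trmx1 mulmx1.
have dlE : dlsubmx G = P *m r^T.
  by rewrite -{1}Gt -trmx_ursub -rPt trmx_mul trmxK.
(* The Schur complement is the value of the form at [row_mx 1 (- r P^-1)]. *)
have d2pos : 0 < d2 0 0.
  pose v := - r *m invmx P.
  have v0 : row_mx (1%:M : 'M[R]_1) v != 0.
    rewrite row_mx_eq0 negb_and; apply/orP; left.
    by apply/eqP => /matrixP/(_ 0 0)/eqP; rewrite !mxE eqxx oner_eq0.
  have := Gpos _ v0; rewrite -{1}[G]submxK bil_block.
  rewrite dlE HP !mul1mx trmx1 mulmx1 /v.
  rewrite [_ *m invmx P *m (P *m r^T)]mulmxA [_ *m invmx P *m (P *m P^T)]mulmxA.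
  by rewrite mulmxKV// !mulNmx rPt subrr mul0mx addr0.
exists (block_mx ((Num.sqrt (d2 0 0))%:M : 'M[R]_1) r 0 P); split.
  apply/pos_upper_block; rewrite block_mxKdl block_mxKul block_mxKdr; split=> //.
  by rewrite mxE eqxx mulr1n sqrtr_gt0.
rewrite tr_block_mx mulmx_block !(mulmx0, mul0mx, addr0, add0r) trmx0.
rewrite mulmx0 add0r -{1}[G]submxK; congr block_mx => //.
rewrite tr_scalar_mx -scalar_mxM -expr2 sqr_sqrtr ?ltW//.
by rewrite -mx11_scalar /d2 subrK.
Qed.

End Cholesky.

(* No measurability is needed: for nonnegative functions the integral is
   defined as a lower integral. *)
Lemma le_lower_integral d (T : measurableType d) (R : realType)
    (mu : {measure set T -> \bar R}) (f g : T -> \bar R) :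
  (forall x, (0 <= f x)%E) -> (forall x, (f x <= g x)%E) ->
  (\int[mu]_x f x <= \int[mu]_x g x)%E.
Proof.
move=> f0 fg; have g0 x : (0 <= g x)%E by exact: le_trans (fg x).
rewrite !ge0_integralTE//; apply: le_ereal_sup => _ [h hf <-].
by exists h => // x; exact: le_trans (hf x) (fg x).
Qed.

Section SlabVolume.
Context {R : realType}.

Lemma lebesgue_integral_rVS N (f : 'rV[R]_(1 + N) -> \bar R) :
  lebesgue_integral_rV f = (\int[lebesgue_measure]_(x in [set: R])
    lebesgue_integral_rV (fun v => f (row_mx (x%:M : 'M[R]_1) v)))%E.
Proof. by []. Qed.

Lemma lebesgue_integral_rV_ge0 N (f : 'rV[R]_N -> \bar R) :
  (forall v, (0 <= f v)%E) -> (0 <= lebesgue_integral_rV f)%E.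
Proof.
elim: N f => [|N IH] f f0 /=; first exact: f0.
by apply: integral_ge0 => x _; apply: IH => v; exact: f0.
Qed.

Lemma lebesgue_integral_rV0 N (f : 'rV[R]_N -> \bar R) :
  (forall v, f v = 0%E) -> lebesgue_integral_rV f = 0%E.
Proof.
elim: N f => [|N IH] f f0 /=; first exact: f0.
by apply: integral0_eq => x _; apply: IH => v; exact: f0.
Qed.

(* By induction on the dimension: [P] being upper triangular, fixing the first
   coordinate only shifts the center of the remaining slab. *)
Lemma lebesgue_integral_rV_slab N (P : 'M[R]_N) (b : 'rV[R]_N) (r M : R)
    (f : 'rV[R]_N -> \bar R) : pos_upper P -> 0 <= r -> 0 <= M ->
  (forall v, (0 <= f v <= M%:E)%E) ->
  (forall v, f v != 0%E -> forall i, `|(v *m P - b) 0 i| <= r) ->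
  (lebesgue_integral_rV f <= (M * ((2 * r) ^+ N / \det P))%:E)%E.
Proof.
move=> + r0 M0; elim: N P b f => [P b f uP fM fs|N IH].
  rewrite det_mx00 expr0 divr1 mulr1 /=.
  by have /andP[] := fM 0.
change (forall (P : 'M[R]_(1 + N)) (b : 'rV[R]_(1 + N)) (f : 'rV[R]_(1 + N) -> \bar R),
  pos_upper P -> (forall v, (0 <= f v <= M%:E)%E) ->
  (forall v, f v != 0%E -> forall i, `|(v *m P - b) 0 i| <= r) ->
  (lebesgue_integral_rV f <= (M * ((2 * r) ^+ N.+1 / \det P))%:E)%E).
move=> P b f + fM fs => /pos_upper_block[P0 d0 uP'].
set d := ulsubmx P 0 0 in d0.
pose c := M * ((2 * r) ^+ N / \det (drsubmx P)).
have c0 : 0 <= c.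
  apply: mulr_ge0 => //; apply: divr_ge0; first by apply: exprn_ge0; lra.
  by rewrite ltW// pos_upper_det_gt0.
pose b0 := lsubmx b 0 0.
pose I : set R := `[(b0 - r) / d, (b0 + r) / d]%classic.
have rowE x v : row_mx (x%:M : 'M[R]_1) v *m P =
    row_mx (x *: ulsubmx P) (x *: ursubmx P + v *m drsubmx P).
  by rewrite -{1}[P]submxK mul_row_block P0 mulmx0 addr0 !mul_scalar_mx.
have outI x v : f (row_mx (x%:M : 'M[R]_1) v) != 0%E -> I x.
  move=> /fs/(_ (lshift N 0)); rewrite rowE -[b]hsubmxK.
  rewrite mxE (row_mxEl (_ *: _)) [in X in (_ + X)]mxE (row_mxEl (lsubmx b)).
  rewrite mxE -/d -/b0 ler_norml => /andP[h1 h2].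
  by rewrite /I /= in_itv /= ler_pdivrMr// ler_pdivlMr//; apply/andP; split; lra.
rewrite lebesgue_integral_rVS.
apply: (@le_trans _ _ (\int[lebesgue_measure]_(x in [set: R]) (c%:E * (\1_I x)%:E))%E).
  (* The inner integral is at most [c] on [I] by induction and vanishes outside [I]. Comparing with
     the indicator of [I] spares any measurability of the inner integral in [x]. *)
  apply: le_lower_integral => x.
  - by apply: lebesgue_integral_rV_ge0 => v; have /andP[] := fM (row_mx x%:M v).
  - rewrite indicE; case: (boolP (x \in I)) => [xI|/negP xI].
      rewrite mule1; apply: (IH _ (rsubmx b - x *: ursubmx P)) => //.
      move=> v /fs h i; have := h (rshift 1 i).
      rewrite rowE -{1}[b]hsubmxK mxE (row_mxEr (_ *: _)).
      rewrite [in X in (_ + X)]mxE (row_mxEr (lsubmx b)) !mxE => {}h.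
      by apply: le_trans h; rewrite le_eqVlt; apply/orP; left; apply/eqP; congr `|_|; ring.
    rewrite mule0 lebesgue_integral_rV0// => v; apply/eqP/negP => /negP/outI.
    by move=> /mem_set.
have mI : measurable I by exact: measurable_itv.
rewrite ge0_integralZl//; last by apply/measurable_EFinP; exact: measurable_indic.
rewrite integral_indic// setIT.
have detE : \det P = d * \det (drsubmx P).
  by rewrite -{1}[P]submxK P0 det_ublock det_mx11.
have D0 := pos_upper_det_gt0 uP'.
have muI : (lebesgue_measure I <= (2 * r / d)%:E)%E.
  rewrite lebesgue_measure_itv/= lte_fin.
  case: ifPn => _; rewrite -?EFinB lee_fin.
    by rewrite le_eqVlt; apply/orP; left; apply/eqP; field; rewrite gt_eqF.
  by rewrite divr_ge0 ?(ltW d0)//; lra.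
have c0' : (0 <= c%:E)%E by rewrite lee_fin.
apply: le_trans (lee_wpmul2l c0' muI) _.
rewrite -EFinM lee_fin /c detE exprS le_eqVlt; apply/orP; left; apply/eqP.
by field; rewrite !gt_eqF.
Qed.

End SlabVolume.

(** * Limits of matrices and piecewise smooth curves *)

Section MatrixLimits.
Context {R : realType} {T : Type} (F : set_system T) {FF : Filter F}.

Lemma cvg_mxP m n (f : T -> 'M[R]_(m, n)) (A : 'M[R]_(m, n)) :
  (forall i j, f x i j @[x --> F] --> A i j) -> f x @[x --> F] --> A.
Proof.
move=> h; apply/cvg_ballP => eps eps0.
suff : \forall x \near F, forall ij : 'I_m * 'I_n,
    ball (A ij.1 ij.2) eps (f x ij.1 ij.2).
  apply: filterS => x hx; split=> // i j; exact: (hx (i, j)).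
by apply: filter_forall => -[i j]; exact: (cvg_ball (h i j)).
Qed.

Lemma cvg_coord m n (f : T -> 'M[R]_(m, n)) (A : 'M[R]_(m, n)) i j :
  f x @[x --> F] --> A -> f x i j @[x --> F] --> A i j.
Proof.
move=> h; apply: (@continuous_cvg _ _ _ F FF f (fun M : 'M[R]_(m, n) => M i j) A _ h).
exact: coord_continuous.
Qed.

Lemma cvg_sumr n (f : 'I_n -> T -> R) (l : 'I_n -> R) :
  (forall i, f i x @[x --> F] --> l i) ->
  \sum_i f i x @[x --> F] --> \sum_i l i.
Proof. by move=> h; apply: cvg_big => //; exact: add_continuous. Qed.

Lemma cvg_prodr n (f : 'I_n -> T -> R) (l : 'I_n -> R) :
  (forall i, f i x @[x --> F] --> l i) ->
  \prod_i f i x @[x --> F] --> \prod_i l i.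
Proof. by move=> h; apply: cvg_big => //; exact: mul_continuous. Qed.

Lemma cvg_mulmx m n p (f : T -> 'M[R]_(m, n)) (g : T -> 'M[R]_(n, p)) (A : 'M[R]_(m, n))
    (B : 'M[R]_(n, p)) :
  f x @[x --> F] --> A -> g x @[x --> F] --> B ->
  f x *m g x @[x --> F] --> A *m B.
Proof.
move=> hf hg; apply: cvg_mxP => i j; rewrite mxE.
under eq_fun do rewrite mxE.
by apply: cvg_sumr => k; apply: cvgM; exact: cvg_coord.
Qed.

Lemma cvg_trmx m n (f : T -> 'M[R]_(m, n)) (A : 'M[R]_(m, n)) :
  f x @[x --> F] --> A -> (f x)^T @[x --> F] --> A^T.
Proof.
move=> hf; apply: cvg_mxP => i j; rewrite mxE.
by under eq_fun do rewrite mxE; exact: cvg_coord.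
Qed.

Lemma cvg_det n (f : T -> 'M[R]_n) (A : 'M[R]_n) :
  f x @[x --> F] --> A -> \det (f x) @[x --> F] --> \det A.
Proof.
move=> hf; rewrite /determinant.
apply: cvg_big => [|s _]; first exact: add_continuous.
apply: cvgM; first exact: cvg_cst.
by apply: cvg_prodr => i; exact: cvg_coord.
Qed.

Lemma cvg_dot N (f g : T -> 'rV[R]_N) (u v : 'rV[R]_N) :
  f x @[x --> F] --> u -> g x @[x --> F] --> v ->
  dot (f x) (g x) @[x --> F] --> dot u v.
Proof.
by move=> hf hg; apply: cvg_coord; apply: cvg_mulmx => //; exact: cvg_trmx.
Qed.

Lemma cvg_bil N (W : T -> 'M[R]_N) (f g : T -> 'rV[R]_N)
    (A : 'M[R]_N) (u v : 'rV[R]_N) :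
  W x @[x --> F] --> A ->
  f x @[x --> F] --> u -> g x @[x --> F] --> v ->
  bil (W x) (f x) (g x) @[x --> F] --> bil A u v.
Proof. by move=> hW hf hg; apply: cvg_dot => //; exact: cvg_mulmx. Qed.

Lemma cvg_enorm N (f : T -> 'rV[R]_N) (u : 'rV[R]_N) :
  f x @[x --> F] --> u -> enorm (f x) @[x --> F] --> enorm u.
Proof.
move=> hf; apply: (@continuous_cvg _ _ _ F FF (fun x => dot (f x) (f x)) Num.sqrt).
  exact: sqrt_continuous.
exact: cvg_dot.
Qed.

Lemma cvg_gmul N (e : 'rV[R]_N) (W : T -> 'M[R]_N) (f g : T -> 'rV[R]_N)
    (A : 'M[R]_N) (u v : 'rV[R]_N) :
  W x @[x --> F] --> A ->
  f x @[x --> F] --> u -> g x @[x --> F] --> v ->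
  gmul e (W x) (f x) (g x) @[x --> F] --> gmul e A u v.
Proof.
move=> hW hf hg; apply: cvgD; first exact: cvgD.
apply: cvgZr_tmp; apply: cvgM; first exact: cvg_cst.
exact: cvg_bil.
Qed.

Lemma cvg_frame N (e : 'rV[R]_N) (W : 'M[R]_N) (f : T -> 'rV[R]_N) (u : 'rV[R]_N) :
  f x @[x --> F] --> u -> frame e W (f x) @[x --> F] --> frame e W u.
Proof.
move=> hf; apply: cvgB; first exact: cvg_cst.
apply: cvgZl_tmp; apply: cvg_mulmx; last exact: cvg_cst.
by apply: cvg_mulmx; [exact: cvg_cst|exact: cvg_trmx].
Qed.

Lemma cvg_gmetric N (e : 'rV[R]_N) (W G : 'M[R]_N) (f : T -> 'rV[R]_N) (u : 'rV[R]_N) :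
  f x @[x --> F] --> u -> gmetric e W G (f x) @[x --> F] --> gmetric e W G u.
Proof.
move=> hf; apply: cvg_mulmx; last exact/cvg_trmx/cvg_frame.
by apply: cvg_mulmx; [exact: cvg_frame|exact: cvg_cst].
Qed.

Lemma cvg_tensor_form N (g : 'rV[R]_N -> 'M[R]_N) (f h : T -> 'rV[R]_N)
    (p u : 'rV[R]_N) :
  {for p, continuous g} -> f x @[x --> F] --> p -> h x @[x --> F] --> u ->
  tensor_form g (f x) (h x) (h x) @[x --> F] --> tensor_form g p u u.
Proof.
move=> cg hf hh; apply: cvg_coord; apply: cvg_mulmx; last exact: cvg_trmx.
by apply: cvg_mulmx => //; exact: (@continuous_cvg _ _ _ F FF f g).
Qed.

End MatrixLimits.

(** * Affine images and pieces of piecewise C^1 curves *)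

Section Curves.
Context {R : realType}.
Notation mu := (@lebesgue_measure R).

Lemma is_derive_cvg (V : normedModType R) (f : R -> V) t df :
  h^-1 *: (f (h + t) - f t) @[h --> (0 : R)^'] --> df -> is_derive t (1:R) f df.
Proof.
have E : (fun h : R => h^-1 *: ((f \o shift t) (h *: (1:R)) - f t)) =
  (fun h => h^-1 *: (f (h + t) - f t)) by apply/funext => h /=; rewrite scaler1.
by move=> h; split; [rewrite /derivable E; exact: cvgP h|rewrite /derive E; exact: cvg_lim h].
Qed.

Lemma cvg_is_derive (V : normedModType R) (f : R -> V) t df :
  is_derive t (1:R) f df -> h^-1 *: (f (h + t) - f t) @[h --> (0 : R)^'] --> df.
Proof.
have E : (fun h : R => h^-1 *: ((f \o shift t) (h *: (1:R)) - f t)) =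
  (fun h => h^-1 *: (f (h + t) - f t)) by apply/funext => h /=; rewrite scaler1.
by move=> [fd <-]; move: fd; rewrite /derivable /derive E.
Qed.

(** This form covers both linear images of curves and the correction [s *: b + d] that later moves
    the two endpoints of a curve to prescribed points. *)
Lemma is_derive_affine N M (c : R -> 'rV[R]_N) (A : 'M[R]_(N, M)) b d t dc :
  is_derive t (1:R) c dc ->
  is_derive t (1:R) (fun s => c s *m A + s *: b + d) (dc *m A + b).
Proof.
move=> /cvg_is_derive hc; apply: is_derive_cvg.
have : (h^-1 *: (c (h + t) - c t)) *m A + b @[h --> (0 : R)^'] --> dc *m A + b.
  by apply: cvgD; [apply: cvg_mulmx => //|]; exact: cvg_cst.
apply: cvg_trans; apply: near_eq_cvg.
near=> h; have h0 : h != 0 by near: h; exact: nbhs_dnbhs_neq.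
rewrite -scalemxAl mulmxBl; apply: (scalerI h0); rewrite scalerDr !scalerA mulfV//.
rewrite !scale1r scalerDl; apply/rowP => i; rewrite !mxE; ring.
Unshelve. all: by end_near. Qed.

Lemma is_derive_dot N (c : R -> 'rV[R]_N) a t dc :
  is_derive t (1:R) c dc -> is_derive t (1:R) (fun s => dot (c s) a) (dot dc a).
Proof.
move=> /cvg_is_derive hc; apply: is_derive_cvg.
have : dot (h^-1 *: (c (h + t) - c t)) a @[h --> (0 : R)^'] --> dot dc a.
  by apply: cvg_dot => //; exact: cvg_cst.
apply: cvg_trans; apply: near_eq_cvg.
by near=> h; rewrite dotZl dotBl.
Unshelve. all: by end_near. Qed.

Lemma C1_affine N M (c : R -> 'rV[R]_N) (A : 'M[R]_(N, M)) b d :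
  C1_curve c -> C1_curve (fun s => c s *m A + s *: b + d).
Proof.
move=> [dc cc].
have D t : is_derive t (1:R) (fun s => c s *m A + s *: b + d) (c^`()%classic t *m A + b).
  by apply: is_derive_affine; rewrite derive1E; exact: derivableP.
split=> [t|]; first exact: (@ex_derive _ _ _ _ _ _ _ (D t)).
rewrite (_ : derive1 _ = fun t => c^`()%classic t *m A + b); last first.
  by apply/funext => t; rewrite derive1E; exact: derive_val.
move=> t; apply: cvgD; last exact: cvg_cst.
by apply: cvg_mulmx; [exact: cc|exact: cvg_cst].
Qed.

Lemma piecewise_C1_affine N M (c : R -> 'rV[R]_N) (A : 'M[R]_(N, M)) b d :
  piecewise_C1 c -> piecewise_C1 (fun s => c s *m A + s *: b + d).
Proof.
move=> [s [ps ls cs]]; exists s; split=> // i /cs[gamma C1g cg].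
exists (fun s => gamma s *m A + s *: b + d); first exact: C1_affine.
by move=> t /cg ->.
Qed.

Lemma C1_cst N (v : 'rV[R]_N) : C1_curve (fun _ : R => v).
Proof.
have D t : is_derive t (1:R) (fun _ : R => v) 0 by exact: is_derive_cst.
split=> [t|]; first exact: (@ex_derive _ _ _ _ _ _ _ (D t)).
rewrite (_ : derive1 _ = fun t => 0); first exact: cst_continuous.
by apply/funext => t; rewrite derive1E; exact: derive_val.
Qed.

Lemma piecewise_C1_cst N (v : 'rV[R]_N) : piecewise_C1 (fun _ : R => v).
Proof.
exists [:: 1]; split=> //=; first by rewrite ltr01.
by move=> [|//] _; exists (fun _ => v) => //; exact: C1_cst.
Qed.

(** The list of break points recast as an inductive predicate, so that statements about curves
    follow by induction on the pieces. *)
Inductive pieces (P : R -> R -> Prop) : R -> R -> Prop :=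
| pieces_nil a : pieces P a a
| pieces_cons a b d : a < b -> P a b -> pieces P b d -> pieces P a d.

Lemma pieces_le P a b : pieces P a b -> a <= b.
Proof. by elim=> // {}a {}b d ab _ _; exact/le_trans/ltW. Qed.

Lemma sub_pieces (P Q : R -> R -> Prop) a b :
  (forall x y, a <= x -> x < y -> y <= b -> P x y -> Q x y) -> pieces P a b -> pieces Q a b.
Proof.
move=> + h; elim: h => [*|{}a {}b d ab Pab pbd IH PQ]; first exact: pieces_nil.
apply: (pieces_cons ab); first by apply: PQ => //; exact: pieces_le pbd.
by apply: IH => x y bx; apply: PQ; rewrite (le_trans _ bx)// ltW.
Qed.

Definition C1_piece N (c : R -> 'rV[R]_N) a b : Prop :=
  exists2 gamma, C1_curve gamma & forall t, a <= t <= b -> c t = gamma t.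

Lemma piecewise_C1_pieces N (c : R -> 'rV[R]_N) :
  piecewise_C1 c -> pieces (C1_piece c) 0 1.
Proof.
suff aux s a : path <%R a s -> (forall i, (i < size s)%N ->
    C1_piece c (nth 0 (a :: s) i) (nth 0 s i)) -> pieces (C1_piece c) a (last a s).
  by move=> [s [ps <- h]]; exact: aux.
elim: s a => [a _ _|b s IH a /= + h]; first exact: pieces_nil.
move=> /andP[ab pbs]; apply: (pieces_cons ab); first exact: (h 0).
by apply: IH => // i; exact: (h i.+1).
Qed.

Lemma C1_piece_derivable N (c gamma : R -> 'rV[R]_N) a b t :
  C1_curve gamma -> (forall t, a <= t <= b -> c t = gamma t) -> a < t < b ->
  derivable c t 1 /\ derive1 c t = derive1 gamma t.
Proof.
move=> [dg _] h /andP[at_ tb].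
have E : \near t, gamma t = c t.
  near=> u; rewrite h//; apply/andP; split; apply: ltW; near: u.
    exact: lt_nbhsr.
  exact: lt_nbhsl.
split; first by apply: near_eq_derivable (dg t).
by rewrite !derive1E; apply/esym/near_eq_derive.
Unshelve. all: by end_near. Qed.

Lemma pieces_derivable N (c : R -> 'rV[R]_N) a b :
  pieces (C1_piece c) a b ->
  exists s : seq R, forall t, a <= t <= b -> t \notin s -> derivable c t 1.
Proof.
elim=> [{}a|{}a {}b d ab [gamma C1g cg] _ [s hs]].
  exists [:: a] => t; rewrite -eq_le => /eqP ->; rewrite mem_seq1 eqxx//.
exists [:: a, b & s] => t /andP[at_ td]; rewrite !inE !negb_or => /and3P[ta tb ts].
have [tlb|btl] := leP t b; last by apply: hs => //; rewrite td ltW.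
have h : a < t < b by rewrite lt_neqAle eq_sym ta at_/= lt_neqAle tb.
by have [] := C1_piece_derivable C1g cg h.
Qed.

End Curves.

(** * Integrals of piecewise continuous functions *)

Section PieceIntegrals.
Context {R : realType}.
Notation mu := (@lebesgue_measure R).
Implicit Types (h k : R -> R) (a b : R).

(** Agreement is asked on the open interval only, because the speed of a curve takes junk values at
    the break points. *)
Definition cont_piece h a b : Prop :=
  exists2 k, continuous k & forall t, a < t < b -> h t = k t.

Lemma mu_itvcc a b : a <= b -> mu `[a, b]%classic = (b - a)%:E.
Proof.
move=> ab; rewrite lebesgue_measure_itv/= lte_fin; case: ltgtP ab => // -> _.
by rewrite subrr.
Qed.

Lemma mu_itvcc_lty a b : (mu `[a, b]%classic < +oo)%E.
Proof. by rewrite lebesgue_measure_itv/=; case: ifP; rewrite -?EFinB ltry. Qed.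

Lemma cont_piece_measurable h a b : a < b -> cont_piece h a b ->
  measurable_fun `[a, b]%classic h.
Proof.
move=> ab [k ck hk].
rewrite -(@setU1itv _ _ (BRight b) a false) ?bnd_simp ?ltW//.
rewrite -(@setUitv1 _ _ (BRight a) b true) ?bnd_simp//.
apply/measurable_funU => //; first by apply: measurableU.
split; first exact: measurable_fun_set1.
apply/measurable_funU => //; split; last exact: measurable_fun_set1.
apply: (eq_measurable_fun k) => [t|]; last first.
  by apply: (measurable_funS measurableT) => //; exact: continuous_measurable_fun.
by rewrite inE /= in_itv /= => /hk.
Qed.

Lemma cont_piece_bounded h a b : a < b -> cont_piece h a b ->
  exists M, forall t, a <= t <= b -> `|h t| <= M.
Proof.
move=> ab [k ck hk].
have cnk : {within `[a, b], continuous (fun t => `|k t|)}.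
  apply: continuous_subspaceT => t.
  by apply: continuous_comp; [exact: ck|exact: norm_continuous].
have [c _ hc] := EVT_max (ltW ab) cnk.
exists (`|k c| + `|h a| + `|h b|) => t tab.
have [ta|ta] := eqVneq t a; first by rewrite ta; have := normr_ge0 (k c); have := normr_ge0 (h b); lra.
have [tb|tb] := eqVneq t b; first by rewrite tb; have := normr_ge0 (k c); have := normr_ge0 (h a); lra.
have tab' : a < t < b by rewrite !lt_neqAle eq_sym ta tb.
rewrite hk// -addrA; apply: le_trans (hc t _) _; first by rewrite in_itv.
by rewrite lerDl addr_ge0.
Qed.

Lemma pieces_cont_measurable h a b : pieces (cont_piece h) a b ->
  measurable_fun `[a, b]%classic h.
Proof.
elim=> [{}a|{}a {}b d ab hab pbd IH].
  by rewrite set_itv1; exact: measurable_fun_set1.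
rewrite (@itv_bndbnd_setU _ _ (BLeft a) (BRight b) (BRight d)) ?bnd_simp ?(pieces_le pbd) ?ltW//.
apply/measurable_funU => //; split; first exact: cont_piece_measurable.
by apply: measurable_funS IH => //; apply: subset_itvr; rewrite bnd_simp.
Qed.

Lemma pieces_cont_integrable h a b : pieces (cont_piece h) a b ->
  mu.-integrable `[a, b]%classic (EFin \o h).
Proof.
move=> hab; apply: measurable_bounded_integrable => //.
- exact: mu_itvcc_lty.
- exact: pieces_cont_measurable.
have [M hM] : exists M, forall t, a <= t <= b -> `|h t| <= M.
  elim: hab => [{}a|{}a {}b d ab hab pbd [M hM]].
    by exists `|h a| => t; rewrite -eq_le => /eqP ->.
  have [M' hM'] := cont_piece_bounded ab hab.
  exists (Num.max M M') => t /andP[at_ td]; rewrite le_max.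
  have [tb|bt] := leP t b; first by rewrite hM' ?orbT// at_.
  by rewrite hM// ltW.
exists M; split; first exact: num_real.
by move=> x Mx t /=; rewrite in_itv/= => /hM/le_trans; apply; exact: ltW.
Qed.

Lemma le_Rintegral_except h k a b (s : seq R) :
  mu.-integrable `[a, b]%classic (EFin \o h) ->
  mu.-integrable `[a, b]%classic (EFin \o k) ->
  (forall t, 0 <= h t) -> (forall t, 0 <= k t) ->
  (forall t, a <= t <= b -> t \notin s -> h t <= k t) ->
  \int[mu]_(t in `[a, b]) h t <= \int[mu]_(t in `[a, b]) k t.
Proof.
move=> ih ik h0 k0 hk; rewrite /Rintegral fine_le//.
- exact: integrable_fin_num.
- exact: integrable_fin_num.
apply: ae_ge0_le_integral => //.
- by move=> t _; rewrite lee_fin.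
- exact: measurable_int ih.
- by move=> t _; rewrite lee_fin.
- exact: measurable_int ik.
exists [set` s]; split.
- apply: countable_measurable => [t|]; first exact: measurable_set1.
  by apply/finite_set_countable/finite_seqP; exists s.
- by apply/countable_lebesgue_measure0/finite_set_countable/finite_seqP; exists s.
move=> t /= nt; apply: contrapT => /negP ts; apply: nt.
by rewrite /= in_itv/= lee_fin => tab; exact: hk.
Qed.

Lemma Rintegral_affine h a b (A B : R) : a <= b ->
  mu.-integrable `[a, b]%classic (EFin \o h) ->
  mu.-integrable `[a, b]%classic (EFin \o (fun t => A * h t + B)) /\
  \int[mu]_(t in `[a, b]) (A * h t + B)
    = A * \int[mu]_(t in `[a, b]) h t + B * (b - a).
Proof.
move=> ab ih.
have iA : mu.-integrable `[a, b]%classic (EFin \o (fun t => A * h t)).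
  by apply: integrableZl ih; exact: measurable_itv.
have iB : mu.-integrable `[a, b]%classic (EFin \o (fun=> B)).
  apply: measurable_bounded_integrable => //; first exact: mu_itvcc_lty.
  by exists `|B|; split; [exact: num_real|move=> x Bx t _ /=; exact: ltW].
split; first by apply: (integrableD _ iA iB); exact: measurable_itv.
rewrite RintegralD// RintegralZl// Rintegral_cst//; congr (_ + _ * _).
exact: (congr1 fine (mu_itvcc ab)).
Qed.

Lemma Rintegral_itv_split h a b d : a <= b <= d ->
  mu.-integrable `[a, d]%classic (EFin \o h) ->
  \int[mu]_(t in `[a, d]) h t
    = \int[mu]_(t in `[a, b]) h t + \int[mu]_(t in `[b, d]) h t.
Proof.
move=> /andP[ab bd] ih.
have := @Rintegral_itvB _ h (BLeft a) (BRight d) b ih; rewrite !bnd_simp => H.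
rewrite -[\int[mu]_(t in `[b, d]) _](@Rintegral_itv_obnd_cbnd _ _ (BRight d)).
  by rewrite -H// addrC subrK.
by apply: integrableS ih => //; apply: subset_itvr; rewrite bnd_simp.
Qed.

Lemma Rintegral_itv_le h a b d : a <= b <= d ->
  mu.-integrable `[a, d]%classic (EFin \o h) -> (forall t, 0 <= h t) ->
  \int[mu]_(t in `[a, b]) h t <= \int[mu]_(t in `[a, d]) h t.
Proof.
move=> abd ih h0; rewrite (Rintegral_itv_split abd ih) lerDl.
by apply: Rintegral_ge0 => t _; exact: h0.
Qed.

(** The fundamental theorem of calculus for the scalar function [dot (gamma t) v]. The bound on the
    derivative may fail at [a] and [b], a null set. *)
Lemma dot_C1_le N (gamma : R -> 'rV[R]_N) v h (M a b : R) :
  0 <= M -> C1_curve gamma -> a <= b -> mu.-integrable `[a, b]%classic (EFin \o h) ->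
  (forall t, 0 <= h t) ->
  (forall t, a < t < b -> `|dot (derive1 gamma t) v| <= M * h t) ->
  `|dot (gamma b) v - dot (gamma a) v| <= M * \int[mu]_(t in `[a, b]) h t.
Proof.
move=> M0 [dg cg]; rewrite le_eqVlt => /predU1P[->|ab] ih h0 hh.
  by rewrite subrr normr0 mulr_ge0// Rintegral_ge0.
pose F t := dot (gamma t) v; pose f t := dot (derive1 gamma t) v.
have cf : continuous f by move=> t; apply: cvg_dot; [exact: cg|exact: cvg_cst].
have dF t : is_derive t (1:R) F (f t).
  by apply: is_derive_dot; rewrite derive1E; exact: derivableP.
have cF : continuous F.
  by move=> t; apply: differentiable_continuous; apply/derivable1_diffP; case: (dF t).
have cfs : {within `[a, b], continuous f} by exact: continuous_subspaceT.
have ifab : mu.-integrable `[a, b]%classic (EFin \o f).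
  by apply: continuous_compact_integrable => //; exact: segment_compact.
have FTC : \int[mu]_(t in `[a, b]) f t = F b - F a.
  rewrite /Rintegral (@continuous_FTC2 _ f F a b ab cfs)//.
    split=> [t _||]; first by case: (dF t).
      by apply: cvg_at_right_filter; exact: cF.
    by apply: cvg_at_left_filter; exact: cF.
  by move=> t _; rewrite derive1E; apply: derive_val.
rewrite -/(F b) -/(F a) -FTC; apply: le_trans (le_normr_Rintegral _ ifab) _ => //.
have [iM EM] := Rintegral_affine M 0 (ltW ab) ih.
rewrite mul0r addr0 in EM; rewrite -EM.
apply: (@le_Rintegral_except _ _ _ _ [:: a; b]) => //.
- exact: integrable_norm.
- by move=> t; rewrite addr0 mulr_ge0.
move=> t /andP[at_ tb]; rewrite !inE negb_or => /andP[ta tb'].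
by rewrite addr0; apply: hh; rewrite !lt_neqAle eq_sym ta tb' at_.
Qed.

End PieceIntegrals.

(** * Comparison of lengths of curves *)

Section CurveLength.
Context {R : realType}.
Notation mu := (@lebesgue_measure R).

Definition speed_along N (g : 'rV[R]_N -> 'M[R]_N) (c : R -> 'rV[R]_N) t : R :=
  Num.sqrt (tensor_form g (c t) (derive1 c t) (derive1 c t)).

Lemma speed_along_ge0 N (g : 'rV[R]_N -> 'M[R]_N) c t : 0 <= speed_along g c t.
Proof. exact: sqrtr_ge0. Qed.

Lemma speed_along_pieces N (g : 'rV[R]_N -> 'M[R]_N) c a b :
  continuous g -> pieces (C1_piece c) a b -> pieces (cont_piece (speed_along g c)) a b.
Proof.
move=> cg; apply: sub_pieces => x y _ xy _ [gamma C1g cgam].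
exists (speed_along g gamma).
  move=> t; have [dg cdg] := C1g.
  apply: (@continuous_cvg _ _ _ _ _ (fun t => tensor_form g (gamma t) (derive1 gamma t)
    (derive1 gamma t)) Num.sqrt).
    exact: sqrt_continuous.
  apply: cvg_tensor_form; [exact: cg| |exact: cdg].
  by apply: differentiable_continuous; apply/derivable1_diffP; exact: dg.
move=> t xty; have [_ E] := C1_piece_derivable C1g cgam xty.
have /andP[xt ty] := xty.
by rewrite /speed_along E cgam// !ltW.
Qed.

Lemma speed_along_integrable N (g : 'rV[R]_N -> 'M[R]_N) c :
  continuous g -> piecewise_C1 c ->
  mu.-integrable `[0, 1]%classic (EFin \o speed_along g c).
Proof.
move=> cg /piecewise_C1_pieces pc.
exact/pieces_cont_integrable/speed_along_pieces.
Qed.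

Lemma curve_length_ge0 N (g : 'rV[R]_N -> 'M[R]_N) c : 0 <= curve_length g c.
Proof. by apply: Rintegral_ge0 => t _; exact: sqrtr_ge0. Qed.

Lemma curve_length_le N N' (g : 'rV[R]_N -> 'M[R]_N) (g' : 'rV[R]_N' -> 'M[R]_N')
    c c' (A B : R) :
  continuous g -> continuous g' -> piecewise_C1 c -> piecewise_C1 c' ->
  0 <= A -> 0 <= B ->
  (forall t, 0 <= t <= 1 -> derivable c t 1 ->
     speed_along g' c' t <= A * speed_along g c t + B) ->
  curve_length g' c' <= A * curve_length g c + B.
Proof.
move=> cg cg' pc pc' A0 B0 h.
have ic := speed_along_integrable cg pc.
have ic' := speed_along_integrable cg' pc'.
have [iA] := Rintegral_affine A B ler01 ic.
rewrite subr0 mulr1 /curve_length => <-.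
have [s hs] := pieces_derivable (piecewise_C1_pieces pc).
apply: (le_Rintegral_except (s := s) ic' iA) => [t|t|t t01 ts].
- exact: speed_along_ge0.
- by rewrite addr_ge0// mulr_ge0// speed_along_ge0.
- by apply: h => //; exact: hs.
Qed.

(** Induction on the pieces: [dot_C1_le] handles the first one and lengths add up. Choosing [v] well
    bounds the horizontal and vertical displacement of a curve by its length. *)
Lemma dot_curve_le N (g : 'rV[R]_N -> 'M[R]_N) c v M :
  continuous g -> piecewise_C1 c -> 0 <= M ->
  (forall t, 0 <= t <= 1 -> derivable c t 1 ->
     `|dot (derive1 c t) v| <= M * speed_along g c t) ->
  forall t, 0 <= t <= 1 -> `|dot (c t) v - dot (c 0) v| <= M * curve_length g c.
Proof.
move=> cg pc M0 h t t01.
pose k := speed_along g c.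
suff aux a b : 0 <= a -> b <= 1 -> pieces (C1_piece c) a b -> forall t, a <= t <= b ->
    `|dot (c t) v - dot (c a) v| <= M * \int[mu]_(t in `[a, b]) k t.
  exact: (aux 0 1 _ _ (piecewise_C1_pieces pc) t t01).
move=> a0 + pab; elim: pab a0 => {a b t t01} [a a0 _ t|a b d ab pcab pbd IH a0 d1 t].
  rewrite -eq_le => /eqP ->; rewrite subrr normr0 mulr_ge0// Rintegral_ge0// => x _.
  exact: speed_along_ge0.
have [gamma C1g cgam] := pcab.
have bd := pieces_le pbd.
have iad : mu.-integrable `[a, d]%classic (EFin \o k).
  apply/pieces_cont_integrable/speed_along_pieces => //.
  exact: pieces_cons pcab pbd.
have first t' : a <= t' <= b ->
    `|dot (c t') v - dot (c a) v| <= M * \int[mu]_(t in `[a, t']) k t.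
  move=> /andP[at' t'b]; rewrite !cgam ?at' ?lexx ?(ltW ab)//.
  apply: dot_C1_le => //; last 2 first.
  - by move=> ?; exact: speed_along_ge0.
  - move=> u /andP[au ut'].
    have aub : a < u < b by rewrite au (lt_le_trans ut').
    have [du Eu] := C1_piece_derivable C1g cgam aub.
    rewrite -Eu; apply: h => //; apply/andP; split; first by rewrite ltW// (le_lt_trans a0).
    by rewrite (le_trans (ltW ut'))// (le_trans t'b)// (le_trans bd).
  apply: integrableS iad => //; apply: subset_itvl; rewrite bnd_simp.
  exact: le_trans bd.
move=> /andP[at_ td].
have k0 u : 0 <= k u by exact: speed_along_ge0.
have [tb|bt] := leP t b.
  apply: le_trans (first _ _) _; first by rewrite at_.
  by rewrite ler_wpM2l// Rintegral_itv_le// at_.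
have abd : a <= b <= d by rewrite ltW.
rewrite (Rintegral_itv_split abd iad) mulrDr.
rewrite (_ : _ - _ = (dot (c b) v - dot (c a) v) + (dot (c t) v - dot (c b) v)); last by ring.
apply: le_trans (ler_normD _ _) _; apply: lerD.
  by apply: first; rewrite lexx ltW.
by apply: IH => //; [rewrite (le_trans a0)// ltW|rewrite ltW].
Qed.

End CurveLength.

(** * Displacement and perturbation of curves in an orthonormal frame *)

Section FrameLength.
Context {R : realType} {N : nat} (e : 'rV[R]_N) (e1 : dot e e = 1).
Implicit Types (c : R -> 'rV[R]_N) (W : 'M[R]_N) (p u v : 'rV[R]_N).

Definition frame_length W c := curve_length (gmetric e W 1%:M) c.

Lemma continuous_gmetric W G : continuous (gmetric e W G).
Proof. by move=> p; exact: (@cvg_gmetric R _ (nbhs p) _ N e W G id p cvg_id). Qed.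

Lemma speed_along_frame W c t :
  speed_along (gmetric e W 1%:M) c t = speed e W (c t) (derive1 c t).
Proof. exact: sqrt_gmetric1. Qed.

Lemma enorm_axis (a : R) : enorm (a *: e) = `|a|.
Proof. by rewrite enormZ /enorm e1 sqrtr1 mulr1. Qed.

Lemma enorm_axis1 : enorm e = 1.
Proof. by rewrite -[e]scale1r enorm_axis normr1. Qed.

Definition horiz p := p - dot p e *: e.

Lemma dot_horiz_axis p : dot (horiz p) e = 0.
Proof. by rewrite /horiz dotBl dotZl e1 mulr1 subrr. Qed.

Lemma dotC_axis_horiz p : dot e (horiz p) = 0.
Proof. by rewrite dotC dot_horiz_axis. Qed.

Lemma dot_horiz p u : dot (horiz p) (horiz u) = dot p (horiz u).
Proof. by rewrite {1}/horiz dotBl dotZl dotC_axis_horiz mulr0 subr0. Qed.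

Lemma enorm_horiz p : enorm (horiz p) <= enorm p.
Proof.
have := normr_dot_le p (horiz p); rewrite -dot_horiz ger0_norm ?dot_ge0//.
rewrite -sqr_enorm expr2; have [->|h0] := eqVneq (enorm (horiz p)) 0.
  by rewrite enorm_ge0.
by rewrite ler_pM2r// lt_def h0 enorm_ge0.
Qed.

Lemma horizB p q : horiz (p - q) = horiz p - horiz q.
Proof. by rewrite /horiz dotBl; apply/rowP => i; rewrite !mxE; ring. Qed.

Section Alternating.
Variables (W : 'M[R]_N) (altW : bracket_form e W) (K : R) (K0 : 0 <= K)
  (WK : forall u v, `|bil W u v| <= K * enorm u * enorm v).

Lemma bil_horizl p u : bil W (horiz p) u = bil W p u.
Proof. by rewrite /horiz bilBl bilZl (bil_axisl altW) mulr0 subr0. Qed.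

(** Both forms kill [e], so [u] may be replaced by its corrected value at [p], whose norm is the
    speed, even though the correction is made with [W] and not with [W']. *)
Lemma normr_bil_speed W' L p q u : bracket_form e W' ->
  (forall u v, `|bil W' u v| <= L * enorm u * enorm v) ->
  `|bil W' q u| <= L * enorm q * speed e W p u.
Proof.
move=> aW' WL; rewrite /speed; set x := _ *: e.
have -> : bil W' q u = bil W' q (u - x) by rewrite bilBr bilZr (bil_axisr aW') mulr0 subr0.
exact: WL.
Qed.

(** The test vector is the horizontal displacement [x] itself. Being orthogonal to [e], it does not
    see the correction in the speed; dividing by [enorm x] gives the claim. *)
Lemma frame_curve_horiz c t : piecewise_C1 c -> 0 <= t <= 1 ->
  enorm (horiz (c t - c 0)) <= frame_length W c.
Proof.
move=> pc t01; set x := horiz _.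
have [->|x0] := eqVneq (enorm x) 0; first exact: curve_length_ge0.
have hx : 0 < enorm x by rewrite lt_def x0 enorm_ge0.
rewrite -(ler_pM2l hx) -expr2 sqr_enorm dot_horiz dotBl.
apply: le_trans (ler_norm _) _.
apply: dot_curve_le => //; [exact: continuous_gmetric|exact: enorm_ge0|].
move=> s _ _; rewrite speed_along_frame /speed mulrC.
rewrite -[X in X <= _](_ : `|dot (derive1 c s - (2^-1 * bil W (c s) (derive1 c s)) *: e) x| = _).
  exact: normr_dot_le.
by rewrite dotBl dotZl dotC_axis_horiz mulr0 subr0.
Qed.

(** The vertical velocity is that of the frame plus [2^-1 * bil W (c s) u]. In the latter only the
    horizontal part of [c s] counts, and this is already bounded by [frame_curve_horiz]. *)
Lemma frame_curve_vert c t : piecewise_C1 c -> 0 <= t <= 1 ->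
  `|dot (c t - c 0) e| <=
    (1 + 2^-1 * K * (enorm (c 0) + frame_length W c)) * frame_length W c.
Proof.
move=> pc t01; rewrite dotBl.
have l0 : 0 <= frame_length W c by exact: curve_length_ge0.
have A0 : 0 <= 2^-1 * K * (enorm (c 0) + frame_length W c).
  by rewrite !mulr_ge0 ?addr_ge0 ?enorm_ge0.
apply: dot_curve_le => //; [exact: continuous_gmetric|by rewrite addr_ge0|].
move=> s s01 _; rewrite speed_along_frame; set u := derive1 c s.
have -> : dot u e = dot (u - (2^-1 * bil W (c s) u) *: e) e + 2^-1 * bil W (horiz (c s)) u.
  by rewrite dotBl dotZl e1 mulr1 bil_horizl subrK.
apply: le_trans (ler_normD _ _) _; rewrite mulrDl mul1r; apply: lerD.
  by apply: le_trans (normr_dot_le _ _) _; rewrite enorm_axis1 mulr1.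
rewrite normrM ger0_norm ?invr_ge0// -!mulrA ler_wpM2l// mulrA.
apply: le_trans (normr_bil_speed (c s) _ _ altW WK) _.
rewrite ler_wpM2r ?enorm_ge0// ler_wpM2l//.
have -> : horiz (c s) = horiz (c 0) + horiz (c s - c 0) by rewrite horizB addrC subrK.
apply: le_trans (ler_enormD _ _) _; apply: lerD; first exact: enorm_horiz.
exact: frame_curve_horiz.
Qed.

Lemma enorm_horiz_vert p : enorm p <= enorm (horiz p) + `|dot p e|.
Proof.
rewrite -{1}[p](subrK (dot p e *: e)); apply: le_trans (ler_enormD _ _) _.
by rewrite enorm_axis.
Qed.

Lemma frame_curve_bound c t : piecewise_C1 c -> 0 <= t <= 1 ->
  enorm (c t - c 0) <=
    (2 + 2^-1 * K * (enorm (c 0) + frame_length W c)) * frame_length W c.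
Proof.
move=> pc t01; apply: le_trans (enorm_horiz_vert _) _.
have := frame_curve_horiz pc t01; have := frame_curve_vert pc t01; lra.
Qed.

(** There are three sources of error: replacing [W] by [W'] at points of norm at most [r]
    ([kap * r]), moving the base point by at most [2 * al] ([K * (2 * al)]), and the extra velocity
    [b]. The first two are proportional to the speed, the last one gives the additive term. *)
Lemma frame_length_perturb W' c a b r al kap :
  bracket_form e W' -> 
  (forall u v, `|bil W' u v| <= K * enorm u * enorm v) ->
  (forall u v, `|bil (W' - W) u v| <= kap * enorm u * enorm v) ->
  0 <= kap -> piecewise_C1 c -> (forall t, 0 <= t <= 1 -> enorm (c t) <= r) ->
  enorm a <= al -> enorm b <= al ->
  frame_length W' (fun t => c t + t *: b + a) <=
   (1 + 2^-1 * (kap * r + K * (2 * al))) * frame_length W c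
   + (al + 2^-1 * (K * (r + 2 * al) * al)).
Proof.
move=> aW' W'K WkW kap0 pc cr aal bal.
have r0 : 0 <= r by apply: le_trans (cr 0 _); rewrite ?enorm_ge0// lexx ler01.
have al0 : 0 <= al by apply: le_trans aal; exact: enorm_ge0.
have E : (fun t => c t + t *: b + a) = (fun t => c t *m 1%:M + t *: b + a).
  by apply/funext => t; rewrite mulmx1.
apply: curve_length_le => //; [exact: continuous_gmetric|exact: continuous_gmetric| | | |].
- by rewrite E; exact: piecewise_C1_affine.
- by rewrite addr_ge0// mulr_ge0// addr_ge0// !mulr_ge0.
- by rewrite addr_ge0// !mulr_ge0// addr_ge0// mulr_ge0.
move=> t t01 dc; rewrite !speed_along_frame.
have Dt : is_derive t (1:R) (fun t => c t *m 1%:M + t *: b + a) (derive1 c t *m 1%:M + b).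
  by apply: is_derive_affine; rewrite derive1E; exact: derivableP.
have -> : derive1 (fun t => c t + t *: b + a) t = derive1 c t + b.
  by rewrite E derive1E derive_val mulmx1.
set u := derive1 c t; set p := c t; set x := t *: b + a.
rewrite -addrA -/x.
have xal : enorm x <= 2 * al.
  apply: le_trans (ler_enormD _ _) _; rewrite mulr2n mulrDl mul1r; apply: lerD => //.
  have /andP[t0 t1] := t01.
  by rewrite enormZ ger0_norm// (le_trans _ bal)// ler_piMl// enorm_ge0.
have pr : enorm p <= r by exact: cr.
set s := speed e W p u; have s0 : 0 <= s by exact: enorm_ge0.
have h1 : `|bil (W' - W) p u| <= kap * r * s.
  rewrite /bil mulmxBr. 
  have -> : dot (p *m W' - p *m W) u = bil (W' - W) p (u - (2^-1 * bil W p u) *: e).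
    by rewrite bilB_mx !bilBr !bilZr (bil_axisr aW') (bil_axisr altW) dotBl mulr0 !subr0.
  apply: le_trans (WkW _ _) _; rewrite -!mulrA ler_wpM2l//.
  by rewrite ler_wpM2r// enorm_ge0.
have h2 : `|bil W' x u| <= K * (2 * al) * s.
  apply: le_trans (normr_bil_speed p x u aW' W'K) _.
  by rewrite ler_wpM2r// ler_wpM2l.
have h3 : `|bil W' (p + x) b| <= K * (r + 2 * al) * al.
  apply: le_trans (W'K _ _) _; rewrite -!mulrA ler_wpM2l//.
  rewrite ler_pM ?enorm_ge0//; apply: le_trans (ler_enormD _ _) _; exact: lerD.
have -> : speed e W' (p + x) (u + b) = enorm ((u - (2^-1 * bil W p u) *: e) + b
   - (2^-1 * (bil (W' - W) p u + bil W' x u + bil W' (p + x) b)) *: e).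
  rewrite /speed; congr enorm; rewrite bilB_mx bilDr !bilDl.
  apply/rowP => i; rewrite !mxE; ring.
apply: le_trans (ler_enormD _ _) _; rewrite enormN enorm_axis.
have h4 := ler_enormD (u - (2^-1 * bil W p u) *: e) b.
rewrite -/(speed e W p u) -/s in h4.
have h5 : `|bil (W' - W) p u + bil W' x u + bil W' (p + x) b| <=
  kap * r * s + K * (2 * al) * s + K * (r + 2 * al) * al.
  by do 2![apply: le_trans (ler_normD _ _) _; apply: lerD => //].
rewrite normrM [`|2^-1|]ger0_norm ?invr_ge0//; lra.
Qed.
End Alternating.
End FrameLength.

(** * The Heisenberg group in matrix form and its quotient distances *)

Section AffineLength.
Context {R : realType}.

Lemma curve_length_affine_le N M (g : 'rV[R]_N -> 'M[R]_N) (g' : 'rV[R]_M -> 'M[R]_M)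
    (A : 'M[R]_(N, M)) d c :
  continuous g -> continuous g' -> piecewise_C1 c ->
  (forall p u, tensor_form g' (p *m A + d) (u *m A) (u *m A) = tensor_form g p u u) ->
  curve_length g' (fun t => c t *m A + d) <= curve_length g c.
Proof.
move=> cg cg' pc h.
have E : (fun t => c t *m A + d) = (fun t => c t *m A + t *: 0 + d).
  by apply/funext => t; rewrite scaler0 addr0.
rewrite -[leRHS]mul1r -[leRHS]addr0; apply: curve_length_le => //.
  by rewrite E; exact: piecewise_C1_affine.
move=> t _ dc.
have Dt : is_derive t (1:R) (fun t => c t *m A + t *: 0 + d) (derive1 c t *m A + 0).
  by apply: is_derive_affine; rewrite derive1E; exact: derivableP.
rewrite /speed_along mul1r addr0 -h.
have -> : derive1 (fun t => c t *m A + d) t = derive1 c t *m A.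
  by rewrite E derive1E derive_val addr0.
by [].
Qed.

(** The inequality is applied to the map and to its inverse. *)
Lemma curve_length_affine N (g g' : 'rV[R]_N -> 'M[R]_N) (A : 'M[R]_N) d c :
  continuous g -> continuous g' -> piecewise_C1 c -> A \in unitmx ->
  (forall p u, tensor_form g' (p *m A + d) (u *m A) (u *m A) = tensor_form g p u u) ->
  curve_length g' (fun t => c t *m A + d) = curve_length g c.
Proof.
move=> cg cg' pc uA h; apply/eqP; rewrite eq_le; apply/andP; split.
  exact: curve_length_affine_le.
have E : c = (fun t => (c t *m A + d) *m invmx A + - (d *m invmx A)).
  by apply/funext => t; rewrite mulmxDl mulmxK// addrK.
rewrite {1}E.
apply: (@curve_length_affine_le _ _ g' g (invmx A) _ (fun t => c t *m A + d)) => //.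
  rewrite (_ : (fun _ => _) = (fun t => c t *m A + t *: 0 + d)); first exact: piecewise_C1_affine.
  by apply/funext => t; rewrite scaler0 addr0.
by move=> p u; rewrite -h mulmxDl mulNmx !mulmxKV// subrK.
Qed.

End AffineLength.

Section HeisMatrix.
Context {R : realType} {n : nat}.
Local Notation H := 'rV[R]_(n + n + 1).
Implicit Types (p q u v : H) (G : 'M[R]_(n + n + 1)).

Definition heis_axis : H := row_mx 0 1%:M.
Definition heis_form : 'M[R]_(n + n + 1) :=
  block_mx (block_mx 0 1%:M (- 1%:M) 0) 0 0 0.

Local Notation e := heis_axis.
Local Notation W0 := heis_form.

Lemma dot_heis_axis p : dot p e = p 0 (rshift (n + n) 0).
Proof.
rewrite /dot -{1}[p]hsubmxK tr_row_mx mul_row_col trmx0 mulmx0 add0r trmx1 mulmx1.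
by rewrite mxE.
Qed.

Lemma heis_axis1 : dot e e = 1.
Proof. by rewrite dot_heis_axis row_mxEr mxE. Qed.

Lemma heis_bracket_form : bracket_form e W0.
Proof.
split; last first.
  by rewrite /heis_axis /heis_form mul_row_block !mul0mx !mulmx0 !addr0 row_mx0.
rewrite /heis_form !tr_block_mx !trmx0 !opp_block_mx !oppr0; congr block_mx.
by rewrite trmx1 raddfN/= trmx1 opprK.
Qed.

Lemma heis_imE p q : heis_im p q = bil W0 p q.
Proof.
rewrite -[in RHS](hsubmxK p) -[in RHS](hsubmxK q) /bil /heis_form mul_row_block.
rewrite !mulmx0 !addr0 /dot tr_row_mx mul_row_col mul0mx addr0.
rewrite -[in RHS](hsubmxK (lsubmx p)) -[in RHS](hsubmxK (lsubmx q)).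
rewrite mul_row_block !mulmx0 add0r addr0 mulmx1 mulmxN mulmx1.
rewrite tr_row_mx mul_row_col -/(heis_x p) -/(heis_y p).
rewrite mulNmx addrC !mxE -sumrB /heis_im; apply: eq_bigr => i _; rewrite !mxE.
by rewrite /heis_x /heis_y.
Qed.

Lemma heis_mulE p q : heis_mul p q = gmul e W0 p q.
Proof.
have xE a : heis_x (a *: e) = 0 by rewrite /heis_x !linearZ /= row_mxKl !linear0.
have yE a : heis_y (a *: e) = 0 by rewrite /heis_y !linearZ /= row_mxKl !linear0.
have xD a b : heis_x (a + b : H) = heis_x a + heis_x b by rewrite /heis_x !linearD.
have yD a b : heis_y (a + b : H) = heis_y a + heis_y b by rewrite /heis_y !linearD.
apply: heis_ext; rewrite heis_mkK /gmul ?xD ?xE ?yD ?yE ?addr0//.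
by rewrite -heis_imE /heis_z !linearD linearZ /= row_mxKr !mxE mulr1.
Qed.

Lemma derive_heis_mul p q u : 'D_u (heis_mul p) q = u *m frame e W0 (- p).
Proof.
have -> : heis_mul p = (fun q => p + q *m frame e W0 (- p)).
  by apply/funext => x; rewrite heis_mulE gmul_frame.
rewrite /derive; apply: cvg_lim => //.
set F := frame _ _ _.
have : (fun _ : R => u *m F) h @[h --> (0 : R)^'] --> u *m F by exact: cvg_cst.
apply: cvg_trans; apply: near_eq_cvg.
near=> h; have h0 : h != 0 by near: h; exact: nbhs_dnbhs_neq.
by rewrite /= mulmxDl -scalemxAl opprD addrACA subrr add0r addrK scalerA mulVf// scale1r.
Unshelve. all: by end_near. Qed.

Lemma tensor_form_delta (g : H -> 'M[R]_(n + n + 1)) p i j :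
  tensor_form g p (delta_mx 0 i) (delta_mx 0 j) = g p i j.
Proof. exact: bil_delta. Qed.

Lemma gmetric_left_invariant G : left_invariant (gmetric e W0 G).
Proof.
move=> p q u v; rewrite !derive_heis_mul heis_mulE.
exact: gmetric_gmul heis_bracket_form _ _ _ _ _.
Qed.

Lemma left_invariantE (g : H -> 'M[R]_(n + n + 1)) :
  left_invariant g -> g = gmetric e W0 (g 0).
Proof.
move=> li; apply/funext => p; apply/matrixP => i j; rewrite -!tensor_form_delta.
have := li p 0 (delta_mx 0 i *m frame e W0 p) (delta_mx 0 j *m frame e W0 p).
rewrite !derive_heis_mul heis_mulE gmulg0 -!mulmxA (frameK heis_bracket_form) !mulmx1.
by rewrite tensor_form_gmetric => ->; rewrite /tensor_form /dot trmx_mul !mulmxA.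
Qed.

Section Quotient.
Variables (Gamma : heis_subgroup R n).

Lemma quotient_projP p q :
  quotient_proj Gamma p = quotient_proj Gamma q <->
  exists2 gamma, Gamma gamma & q = gmul e W0 gamma p.
Proof.
split=> [/eqmodP/asboolP[gamma Gg ->]|[gamma Gg ->]].
  by exists gamma => //; rewrite heis_mulE.
by apply/eqmodP/asboolP; exists gamma => //; rewrite heis_mulE.
Qed.

Lemma quotient_proj_surj (a : heis_quotient Gamma) : exists p, quotient_proj Gamma p = a.
Proof. by exists (repr a); rewrite /quotient_proj reprK. Qed.

Lemma piecewise_C1_line p q : piecewise_C1 (fun t : R => p + t *: (q - p)).
Proof.
rewrite (_ : (fun _ => _) = (fun t : R => (0 : H) *m 1%:M + t *: (q - p) + p)).
  exact/piecewise_C1_affine/piecewise_C1_cst.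
by apply/funext => t; rewrite mul0mx add0r addrC.
Qed.

Lemma quotient_dist_le G c p q gamma : Gamma gamma -> piecewise_C1 c ->
  c 0 = p -> c 1 = gmul e W0 gamma q ->
  quotient_dist (gmetric e W0 G) (quotient_proj Gamma p) (quotient_proj Gamma q)
   <= curve_length (gmetric e W0 G) c.
Proof.
move=> Gg pc c0 c1; apply: ge_inf.
  by exists 0 => _ [c' _ <-]; exact: curve_length_ge0.
exists c => //; split=> //; first by rewrite c0.
by apply/esym/quotient_projP; exists gamma.
Qed.

Lemma quotient_dist_approx G p q eta : 0 < eta ->
  exists c gamma, [/\ Gamma gamma, piecewise_C1 c, c 0 = p, c 1 = gmul e W0 gamma q
   & curve_length (gmetric e W0 G) c <
     quotient_dist (gmetric e W0 G) (quotient_proj Gamma p) (quotient_proj Gamma q) + eta].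
Proof.
move=> eta0; rewrite /quotient_dist; set S := (X in inf X).
have hS : has_inf S.
  split; last by exists 0 => _ [c' _ <-]; exact: curve_length_ge0.
  exists (curve_length (gmetric e W0 G) (fun t : R => p + t *: (q - p))).
  exists (fun t : R => p + t *: (q - p)) => //; split.
  - exact: piecewise_C1_line.
  - by rewrite scale0r addr0.
  - by rewrite scale1r addrC subrK.
have [_ [c [pc c0 c1] <-] lc] := inf_adherent eta0 hS.
move/esym/quotient_projP : c0 => [g0 G0 c0]; move/esym/quotient_projP : c1 => [g1 G1 c1].
have E : (fun t => gmul e W0 (- g0) (c t)) = (fun t => c t *m frame e W0 g0 + - g0).
  by apply/funext => t; rewrite gmul_frame opprK addrC.
(* The curve found by the infimum may start at another lift [g0 p] of the same point; a translation
   by an element of [Gamma] moves its start to [p]. *)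
exists (fun t => gmul e W0 (- g0) (c t)), (heis_mul (heis_inv g0) g1); split.
- exact/subgroup_mul/G1/subgroup_inv.
- rewrite E (_ : (fun _ => _) = (fun t => c t *m frame e W0 g0 + t *: 0 + - g0)).
    exact: piecewise_C1_affine.
  by apply/funext => t; rewrite scaler0 addr0.
- by rewrite c0 (gmulKg heis_bracket_form).
- by rewrite c1 (gmulA heis_bracket_form) heis_mulE.
have cg : continuous (gmetric e W0 G) by exact: continuous_gmetric.
rewrite E (curve_length_affine cg cg)//.
- by rewrite unitmxE (det_frame heis_bracket_form) unitr1.
- move=> x u; have := gmetric_gmul heis_bracket_form G (- g0) x u u.
  by rewrite opprK gmul_frame opprK addrC.
Qed.

End Quotient.

(** The infimum is expressed by its two characteristic inequalities, on points of the fixed space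
    [H], so that distances on quotients by varying lattices can be compared. *)
Definition qdist_spec (W : 'M[R]_(n + n + 1)) (L : set H) (d : H -> H -> R) : Prop :=
  (forall c p q gamma, L gamma -> piecewise_C1 c -> c 0 = p -> c 1 = gmul e W gamma q ->
     d p q <= frame_length e W c) /\
  (forall p q eta, 0 < eta -> exists c gamma, [/\ L gamma, piecewise_C1 c, c 0 = p,
     c 1 = gmul e W gamma q & frame_length e W c < d p q + eta]).

(* [P] is an isomorphism from the Heisenberg group with the metric [P *m P^T] at
   the origin to the group of [W] with an orthonormal frame. *)
Definition frame_iso (W P : 'M[R]_(n + n + 1)) : Prop :=
  P \in unitmx /\ forall p q, gmul e W (p *m P) (q *m P) = gmul e W0 p q *m P.

(** Linear and multiplicative, [P] intertwines the linear parts of the left translations by [- p]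
    and [- p *m P], which are the coframes at [p] and [p *m P]. *)
Lemma frame_iso_form W P p u : frame_iso W P ->
  tensor_form (gmetric e W 1%:M) (p *m P) (u *m P) (u *m P) =
  tensor_form (gmetric e W0 (P *m P^T)) p u u.
Proof.
move=> [uP hP]; rewrite tensor_form_gmetric1 tensor_form_gmetric mulmx1.
suff -> : u *m P *m frame e W (p *m P) = u *m frame e W0 p *m P by [].
have := hP (- p) u; rewrite !gmul_frame mulNmx opprK => /(congr1 (+%R (p *m P))).
by rewrite !opprK mulmxDl mulNmx !addNKr => ->.
Qed.

Lemma frame_iso_length W P c : frame_iso W P -> piecewise_C1 c ->
  frame_length e W (fun t => c t *m P) = curve_length (gmetric e W0 (P *m P^T)) c.
Proof.
move=> iP pc.
have cg : continuous (gmetric e W0 (P *m P^T)) by exact: continuous_gmetric.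
have cg' : continuous (gmetric e W 1%:M) by exact: continuous_gmetric.
have h p u : tensor_form (gmetric e W 1%:M) (p *m P + 0) (u *m P) (u *m P) =
    tensor_form (gmetric e W0 (P *m P^T)) p u u by rewrite addr0 frame_iso_form.
rewrite -(curve_length_affine cg cg' pc iP.1 h) /frame_length.
by congr (curve_length _ _); apply/funext => t; rewrite addr0.
Qed.

Lemma piecewise_C1_mulmx c (A : 'M[R]_(n + n + 1)) : piecewise_C1 c ->
  piecewise_C1 (fun t => c t *m A).
Proof.
rewrite (_ : (fun t => c t *m A) = (fun t => c t *m A + t *: 0 + 0)).
  exact: piecewise_C1_affine.
by apply/funext => t; rewrite scaler0 !addr0.
Qed.

Lemma quotient_dist_spec (Gamma : heis_subgroup R n) W P : frame_iso W P ->
  qdist_spec W [set v | Gamma (v *m invmx P)]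
    (fun p q => quotient_dist (gmetric e W0 (P *m P^T))
       (quotient_proj Gamma (p *m invmx P)) (quotient_proj Gamma (q *m invmx P))).
Proof.
move=> iP; have [uP hP] := iP; split=> [c p q gamma Gg pc c0 c1|p q eta eta0].
  have pc' := piecewise_C1_mulmx (invmx P) pc.
  have E : c = (fun t => c t *m invmx P *m P) by apply/funext => t; rewrite mulmxKV.
  rewrite [in leRHS]E frame_iso_length//; apply: quotient_dist_le Gg pc' _ _.
    by rewrite c0.
  by rewrite c1 -{1}[gamma](mulmxKV uP) -{1}[q](mulmxKV uP) hP mulmxK.
have [c [gamma [Gg pc c0 c1 lc]]] :=
  quotient_dist_approx Gamma (P *m P^T) (p *m invmx P) (q *m invmx P) eta0.
exists (fun t => c t *m P), (gamma *m P); split.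
- by rewrite /= mulmxK.
- exact: piecewise_C1_mulmx.
- by rewrite c0 mulmxKV.
- by rewrite c1 -hP mulmxKV.
- by rewrite frame_iso_length.
Qed.

End HeisMatrix.

(** * The Ricci curvature at the origin *)

Section PointwiseDerivatives.
Context {R : realType} {V : normedModType R}.
Implicit Types (f g : V -> R) (x v : V).

Lemma is_derive_addf f g x v df dg : is_derive x v f df -> is_derive x v g dg ->
  is_derive x v (fun y => f y + g y) (df + dg).
Proof. exact: is_deriveD. Qed.

Lemma is_derive_subf f g x v df dg : is_derive x v f df -> is_derive x v g dg ->
  is_derive x v (fun y => f y - g y) (df - dg).
Proof. exact: is_deriveB. Qed.

Lemma is_derive_mulf f g x v df dg : is_derive x v f df -> is_derive x v g dg ->
  is_derive x v (fun y => f y * g y) (df * g x + f x * dg).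
Proof.
move=> hf hg; have := is_deriveM hf hg.
by rewrite /GRing.scale/= addrC [g x * _]mulrC.
Qed.

End PointwiseDerivatives.

Section Ricci.
Context {R : realType} {N : nat} (e : 'rV[R]_N).
Variables (W G : 'M[R]_N) (bW : bracket_form e W) (Gt : G^T = G) (Gu : G \in unitmx).
Implicit Types (p q u v : 'rV[R]_N) (i j k l m : 'I_N).
Local Notation "''e_' i" := (delta_mx 0 i : 'rV[R]_N) (at level 8, i at level 2).

(* The values at the origin of the coefficients of the Levi-Civita connection
   are products of the 1-form [eta] dual to the axis and of [J], defined by
   G(uJ, v) = W(u, v). *)
Let eta l : R := bil G e 'e_l.
Let zeta : R := bil G e e.
Let J : 'M[R]_N := W *m invmx G.
(** Equal to [W G^-1 W^T]: [bil S u u] is the squared norm, for the inverse metric, of the 1-form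
    [W(u, .)]. *)
Let S : 'M[R]_N := W *m J^T.
Let g := gmetric e W G.

Lemma is_derive_dotr p w v (a : R) :
  is_derive p w (fun q : 'rV[R]_N => a + dot q v) (dot w v).
Proof.
have E : (fun h : R => h^-1 *: (((fun q : 'rV[R]_N => a + dot q v) \o shift p) (h *: w)
    - (a + dot p v))) @ 0^' --> dot w v.
  have : (fun _ : R => dot w v) h @[h --> (0 : R)^'] --> dot w v by exact: cvg_cst.
  apply: cvg_trans; apply: near_eq_cvg.
  near=> h; have h0 : h != 0 by near: h; exact: nbhs_dnbhs_neq.
  by rewrite /= dotDl dotZl opprD addrACA subrr add0r addrK /GRing.scale/= mulKf.
by split; [exact: cvgP E|exact: cvg_lim E].
Unshelve. all: by end_near. Qed.

Lemma is_derive_bill (A : 'M[R]_N) p w v :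
  is_derive p w (fun q : 'rV[R]_N => bil A q v) (bil A w v).
Proof.
rewrite (_ : (fun q => bil A q v) = (fun q => 0 + dot q (v *m A^T))).
  by have := is_derive_dotr p w (v *m A^T) 0; rewrite /bil dot_mulmx.
by apply/funext => q; rewrite add0r /bil dot_mulmx.
Qed.

Lemma bilC_sym u v : bil G u v = bil G v u.
Proof. by rewrite /bil dot_mulmx Gt dotC. Qed.

Lemma gmetricE p j l : g p j l = G j l
   - 2^-1 * (bil W p 'e_l * eta j + bil W p 'e_j * eta l)
   + 2^-1 * 2^-1 * zeta * (bil W p 'e_j * bil W p 'e_l).
Proof.
rewrite -(bil_delta (g p)) -[bil _ _ _]/(tensor_form g p _ _) tensor_form_gmetric.
rewrite !mulmx_frame -/(bil _ _ _) bilBl !bilBr !bilZl !bilZr bil_delta.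
rewrite (bilC_sym 'e_j e) -/(eta j) -/(eta l) -/zeta; ring.
Qed.

Lemma partial_gmetric i j l p : partial i (fun q => g q j l) p =
  - 2^-1 * (W i l * (eta j - 2^-1 * zeta * bil W p 'e_j)
            + W i j * (eta l - 2^-1 * zeta * bil W p 'e_l)).
Proof.
have -> : (fun q => g q j l) = (fun q => G j l
   - 2^-1 * (bil W q 'e_l * eta j + bil W q 'e_j * eta l)
   + 2^-1 * 2^-1 * zeta * (bil W q 'e_j * bil W q 'e_l)).
  by apply/funext => q; exact: gmetricE.
rewrite /partial.
have Dj := is_derive_bill W p 'e_i 'e_j; have Dl := is_derive_bill W p 'e_i 'e_l.
have C (c : R) : is_derive p 'e_i (fun _ : 'rV[R]_N => c) 0 by exact: is_derive_cst.
have D := is_derive_addf (is_derive_subf (C (G j l))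
  (is_derive_mulf (C 2^-1) (is_derive_addf (is_derive_mulf Dl (C (eta j)))
     (is_derive_mulf Dj (C (eta l))))))
  (is_derive_mulf (C (2^-1 * 2^-1 * zeta)) (is_derive_mulf Dj Dl)).
rewrite (@derive_val _ _ _ _ _ _ _ D) !bil_delta; ring.
Qed.

Lemma W_skew i j : W i j = - W j i.
Proof. by rewrite -!bil_delta (bil_skew _ _ bW.1). Qed.

Lemma invmx_gmetric p : invmx (g p) = (frame e W (- p))^T *m invmx G *m frame e W (- p).
Proof.
have uF q : frame e W q \in unitmx by rewrite unitmxE (det_frame bW) unitr1.
have FK : frame e W p *m frame e W (- p) = 1%:M by exact: frameK bW _.
have FK' : frame e W (- p) *m frame e W p = 1%:M by rewrite -{2}[p]opprK; exact: frameK bW _.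
have gK : g p *m ((frame e W (- p))^T *m invmx G *m frame e W (- p)) = 1%:M.
  rewrite /g /gmetric -!mulmxA (mulmxA (frame e W p)^T) -trmx_mul FK' trmx1 mul1mx.
  by rewrite (mulmxA G) mulmxV// mul1mx.
have ug : g p \in unitmx by case: (mulmx1_unit gK).
by rewrite -[LHS]mulmx1 -gK mulKmx.
Qed.

Lemma mul_bracket_frame p : W *m (frame e W p)^T = W.
Proof.
rewrite -[W in LHS]trmxK -trmx_mul bW.1 mulmxN /frame mulmxBl mul1mx -scalemxAl.
by rewrite -!mulmxA bW.2 !mulmx0 scaler0 subr0 linearN /= bW.1 opprK.
Qed.

(** Each partial derivative of the metric carries an entry of [W]. In the Koszul combination those
    with indices [i], [j] cancel by skewness and the others double. A formula around the origin is
    needed, since curvature differentiates it once more. *)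
Lemma christoffel_gmetric k i j : christoffel g k i j = fun p =>
  - 2^-1 * ((eta j - 2^-1 * zeta * bil W p 'e_j) * (J i k + 2^-1 * bil S p 'e_i * e 0 k)
    + (eta i - 2^-1 * zeta * bil W p 'e_i) * (J j k + 2^-1 * bil S p 'e_j * e 0 k)).
Proof.
apply/funext => p; rewrite /christoffel.
pose c j := eta j - 2^-1 * zeta * bil W p 'e_j.
(* In [W *m invmx (g p)] one of the two frames is absorbed by [mul_bracket_frame], so the result is
   affine in [p]. *)
have B i' : \sum_l invmx (g p) k l * W i' l = J i' k + 2^-1 * bil S p 'e_i' * e 0 k.
  have -> : \sum_l invmx (g p) k l * W i' l = (W *m (invmx (g p))^T) i' k.
    by rewrite mxE; apply: eq_bigr => l _; rewrite mxE mulrC.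
  rewrite invmx_gmetric !trmx_mul trmxK trmx_inv Gt. rewrite (mulmxA W). rewrite mul_bracket_frame (mulmxA W).
  rewrite -/J; transitivity (('e_i' *m (J *m frame e W (- p)) : 'rV[R]_N) 0 k).
    by rewrite -rowE [in RHS]mxE.
  rewrite mulmxA mulmx_frame bilNl -rowE mulrN scaleNr opprK [LHS]mxE [X in X + _]mxE.
  rewrite [X in _ + X]mxE; congr (_ + _ * _ * _).
  by rewrite rowE /bil /S [in RHS]mulmxA [in RHS]dot_mulmx trmxK.
rewrite -(B i) -(B j) -/(c i) -/(c j) mulNr -mulrN; congr (_ * _).
rewrite !mulr_sumr -big_split -sumrN /=; apply: eq_bigr => l _.
rewrite !partial_gmetric (W_skew j i) (W_skew l i) (W_skew l j) /c.
by set x := invmx _ _ _; field.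
Qed.

Lemma partial_christoffel k i j m : partial m (christoffel g k i j) 0 =
  - 2^-1 * (- 2^-1 * zeta * W m j * J i k + 2^-1 * eta j * S m i * e 0 k
            - 2^-1 * zeta * W m i * J j k + 2^-1 * eta i * S m j * e 0 k).
Proof.
rewrite christoffel_gmetric /partial.
have C (c : R) : is_derive (0 : 'rV[R]_N) 'e_m (fun _ : 'rV[R]_N => c) 0.
  exact: is_derive_cst.
have DW h := is_derive_bill W 0 'e_m 'e_h.
have DS h := is_derive_bill S 0 'e_m 'e_h.
have De h := is_derive_subf (C (eta h)) (is_derive_mulf (C (2^-1 * zeta)) (DW h)).
have DJ h := is_derive_addf (C (J h k))
  (is_derive_mulf (is_derive_mulf (C 2^-1) (DS h)) (C (e 0 k))).
have D := is_derive_mulf (C (- 2^-1)) (is_derive_addf (is_derive_mulf (De j) (DJ i))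
  (is_derive_mulf (De i) (DJ j))).
rewrite (@derive_val _ _ _ _ _ _ _ D) !bil_delta !bil0l; ring.
Qed.

Lemma christoffel0 k i j :
  christoffel g k i j 0 = - 2^-1 * (eta j * J i k + eta i * J j k).
Proof. by rewrite christoffel_gmetric !bil0l; ring. Qed.

(** Contraction with [u] twice. Products of 1-forms factor under it, so every term with a factor
    [eta] in a contracted index dies when [u] is orthogonal to the axis. *)
Let contr u (F : 'I_N -> 'I_N -> R) : R := \sum_j \sum_k u 0 j * u 0 k * F j k.

Lemma contrE u F F' : (forall j k, F j k = F' j k) -> contr u F = contr u F'.
Proof. by move=> h; apply: eq_bigr => j _; apply: eq_bigr => k _; rewrite h. Qed.

Lemma contrD u F F' : contr u (fun j k => F j k + F' j k) = contr u F + contr u F'.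
Proof.
rewrite /contr -big_split; apply: eq_bigr => j _; rewrite -big_split /=.
by apply: eq_bigr => k _; rewrite mulrDr.
Qed.

Lemma contrZ u a F : contr u (fun j k => a * F j k) = a * contr u F.
Proof.
rewrite /contr mulr_sumr; apply: eq_bigr => j _; rewrite mulr_sumr.
by apply: eq_bigr => k _; rewrite mulrCA.
Qed.

Lemma contr_mul u (a b : 'I_N -> R) :
  contr u (fun j k => a j * b k) = (\sum_j u 0 j * a j) * (\sum_k u 0 k * b k).
Proof.
rewrite /contr mulr_suml; apply: eq_bigr => j _; rewrite mulr_sumr.
by apply: eq_bigr => k _; rewrite mulrACA.
Qed.

Lemma contr_bil u (A : 'M[R]_N) : contr u (fun j k => A j k) = bil A u u.
Proof.
rewrite /bil dotE /contr exchange_big; apply: eq_bigr => k _.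
by rewrite mxE mulr_suml; apply: eq_bigr => j _; rewrite mulrAC.
Qed.

Lemma sum_mulmx u (A : 'M[R]_N) i : \sum_j u 0 j * A j i = (u *m A) 0 i.
Proof. by rewrite mxE. Qed.

Lemma contr_sum u (F : 'I_N -> 'I_N -> 'I_N -> R) :
  contr u (fun j k => \sum_m F m j k) = \sum_m contr u (F m).
Proof.
rewrite /contr [RHS]exchange_big /=; apply: eq_bigr => j _.
by rewrite [RHS]exchange_big /=; apply: eq_bigr => k _; exact: mulr_sumr.
Qed.

Lemma ricci_gmetric0 u : bil G e u = 0 ->
  tensor_form (ricci g) 0 u u = - 2^-1 * (zeta * bil S u u).
Proof.
move=> ue.
have etaE v : \sum_j v 0 j * eta j = bil G e v.
  by rewrite bilC_sym /bil dot_mulmx Gt dotE; apply: eq_bigr => j _; rewrite /eta /bil dot_delta.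
have ue' : \sum_j u 0 j * eta j = 0 by rewrite etaE.
have uJe : \sum_j (u *m J) 0 j * eta j = 0.
  rewrite etaE bilC_sym /bil /J -!mulmxA mulVmx// mulmx1 -/(bil W u e).
  exact: bil_axisr bW _.
pose w i := \sum_k u 0 k * W i k.
have wE i : w i = - (u *m W) 0 i.
  by rewrite mxE -sumrN; apply: eq_bigr => k _; rewrite W_skew mulrN.
have sJ i : \sum_j u 0 j * J j i = (u *m J) 0 i by rewrite mxE.
(* Summed over [i], the two terms contribute -3/4 and 1/4 of [zeta * bil S u u], which explains the
   factor -1/2. *)
have Ri i : contr u (fun j k => riemann g i i j k 0) =
    - (2^-1 + 2^-1 * 2^-1) * zeta * ((u *m W) 0 i * (u *m J) 0 i)
    + 2^-1 * 2^-1 * bil S u u * (e 0 i * eta i).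
  pose q : R := 2^-1 * 2^-1.
  rewrite (@contrE u _ (fun j k =>
     (q * zeta) * (J j i * W i k) + (q * zeta) * (W i j * J k i)
     + (- q * e 0 i) * (S i j * eta k) + (- q * e 0 i) * (eta j * S i k)
     + (- q * zeta * J i i) * W j k + (q * e 0 i) * (S j i * eta k)
     + (- q * zeta) * (W j i * J k i) + (q * eta i * e 0 i) * S j k
     + \sum_m ((- 2^-1 * christoffel g i i m 0) * (J j m * eta k)
              + (- 2^-1 * christoffel g i i m 0) * (eta j * J k m)
              + (- q) * ((eta m * J j i + eta j * J m i) * (eta k * J i m + eta i * J k m))))); last first.
    move=> j k; rewrite /riemann !partial_christoffel; congr (_ + _).
      by rewrite /q; ring.
    by apply: eq_bigr => m _; rewrite [christoffel g m j k 0]christoffel0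
      [christoffel g i j m 0]christoffel0 [christoffel g m i k 0]christoffel0 /q; ring.
  rewrite contrD contr_sum !contrD !contrZ !contr_mul !contr_bil ue' !(mulr0, mul0r, addr0).
  rewrite (bil_alt bW) !(mulr0, mul0r, addr0) -/(w i) !sJ wE sum_mulmx.
  (* The products of Christoffel symbols reduce to a multiple of [eta(uJ) = W(u, e)], which is 0. *)
  rewrite (_ : \sum_m _ = (- q * (u *m J) 0 i * eta i) * \sum_m (u *m J) 0 m * eta m).
    by rewrite uJe mulr0 /q; field.
  rewrite mulr_sumr; apply: eq_bigr => m _.
  rewrite !contrD !contrZ !contr_mul ue' !(mulr0, mul0r, add0r).
  have split_sum x y (A B : 'I_N -> R) : \sum_j u 0 j * (x * A j + B j * y) =
      x * (\sum_j u 0 j * A j) + y * (\sum_j u 0 j * B j).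
    by rewrite !mulr_sumr -big_split /=; apply: eq_bigr => j _; ring.
  have -> : \sum_j u 0 j * (eta m * J j i + eta j * J m i) = eta m * (u *m J) 0 i.
    by rewrite split_sum ue' mulr0 addr0 sJ.
  have -> : \sum_k u 0 k * (eta k * J i m + eta i * J k m) = eta i * (u *m J) 0 m.
    by under eq_bigr do rewrite addrC; rewrite split_sum ue' mulr0 addr0 sJ.
  by rewrite /q; ring.
have -> : tensor_form (ricci g) 0 u u = \sum_i contr u (fun j k => riemann g i i j k 0).
  rewrite -contr_sum -[LHS]/(bil (ricci g 0) u u) -contr_bil.
  by apply: contrE => j k; rewrite mxE.
under eq_bigr do rewrite Ri.
rewrite big_split /= -!mulr_sumr -dotE.
have -> : \sum_i e 0 i * eta i = zeta by rewrite etaE.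
have -> : dot (u *m W) (u *m J) = bil S u u.
  by rewrite /bil /S mulmxA [RHS]dot_mulmx trmxK.
by field.
Qed.

End Ricci.

Lemma mulmx_cancel_left (R : realType) N (A B C : 'M[R]_N) :
  A \in unitmx -> A *m B = A *m C -> B = C.
Proof. by move=> uA h; rewrite -[B](mulKmx uA) h mulKmx. Qed.

(** For a horizontal unit vector the Ricci curvature is [- |w W|^2 / 2], so that a lower curvature
    bound is an upper bound on [W]. General vectors follow by homogeneity and because [W] kills the
    axis. *)
Lemma ricci_ge_form_bound (R : realType) N (e : 'rV[R]_N) (W0 W P : 'M[R]_N) (l K : R) :
  dot e e = 1 -> bracket_form e W0 -> P \in unitmx -> e *m P = l *: e ->
  W = l *: (invmx P *m W0 *m (invmx P)^T) ->
  ricci_ge (gmetric e W0 (P *m P^T)) K ->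
  forall v, enorm (v *m W) <= Num.sqrt (2 * `|K|) * enorm v.
Proof.
move=> e1 bW uP eP WE ric.
have l0 : l != 0.
  apply: contraNneq (oner_neq0 R) => l0; rewrite -e1.
  by rewrite -(mulmxK uP e) eP l0 scale0r mul0mx dot0l.
have eW : e *m W = 0.
  rewrite WE -scalemxAr !mulmxA.
  rewrite (_ : e *m invmx P = l^-1 *: e); last first.
    by apply: (scalerI l0); rewrite scalerA mulfV// scale1r scalemxAl -eP mulmxK.
  by rewrite -!scalemxAl bW.2 mul0mx !scaler0.
have GT : (P *m P^T)^T = P *m P^T by rewrite trmx_mul trmxK.
have uG : P *m P^T \in unitmx by rewrite unitmx_mul unitmx_tr uP.
have unit_bound w : dot w e = 0 -> dot w w = 1 -> dot (w *m W) (w *m W) <= 2 * `|K|.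
  move=> we ww; pose u := w *m invmx P.
  have uPw : u *m P = w by rewrite /u mulmxKV.
  have GE a b : bil (P *m P^T) a b = dot (a *m P) (b *m P).
    by rewrite /bil mulmxA dot_mulmx trmxK.
  have Ge : bil (P *m P^T) e u = 0 by rewrite GE eP uPw dotZl dotC we mulr0.
  have u1 : tensor_form (gmetric e W0 (P *m P^T)) 0 u u = 1.
    by rewrite tensor_form_gmetric1 frame0 mulmx1 uPw.
  have := ric 0 u u1; rewrite (ricci_gmetric0 bW GT uG Ge).
  have -> : bil (P *m P^T) e e = l ^+ 2 by rewrite GE eP dotZl dotZr e1 mulr1.
  have PTu : P^T \in unitmx by rewrite unitmx_tr.
  have iG : invmx (P *m P^T) = (invmx P)^T *m invmx P.
    by rewrite trmx_inv; apply: (mulmx_cancel_left uG); rewrite mulmxV// mulmxA mulmxK// mulmxV.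
  have -> : bil (W0 *m (W0 *m invmx (P *m P^T))^T) u u =
      dot (u *m W0 *m (invmx P)^T) (u *m W0 *m (invmx P)^T).
    by rewrite iG /bil mulmxA dot_mulmx trmxK dotC !mulmxA dot_mulmx.
  have -> : l ^+ 2 * dot (u *m W0 *m (invmx P)^T) (u *m W0 *m (invmx P)^T) =
      dot (w *m W) (w *m W).
    by rewrite WE -!scalemxAr !mulmxA -/u dotZl dotZr mulrA expr2.
  by have := ler_norm (- K); rewrite normrN; lra.
move=> v; pose h := horiz e v.
have hW : v *m W = h *m W by rewrite /h /horiz mulmxBl -scalemxAl eW scaler0 subr0.
have hv : enorm h <= enorm v by exact: enorm_horiz.
apply: (@le_trans _ _ (Num.sqrt (2 * `|K|) * enorm h)); last by rewrite ler_wpM2l ?sqrtr_ge0.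
rewrite hW; have [->|h0] := eqVneq h 0; first by rewrite mul0mx enorm0 mulr0.
rewrite -enorm_eq0 in h0; have hp : 0 < enorm h by rewrite lt_def h0 enorm_ge0.
have := unit_bound ((enorm h)^-1 *: h).
rewrite -scalemxAl !dotZl !dotZr -!sqr_enorm dot_horiz_axis// mulr0 => /(_ erefl).
rewrite mulrA -expr2 exprVn mulVf ?expf_neq0// => /(_ erefl) hb.
rewrite enorm_le ?mulr_ge0 ?sqrtr_ge0 ?enorm_ge0//.
rewrite exprMn sqr_sqrtr ?mulr_ge0// -[dot _ _]sqr_enorm.
rewrite -ler_pdivrMr ?exprn_gt0//; apply: le_trans hb.
by rewrite le_eqVlt; apply/orP; left; apply/eqP; field.
Qed.

(** * Fundamental domains *)

Section FundamentalDomain.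
Context {R : realType} {n : nat}.
Local Notation H := 'rV[R]_(n + n + 1).
Local Notation e := (@heis_axis R n).
Local Notation W0 := (@heis_form R n).
Variable Gamma : heis_subgroup R n.
Implicit Types (p q gamma : H) (A S : set H).

Lemma subgroup_gmul p q : Gamma p -> Gamma q -> Gamma (gmul e W0 p q).
Proof. by rewrite -heis_mulE; exact: subgroup_mul. Qed.

Definition wandering A : Prop :=
  forall p gamma, Gamma gamma -> A p -> A (gmul e W0 gamma p) -> gamma = 0.

Lemma sub_wandering A B : A `<=` B -> wandering B -> wandering A.
Proof. by move=> AB hB p gamma Gg /AB Ap /AB; exact: hB Gg Ap. Qed.

(** If [q] and [gamma q] are both close to [p], then [gamma = (gamma q) q^-1] is close to
    [p p^-1 = 0], hence equal to 0 by discreteness. *)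
Lemma wandering_ball : lattice Gamma -> forall p,
  exists2 d, 0 < d & wandering [set q | `|p - q| < d].
Proof.
move=> [disc _] p.
have [eps /= eps0 heps] := (nbhs_ballP _ _).1 (disc 0 (subgroup_one Gamma)).
have : gmul e W0 ab.1 (- ab.2) @[ab --> (p, p)] --> gmul e W0 p (- p).
  apply: cvg_gmul; first exact: cvg_cst.
    exact: cvg_fst.
  by apply: cvgN; exact: cvg_snd.
rewrite (gmulgN heis_bracket_form) => /cvg_ballP/(_ _ eps0)[[A B] /= [Ap Bp] AB].
have [d /= d0 hd] := (nbhs_ballP _ _).1 (filterI Ap Bp).
exists d => // q gamma Gg; rewrite /= => pq pgq.
have [_ Bq] : (A `&` B) q by apply: hd; rewrite -ball_normE.
have [Agq _] : (A `&` B) (gmul e W0 gamma q) by apply: hd; rewrite -ball_normE.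
have := AB (gmul e W0 gamma q, q); rewrite /= (gmulgK heis_bracket_form) => /(_ _)/heps; exact.
Qed.

(** A countable family of balls with rational centers, enumerated through [unpickle]; those that are
    not wandering are replaced by the empty set. *)
Let cell (i : nat) : set H :=
  let A := [set q | exists m (z : 'rV[int]_(n + n + 1)), unpickle i = Some (m, z) /\
    `|m.+1%:R^-1 *: map_mx intr z - q| < m.+1%:R^-1] in
  if `[< wandering A >] then A else set0.

Let cell_wandering i : wandering (cell i).
Proof. by rewrite /cell; case: ifPn => [/asboolP|_ p gamma _ []]. Qed.

Let open_cell i : open (cell i).
Proof.
rewrite /cell; case: ifPn => _; last exact: open0.
case E : (unpickle i : option (nat * 'rV[int]_(n + n + 1))) => [[m z]|]; last first.
  by rewrite (_ : [set q | _] = set0) ?open0//; apply/seteqP; split=> // q [m [z []]].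
rewrite (_ : [set q | _] = ball (m.+1%:R^-1 *: map_mx intr z : H) m.+1%:R^-1).
  by apply: ball_open; rewrite invr_gt0.
apply/seteqP; split=> q; rewrite -ball_normE /=.
  by move=> [m' [z' [[<- <-]]]].
by move=> h; exists m, z.
Qed.

Let cell_cover : lattice Gamma -> forall p, exists i, cell i p.
Proof.
move=> lG p; have [d d0 wd] := wandering_ball lG p.
(* Rounding [p] down to the grid of mesh [1/(m+1)] gives a ball of radius [1/(m+1)] that contains
   [p] and, as [2/(m+1) < d], stays in the wandering ball around [p]. *)
pose m := Num.truncn (2 / d).
have md : 2 / m.+1%:R < d.
  by rewrite ltr_pdivrMr// mulrC -ltr_pdivrMr//; exact: truncnS_gt.
pose z : 'rV[int]_(n + n + 1) := map_mx Num.floor (m.+1%:R *: p).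
exists (pickle (m, z)); rewrite /cell.
have m0 : 0 < (m.+1%:R : R) by [].
have pz : `|m.+1%:R^-1 *: map_mx intr z - p| < m.+1%:R^-1.
  have -> : m.+1%:R^-1 *: map_mx intr z - p = m.+1%:R^-1 *: (map_mx intr z - m.+1%:R *: p).
    by rewrite scalerBr scalerA mulVf ?gt_eqF// scale1r.
  rewrite normrZ ger0_norm ?invr_ge0// ltr_pdivrMl// mulfV ?gt_eqF//.
  rewrite [ltLHS]/Num.norm/= mx_normrE; apply/bigmax_ltP; split=> // -[i j] _ /=.
  rewrite !mxE distrC ger0_norm ?subr_ge0 ?floor_le_tmp//.
  by rewrite ltrBlDl -intrD1; exact: floorD1_gt.
rewrite ifT; first by exists m, z; rewrite pickleK.
apply/asboolP; apply: sub_wandering wd => q [m' [z' []]]; rewrite pickleK => -[<- <-] zq /=.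
apply: lt_trans md; rewrite -(subrKA (m.+1%:R^-1 *: map_mx intr z)).
apply: le_lt_trans (ler_normD _ _) _.
have -> : 2 / m.+1%:R = m.+1%:R^-1 + m.+1%:R^-1 :> R by ring.
by apply: ltrD => //; rewrite distrC.
Qed.

Lemma continuous_gmul gamma : continuous (gmul e W0 gamma).
Proof.
by move=> p; apply: (@cvg_gmul R _ (nbhs p) _ _ e (fun=> W0) (fun=> gamma) id);
  [exact: cvg_cst|exact: cvg_cst|exact: cvg_id].
Qed.

(** From each orbit one keeps the point in the first cell where the orbit meets [S]: unique because
    cells are wandering, Borel because [O i], the points whose orbit meets an earlier piece, is
    open. As the volume is an infimum over fundamental domains, it is bounded by that of any region
    containing one. *)
Lemma fundamental_domain_in S : lattice Gamma -> open S ->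
  (forall p, exists2 gamma, Gamma gamma & S (gmul e W0 gamma p)) ->
  exists2 F, fundamental_domain Gamma F & F `<=` S.
Proof.
move=> lG oS hS.
pose A i := S `&` cell i.
have oA i : open (A i) by apply: openI => //; exact: open_cell.
pose O i := \bigcup_(jg in [set jg : nat * H | (jg.1 < i)%N /\ Gamma jg.2])
  (gmul e W0 jg.2 @^-1` A jg.1).
have oO i : open (O i).
  apply: bigcup_open => -[j gamma] _.
  by apply: open_comp => // x _; exact: continuous_gmul.
have bA i q gamma : Gamma gamma -> A i q -> A i (gmul e W0 gamma q) -> gamma = 0.
  by move=> Gg [_ cq] [_ cgq]; exact: cell_wandering cq cgq.
exists (\bigcup_i (A i `\` O i)); last by move=> p [i _ [[]]].
split.
  have mo (B : set H) : open B -> measurable (B : set (g_sigma_algebraType (@open H))).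
    by move=> oB; exact: sub_sigma_algebra.
  apply: (@bigcup_measurable _ (g_sigma_algebraType (@open H))) => i _.
  by apply: measurableD; exact: mo.
move=> a; have [p0 <-] := quotient_proj_surj a.
have exj : exists j, `[< exists2 gamma, Gamma gamma & A j (gmul e W0 gamma p0) >].
  have [gamma Gg Sg] := hS p0; have [i ci] := cell_cover lG (gmul e W0 gamma p0).
  by exists i; apply/asboolP; exists gamma.
have [j /asboolP[gamma Gg Aj] jmin] := ex_minnP exj.
have minO g : Gamma g -> ~ O j (gmul e W0 g p0).
  move=> G_g [[i g'] /= [ij Gg'] Ai].
  move: ij; rewrite ltnNge => /negP; apply; apply: jmin.
  by apply/asboolP; exists (gmul e W0 g' g); [exact: subgroup_gmul|rewrite -(gmulA heis_bracket_form)].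
exists (gmul e W0 gamma p0); split.
  split; first by exists j => //; split=> //; exact: minO.
  by apply/esym/quotient_projP; exists gamma.
move=> p' [[i _ [Ai nO]] /esym/quotient_projP[g' Gg' p'E]].
have ij : i = j.
  apply/eqP; rewrite eqn_leq; apply/andP; split; last first.
    by apply: jmin; apply/asboolP; exists g'; rewrite -?p'E.
  rewrite leqNgt; apply/negP => ji; apply: nO.
  exists (j, gmul e W0 gamma (- g')) => /=.
    by split=> //; apply: subgroup_gmul => //; exact: subgroup_inv.
  by rewrite /= p'E -(gmulA heis_bracket_form) (gmulKg heis_bracket_form).
rewrite ij p'E in Ai.
have := bA j (gmul e W0 gamma p0) (gmul e W0 g' (- gamma)).
rewrite -(gmulA heis_bracket_form) (gmulKg heis_bracket_form).
move=> /(_ (subgroup_gmul Gg' (subgroup_inv Gg)) Aj Ai).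
by move=> /(gmul_eq0 heis_bracket_form)/oppr_inj E; rewrite p'E E.
Qed.

End FundamentalDomain.

(** * Noncollapsing makes the lattices uniformly discrete *)

Section ThinDomain.
Context {R : realType} {N : nat} (e : 'rV[R]_N) (e1 : dot e e = 1).
Implicit Types (p q u v gamma : 'rV[R]_N).

Lemma int_reduce (t s : R) : s != 0 -> exists k : int,
  `|t + k%:~R * s| <= `|s| /\ `|k%:~R| * `|s| <= `|t| + `|s|.
Proof.
move=> s0; exists (- Num.floor (t / s)).
have h : `|t + (- Num.floor (t / s))%:~R * s| <= `|s|.
  rewrite (_ : t + _ = s * (t / s - (Num.floor (t / s))%:~R)).
    rewrite normrM ler_piMr// ger0_norm ?subr_ge0 ?floor_le_tmp//.
    by rewrite lerBlDl -intrD1 ltW// floorD1_gt.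
  by rewrite rmorphN /=; field.
split=> //; rewrite -normrM -[X in `|X|](addKr t) addrC.
apply: le_trans (ler_normB _ _) _; rewrite addrC; exact: lerD.
Qed.

Definition gsubgroup (W : 'M[R]_N) (L : set 'rV[R]_N) : Prop :=
  [/\ L 0, forall p q, L p -> L q -> L (gmul e W p q) & forall p, L p -> L (- p)].

Variables (W : 'M[R]_N) (bW : bracket_form e W) (K : R) (K0 : 0 <= K)
  (WK : forall u v, `|bil W u v| <= K * enorm u * enorm v).

Lemma gmul_scale (a b : R) p : gmul e W (a *: p) (b *: p) = (a + b) *: p.
Proof. by rewrite /gmul bilZl bilZr (bil_alt bW) !mulr0 scale0r addr0 scalerDl. Qed.

Lemma gmul_scalel (a : R) gamma p :
  gmul e W (a *: gamma) p = p + a *: (gamma + (2^-1 * bil W gamma p) *: e).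
Proof. by rewrite /gmul bilZl; apply/rowP => i; rewrite !mxE; ring. Qed.

Lemma gsubgroup_int L gamma (k : int) : gsubgroup W L -> L gamma -> L (k%:~R *: gamma).
Proof.
move=> [L0 LM LV] Lg.
have Ln (m : nat) : L (m%:R *: gamma).
  elim: m => [|m IH]; first by rewrite scale0r.
  by rewrite -natr1 -gmul_scale scale1r; exact: LM.
case: k => m; first exact: Ln.
by rewrite NegzE rmorphN /= scaleNr; apply: LV; exact: Ln.
Qed.

(* Reducing modulo the powers of [gamma] brings every orbit close to the
   hyperplane orthogonal to the dominant part of [gamma]: its horizontal part, or
   the axis. *)
Lemma thin_domain L gamma r0 : gsubgroup W L -> 0 <= r0 ->
  (forall p, exists2 g, L g & enorm (gmul e W g p) <= r0) ->
  L gamma -> gamma != 0 -> enorm gamma <= 1 ->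
  exists2 a, dot a a = 1 & forall p, exists2 g, L g &
    enorm (gmul e W g p) <= r0 + (3 + 3 * (K * r0 + 1)) * (r0 + 2) /\
    `|dot (gmul e W g p) a| <= 2 * enorm gamma.
Proof.
move=> LG r00 cob Lg g0 g1; have [_ LM _] := LG.
set M := K * r0 + 1; have M1 : 1 <= M by rewrite lerDr mulr_ge0.
pose h := horiz e gamma; pose s := dot gamma e.
have gE : gamma = h + s *: e by rewrite /h /horiz subrK.
have hg : enorm h <= enorm gamma by exact: enorm_horiz.
have sg : `|s| <= enorm gamma.
  by apply: le_trans (normr_dot_le _ _) _; rewrite (enorm_axis1 e1) mulr1.
have he : dot h e = 0 by exact: dot_horiz_axis.
have Wh p : enorm p <= r0 -> `|2^-1 * bil W gamma p| <= 2^-1 * (M * enorm h).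
  move=> pr; rewrite normrM ger0_norm ?invr_ge0// ler_wpM2l//.
  rewrite -(bil_horizl bW); apply: le_trans (WK _ _) _.
  rewrite mulrAC ler_wpM2r ?enorm_ge0//; apply: (@le_trans _ _ (K * r0)).
    by rewrite ler_wpM2l.
  by rewrite lerDl.
have hn0 := enorm_ge0 h; clearbody h s.
(* A power of [gamma] moves [p1] by [k *: (gamma + x *: e)] with [|x| <= 2^-1 * M * enorm h]. If [h]
   dominates, the motion along [h] is unaffected by [x]; otherwise [|x| <= |s| / 4] cannot cancel
   [s]. In both cases the other components stay within [3 + 3 * M] times the controlled one. *)
have [caseA|caseB] := leP `|s| (2 * M * enorm h).
  have h0 : enorm h != 0.
    rewrite enorm_eq0; apply: contraNneq g0 => h0; rewrite gE h0 add0r.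
    move: caseA; rewrite h0 enorm0 mulr0 normr_le0 => /eqP ->.
    by rewrite scale0r.
  have hp : 0 < enorm h by rewrite lt_def h0.
  exists ((enorm h)^-1 *: h).
    by rewrite dotZl dotZr -sqr_enorm; field.
  move=> p; have [g1' Lg1 pr] := cob p.
  set p1 := gmul e W g1' p in pr.
  have [k [k1 k2]] := int_reduce (dot p1 ((enorm h)^-1 *: h)) h0.
  exists (gmul e W (k%:~R *: gamma) g1').
  by apply: LM => //; exact: gsubgroup_int.
  rewrite -(gmulA bW) -/p1 gmul_scalel; set x := _ * bil W gamma p1.
  have hx := Wh p1 pr; rewrite -/x in hx.
  rewrite (ger0_norm hn0) in k1 k2.
  have pa : `|dot p1 ((enorm h)^-1 *: h)| <= r0.
    apply: le_trans (normr_dot_le _ _) _.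
    by rewrite enormZ ger0_norm ?invr_ge0// mulVf// mulr1.
  split.
    apply: le_trans (ler_enormD _ _) _; apply: lerD => //.
    rewrite enormZ gE -addrA -scalerDl.
    have b1 : enorm (h + (s + x) *: e) <= (3 + 3 * M) * enorm h.
      apply: le_trans (ler_enormD _ _) _; rewrite (enorm_axis e1).
      have := ler_normD s x; nra.
    have kk : `|k%:~R : R| * enorm h <= r0 + 2 by lra.
    apply: le_trans (ler_wpM2l (normr_ge0 _) b1) _.
    by rewrite mulrCA ler_wpM2l//; lra.
  rewrite [X in `|X|](_ : _ = dot p1 ((enorm h)^-1 *: h) + k%:~R * enorm h); first by lra.
  rewrite dotDl; congr (_ + _); rewrite dotZl !dotZr gE !dotDl !dotZl (dotC e h) he.
  by rewrite !mulr0 !addr0 -sqr_enorm; congr (_ * _); field.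
have s0 : s != 0.
  apply: contraTneq caseB => ->; rewrite normr0 -leNgt !mulr_ge0//; lra.
exists e => // p; have [g1' Lg1 pr] := cob p.
set p1 := gmul e W g1' p in pr.
have hx := Wh p1 pr; set x := _ * bil W gamma p1 in hx.
have xs : `|x| <= 4^-1 * `|s| by lra.
have ns0 : 0 < `|s| by rewrite normr_gt0.
have sx1 : 4^-1 * 3 * `|s| <= `|s + x|.
  have := ler_normB (s + x) x; rewrite addrK; lra.
have sx2 : `|s + x| <= 2 * `|s| by have := ler_normD s x; lra.
have sx0 : s + x != 0 by rewrite -normr_gt0; lra.
have [k [k1 k2]] := int_reduce (dot p1 e) sx0.
exists (gmul e W (k%:~R *: gamma) g1').
  by apply: LM => //; exact: gsubgroup_int.
rewrite -(gmulA bW) -/p1 gmul_scalel -/x.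
have pa : `|dot p1 e| <= r0.
  by apply: le_trans (normr_dot_le _ _) _; rewrite (enorm_axis1 e1) mulr1.
split.
  apply: le_trans (ler_enormD _ _) _; apply: lerD => //.
  rewrite enormZ gE -addrA -scalerDl.
  have hs : enorm h <= `|s| by nra.
  have b1 : enorm (h + (s + x) *: e) <= (3 + 3 * M) * `|s + x|.
    apply: le_trans (ler_enormD _ _) _; rewrite (enorm_axis e1); nra.
  have kk : `|k%:~R : R| * `|s + x| <= r0 + 2 by lra.
  apply: le_trans (ler_wpM2l (normr_ge0 _) b1) _.
  by rewrite mulrCA ler_wpM2l//; lra.
rewrite [X in `|X|](_ : _ = dot p1 e + k%:~R * (s + x)); first by lra.
by rewrite dotDl; congr (_ + _); rewrite dotZl gE !dotDl !dotZl e1 he !mulr1 add0r.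
Qed.

End ThinDomain.

(** * Volume of a thin slab in an arbitrary direction *)

Section ThinVolume.
Context {R : realType} {N : nat}.

(** The direction [a] need not be a coordinate axis. The form [G] stretches [a] by about [1/eps],
    and its Cholesky factor [T] has determinant at least [1/eps] by Sylvester's identity. On [F] the
    vector [v *m P *m T] has squared norm at most [2 * r ^+ 2], so it lies in a box of half-width
    [2 * r], and the slab estimate applies to the upper triangular [P *m T]. *)
Lemma thin_volume (g : 'rV[R]_N -> 'M[R]_N) (P : 'M[R]_N) a (F : set 'rV[R]_N) (r eps : R) :
  pos_upper P -> (forall p, \det (g p) = \det P ^+ 2) ->
  dot a a = 1 -> 0 < eps -> 0 <= r ->
  (forall p, F p -> enorm (p *m P) <= r /\ `|dot (p *m P) a| <= eps * r) ->
  (riemannian_volume g F <= ((4 * r) ^+ N * eps)%:E)%E.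
Proof.
move=> uP dg a1 eps0 r0 hF.
pose G : 'M[R]_N := 1%:M + (eps ^- 2 *: a^T) *m a.
have GE u v : bil G u v = dot u v + eps ^- 2 * (dot u a * dot v a).
  rewrite /bil /G mulmxDr mulmx1 dotDl; congr (_ + _).
  rewrite mulmxA -scalemxAr -scalemxAl dotZl; congr (_ * _).
  by rewrite /dot [u *m a^T]mx11_scalar mul_scalar_mx -scalemxAl mxE -/(dot a v) (dotC a v) [(_%:M) 0 0]mxE eqxx mulr1n.
have GT : G^T = G.
  by rewrite /G linearD /= trmx1 trmx_mul linearZ /= trmxK -scalemxAr -scalemxAl.
have Gpos x : x != 0 -> 0 < bil G x x.
  move=> x0; rewrite GE -expr2 ltr_wpDr ?dot_gt0// mulr_ge0 ?sqr_ge0// invr_ge0.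
  exact: sqr_ge0.
have [T [uT TE]] := cholesky GT Gpos.
have dT : \det T ^+ 2 = 1 + eps ^- 2.
  rewrite expr2 -{2}det_tr -det_mulmx -TE /G det_add1_mulmx.
  rewrite -scalemxAr -/(dot a a) [a *m _]mx11_scalar -/(dot a a) a1.
  by rewrite det_mx11 !mxE eqxx mulr1n mulr1.
have dT0 := pos_upper_det_gt0 uT; have dP0 := pos_upper_det_gt0 uP.
have dTe : eps^-1 <= \det T.
  rewrite -(ler_pXn2r (n := 2))// ?nnegrE ?invr_ge0 ?(ltW eps0) ?(ltW dT0)//.
  by rewrite dT exprVn lerDr.
have uPT := pos_upperM uP uT.
rewrite /riemannian_volume.
apply: (@le_trans _ _ (\det P * ((2 * (2 * r)) ^+ N / \det (P *m T)))%:E).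
  apply: (lebesgue_integral_rV_slab (b := 0) uPT) => //.
  - by rewrite mulr_ge0.
  - exact: ltW.
  - move=> v; rewrite dg sqrtr_sqr gtr0_norm// !lee_fin.
    rewrite indicE; case: (_ \in _); rewrite ?mulr1 ?mulr0 ?lexx ?(ltW dP0)//.
  move=> v; rewrite indicE; case: (boolP (v \in F)) => [|_]; last by rewrite mulr0 eqxx.
  rewrite inE => /hF[vr va] _ i; rewrite subr0; apply: le_trans (normr_coord_le _ _) _.
  rewrite enorm_le ?mulr_ge0// mulmxA dot_mulmx -mulmxA -TE.
  rewrite dotC -/(bil G _ _) GE.
  have h1 : dot (v *m P) (v *m P) <= r ^+ 2 by rewrite -sqr_enorm ler_pXn2r// nnegrE enorm_ge0.
  have h2 : dot (v *m P) a ^+ 2 <= (eps * r) ^+ 2.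
    by rewrite -real_normK ?num_real// ler_pXn2r// ?nnegrE// mulr_ge0// ltW.
  have h3 : eps ^- 2 * dot (v *m P) a ^+ 2 <= r ^+ 2.
    by rewrite ler_pdivrMl ?exprn_gt0// -exprMn.
  rewrite -expr2; apply: le_trans (lerD h1 h3) _.
  by rewrite exprMn -mulrDl; have := sqr_ge0 r; lra.
rewrite lee_fin det_mulmx (_ : 2 * (2 * r) = 4 * r); last by ring.
have -> : \det P * ((4 * r) ^+ N / (\det P * \det T)) = (4 * r) ^+ N * (\det T)^-1.
  by field; rewrite !gt_eqF.
apply: ler_wpM2l; first by rewrite exprn_ge0// mulr_ge0.
by rewrite -[eps]invrK lef_pV2// posrE// invr_gt0.
Qed.

End ThinVolume.

(** * Uniform bounds for one manifold in its Cholesky frame *)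

Section Normalization.
Context {R : realType} {n : nat}.
Local Notation H := 'rV[R]_(n + n + 1).
Local Notation e := (@heis_axis R n).
Local Notation W0 := (@heis_form R n).
Implicit Types (p q u v : H) (P W : 'M[R]_(n + n + 1)).

Lemma heis_axisE : e = delta_mx 0 (rshift (n + n) 0).
Proof.
apply/rowP => j; rewrite [RHS]mxE /=; case: (split_ordP j) => i ->.
  by rewrite row_mxEl mxE eq_lrshift.
by rewrite row_mxEr !ord1 mxE !eqxx.
Qed.

Lemma pos_upper_axis P : pos_upper P ->
  e *m P = P (rshift (n + n) 0) (rshift (n + n) 0) *: e.
Proof.
move=> [/is_trig_mxP tP _]; rewrite heis_axisE -rowE; apply/rowP => j; rewrite !mxE /=.
case: (split_ordP j) => i ->; last by rewrite !ord1 eqxx mulr1.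
rewrite eq_lrshift mulr0; have := tP (lshift 1 i) (rshift (n + n) 0); rewrite mxE; apply.
by rewrite /= addn0.
Qed.

(** The Heisenberg bracket transported by [P]; the factor [l] is the one by which [P] scales the
    axis. *)
Definition frame_form P (l : R) := l *: (invmx P *m W0 *m (invmx P)^T).

Section Frame.
Variables (P : 'M[R]_(n + n + 1)) (l : R).
Hypotheses (uP : P \in unitmx) (l0 : l != 0) (eP : e *m P = l *: e).

Lemma axis_invmx : e *m invmx P = l^-1 *: e.
Proof.
by apply: (scalerI l0); rewrite scalerA mulfV// scale1r scalemxAl -eP mulmxK.
Qed.

Lemma frame_form_bracket : bracket_form e (frame_form P l).
Proof.
split.
  by rewrite /frame_form linearZ /= !trmx_mul trmxK heis_bracket_form.1 mulNmx mulmxN scalerN mulmxA.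
by rewrite /frame_form -scalemxAr !mulmxA axis_invmx -!scalemxAl heis_bracket_form.2 mul0mx !scaler0.
Qed.

Lemma bil_frame_form p q : bil (frame_form P l) (p *m P) (q *m P) = l * bil W0 p q.
Proof.
rewrite /bil /frame_form -scalemxAr dotZl !mulmxA mulmxK//; congr (_ * _).
by rewrite [in LHS]dot_mulmx trmxK mulmxK.
Qed.

Lemma frame_form_iso : frame_iso (frame_form P l) P.
Proof.
split=> // p q; rewrite /gmul bil_frame_form !mulmxDl -scalemxAl eP scalerA.
by congr (_ + _ *: _); rewrite -mulrA (mulrC l).
Qed.

Lemma heis_form_ker v : v *m W0 = 0 -> exists s, v = s *: e.
Proof.
move=> vW; exists (rsubmx v 0 0); rewrite -{1}[v]hsubmxK /heis_axis scale_row_mx scaler0.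
have h : lsubmx v *m block_mx 0 1%:M (- 1%:M) 0 = 0 :> 'rV[R]_(n + n).
  move: vW; rewrite -{1}[v]hsubmxK /heis_form mul_row_block !mulmx0 !addr0.
  by move/eqP; rewrite row_mx_eq0 => /andP[/eqP].
congr row_mx; last by rewrite scalemx1 -mx11_scalar.
move: h; rewrite -{1}[lsubmx v]hsubmxK mul_row_block !mulmx0 add0r addr0 mulmx1 mulmxN mulmx1.
move/eqP; rewrite row_mx_eq0 oppr_eq0 => /andP[/eqP h1 /eqP h2].
by rewrite -[lsubmx v]hsubmxK h1 h2 row_mx0.
Qed.

Lemma frame_form_ker v : v *m frame_form P l = 0 -> exists s, v = s *: e.
Proof.
rewrite /frame_form -scalemxAr => /eqP; rewrite scaler_eq0 (negPf l0) /= => /eqP.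
rewrite !mulmxA => /(congr1 (fun x => x *m P^T)); rewrite /= mul0mx -(mulmxA _ (invmx P)^T P^T) -trmx_mul mulmxV//.
rewrite trmx1 mulmx1 => /heis_form_ker[s vs]; exists (s * l).
by rewrite -[v](mulmxKV uP) vs -scalemxAl eP scalerA.
Qed.

End Frame.

Lemma frame_gsubgroup (Gamma : heis_subgroup R n) P W : frame_iso W P ->
  gsubgroup e W [set v | Gamma (v *m invmx P)].
Proof.
move=> [uP hP]; split=> [|p q|p] /=.
- by rewrite mul0mx; exact: subgroup_one.
- move=> Gp Gq; rewrite -{1}[p](mulmxKV uP) -{1}[q](mulmxKV uP) hP mulmxK//.
  exact: subgroup_gmul.
- by rewrite mulNmx; exact: subgroup_inv.
Qed.

(** A curve from 0 of length less than [D + 1] ends at a translate of [p], and [frame_curve_bound]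
    controls its endpoint. The extra 1 is there because the infimum need not be attained. *)
Lemma diameter_cobounded W L d D C : bracket_form e W -> 0 <= C ->
  (forall u v, `|bil W u v| <= C * enorm u * enorm v) -> 0 < D ->
  qdist_spec W L d -> (forall p q, d p q <= D) ->
  forall p, exists2 g, L g &
    enorm (gmul e W g p) <= (2 + 2^-1 * C * (D + 1)) * (D + 1).
Proof.
move=> bW C0 WC D0 [_ dex] dD p.
have [c [g [Lg pc c0 c1 lc]]] := dex 0 p 1 ltr01; exists g => //.
have h01 : 0 <= (1 : R) <= 1 by rewrite ler01 lexx.
have := frame_curve_bound heis_axis1 bW C0 WC pc h01.
rewrite c0 c1 subr0 enorm0 add0r => /le_trans; apply.
have l1 : frame_length e W c <= D + 1 by rewrite ltW// (lt_le_trans lc)// lerD2r.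
have l0 : 0 <= frame_length e W c by exact: curve_length_ge0.
apply: ler_pM => //; first by rewrite addr_ge0// !mulr_ge0.
by rewrite lerD2l ler_wpM2l// mulr_ge0.
Qed.

Lemma open_enorm_lt P a (r s : R) :
  open [set p : H | enorm (p *m P) < r /\ `|dot (p *m P) a| < s].
Proof.
have cP : continuous (fun p : H => p *m P).
  by move=> p; apply: (@cvg_mulmx R _ (nbhs p) _ _ _ _ id (fun=> P)); [exact: cvg_id|exact: cvg_cst].
rewrite (_ : mkset _ = (fun p => enorm (p *m P)) @^-1` [set x | x < r] `&`
  (fun p => `|dot (p *m P) a|) @^-1` [set x | x < s]); last first.
  by apply/seteqP; split=> p.
apply: openI; apply: open_comp; rewrite ?open_lt//; move=> p _.
  by apply: (@cvg_enorm R _ (nbhs p)); exact: cP.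
apply: (@continuous_cvg _ _ _ (nbhs p) _ (fun p => dot (p *m P) a) Num.norm).
  exact: norm_continuous.
by apply: (@cvg_dot R _ (nbhs p)); [exact: cP|exact: cvg_cst].
Qed.

(** A lattice element of norm [x <= 1] confines a fundamental domain to a slab of volume at most
    [(4 * r) ^+ (n + n + 1) * (3 * x / r)], which has to be at least [V]. *)
Definition systole_bound (r V : R) : R :=
  Num.min 1 (V * r / (3 * (4 * r) ^+ (n + n + 1))).

Lemma volume_systole (Gamma : heis_subgroup R n) P W r0 C V :
  lattice Gamma -> pos_upper P -> frame_iso W P -> bracket_form e W -> 0 <= C -> 0 <= r0 ->
  (forall u v, `|bil W u v| <= C * enorm u * enorm v) -> 0 < V ->
  (forall p, exists2 g, Gamma (g *m invmx P) & enorm (gmul e W g p) <= r0) ->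
  (V%:E <= quotient_volume Gamma (gmetric e W0 (P *m P^T)))%E ->
  forall gamma, Gamma (gamma *m invmx P) -> gamma != 0 ->
    systole_bound (r0 + (3 + 3 * (C * r0 + 1)) * (r0 + 2) + 1) V <= enorm gamma.
Proof.
move=> lG uP iP bW C0 r00 WC V0 cob hV gamma Gg g0.
set r := r0 + _ + 1; rewrite leNgt; apply/negP; rewrite /systole_bound lt_min => /andP[g1 gV].
have LG := frame_gsubgroup Gamma iP.
have [a a1 ha] := thin_domain heis_axis1 bW C0 WC LG r00 cob Gg g0 (ltW g1).
have r_gt0 : 0 < r by rewrite /r ltr_wpDl// addr_ge0// mulr_ge0 ?addr_ge0 ?mulr_ge0 ?addr_ge0 ?mulr_ge0.
have gp : 0 < enorm gamma by rewrite lt_def enorm_eq0 g0 enorm_ge0.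
have [uP' hP] := iP.
(* The factor 3 instead of 2 and the final 1 in [r] make the inequalities strict, so that [S] is
   open. *)
pose S := [set p : H | enorm (p *m P) < r /\ `|dot (p *m P) a| < 3 * enorm gamma].
have [F fF FS] : exists2 F, fundamental_domain Gamma F & F `<=` S.
  apply: fundamental_domain_in => //; first exact: open_enorm_lt.
  move=> p; have [g Lg [h1 h2]] := ha (p *m P).
  exists (g *m invmx P) => //; rewrite /S /= -hP mulmxKV//; split.
    by apply: le_lt_trans h1 _; rewrite /r ltrDl.
  by apply: le_lt_trans h2 _; rewrite ltr_pM2r// ltr_nat.
have vF : (riemannian_volume (gmetric e W0 (P *m P^T)) F <=
    ((4 * r) ^+ (n + n + 1) * (3 * enorm gamma / r))%:E)%E.
  apply: (thin_volume uP _ a1 _ (ltW r_gt0)).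
  - move=> p; rewrite /gmetric !det_mulmx !det_tr (det_frame heis_bracket_form).
    by rewrite mul1r mulr1 expr2.
  - by rewrite divr_gt0// mulr_gt0.
  - move=> p /FS[h1 h2]; split; first exact: ltW.
    by rewrite mulfVK ?gt_eqF// ltW.
have := le_trans hV (le_trans (ereal_inf_lbound (ex_intro2 _ _ F fF erefl)) vF).
rewrite lee_fin leNgt => /negP; apply.
have r4 : 0 < (4 * r) ^+ (n + n + 1) by rewrite exprn_gt0// mulr_gt0.
rewrite ltr_pdivlMr ?mulr_gt0// in gV.
by rewrite mulrA ltr_pdivrMr//; apply: le_lt_trans gV; rewrite le_eqVlt; apply/orP; left; apply/eqP; ring.
Qed.

(** The constants [C], [r0], [del] depend only on [n], [D], [V], [K]. The kernel condition, in
    contrast, is not quantitative and does not survive limits; [det_form_ge] makes it uniform. *)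
Lemma normalization (Gamma : heis_subgroup R n) (g : H -> 'M[R]_(n + n + 1)) D V K :
  lattice Gamma -> left_invariant_metric g -> 0 < D -> 0 < V ->
  (diameter (quotient_dist (Gamma := Gamma) g) <= D%:E)%E ->
  (V%:E <= quotient_volume Gamma g)%E -> ricci_ge g K ->
  let C := Num.sqrt (2 * `|K|) in
  let r0 := (2 + 2^-1 * C * (D + 1)) * (D + 1) in
  let del := systole_bound (r0 + (3 + 3 * (C * r0 + 1)) * (r0 + 2) + 1) V in
  exists P W, let L := [set v | Gamma (v *m invmx P)] in
  [/\ frame_iso W P, bracket_form e W /\ (forall v, v *m W = 0 -> exists s, v = s *: e),
      (forall v, enorm (v *m W) <= C * enorm v),
      [/\ gsubgroup e W L, forall p, exists2 g, L g & enorm (gmul e W g p) <= r0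
        & forall gamma, L gamma -> gamma != 0 -> del <= enorm gamma]
    & qdist_spec W L (fun p q => quotient_dist g
       (quotient_proj Gamma (p *m invmx P)) (quotient_proj Gamma (q *m invmx P)))].
Proof.
move=> lG [[gT gpos _] li] D0 V0 hD hV ric C r0 del.
have gE := left_invariantE li.
have G0pos u : u != 0 -> 0 < bil (g 0) u u by exact: gpos.
have [P [upP gP]] := cholesky (gT 0) G0pos.
have uP := pos_upper_unit upP.
pose l := P (rshift (n + n) 0) (rshift (n + n) 0).
have eP : e *m P = l *: e by exact: pos_upper_axis.
have l0 : l != 0 by rewrite gt_eqF//; exact: upP.2.
pose W := frame_form P l.
have bW : bracket_form e W by exact: frame_form_bracket.
have iP : frame_iso W P by exact: frame_form_iso.
have C0 : 0 <= C by exact: sqrtr_ge0.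
have WC v : enorm (v *m W) <= C * enorm v.
  apply: (@ricci_ge_form_bound _ _ e W0 W P l K) => //; first exact: heis_axis1.
    exact: heis_bracket_form.
  by rewrite -gP -gE.
have WC' u v : `|bil W u v| <= C * enorm u * enorm v.
  by apply: le_trans (normr_dot_le _ _) _; rewrite ler_wpM2r ?enorm_ge0.
have spec := quotient_dist_spec Gamma iP.
rewrite -gP -gE in spec.
have dD p q : quotient_dist g (quotient_proj Gamma (p *m invmx P))
    (quotient_proj Gamma (q *m invmx P)) <= D.
  rewrite -lee_fin; apply: le_trans hD; apply: ereal_sup_ubound.
  by exists (quotient_proj Gamma (p *m invmx P)) => //;
     exists (quotient_proj Gamma (q *m invmx P)).
have cob := diameter_cobounded bW C0 WC' D0 spec dD.
exists P, W; split=> //.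
- by split=> // v; exact: frame_form_ker.
split=> //; first exact: frame_gsubgroup.
move=> gamma Lg g0; apply: (volume_systole lG upP iP bW C0 _ WC' V0 cob _ Lg g0).
  by rewrite mulr_ge0// addr_ge0// ?mulr_ge0 ?addr_ge0// ltW.
by rewrite -gP -gE.
Qed.

End Normalization.

(** * Nondegeneracy of the bracket from the commutators of the lattice *)

(** A subgroup of the reals with a gap at 0 is cyclic: its positive elements have a minimum, and
    division with remainder applies. For the trivial subgroup [c] is [del]. *)
Lemma gap_subgroup (R : realType) (A : set R) (del : R) : 0 < del ->
  A 0 -> (forall a b, A a -> A b -> A (a - b)) ->
  (forall a, A a -> a != 0 -> del <= `|a|) ->
  exists2 c, del <= c & forall a, A a -> exists z : int, a = z%:~R * c.
Proof.
move=> del0 A0 AB gap.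
have [[a0 [Aa0 a00]]|noA] := pselect (exists a, A a /\ a != 0); last first.
  exists del => // a Aa; exists 0; rewrite mul0r; apply: contrapT => /eqP a0.
  by apply: noA; exists a.
have AN a : A a -> A (- a) by move=> /(AB _ _ A0); rewrite sub0r.
have AD a b : A a -> A b -> A (a + b) by move=> Aa /AN Ab; rewrite -[b]opprK; exact: AB.
pose S := [set a | A a /\ 0 < a].
have hS : has_inf S.
  split; last by exists 0 => a [_ /ltW].
  by exists `|a0|; split; [case: ger0P => // _; exact: AN|rewrite normr_gt0].
pose c := inf S.
have delc : del <= c.
  by apply: lb_le_inf; [case: hS|move=> a [Aa a_gt0]; rewrite -(gtr0_norm a_gt0) gap// gt_eqF].
have cmin a : S a -> c <= a by move=> Sa; apply: ge_inf => //; case: hS.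
have [t [At t0] tc] := inf_adherent del0 hS.
have tE : t = c.
  (* Were the infimum not attained at [t], some [t'] would lie between [c] and [t], at distance less
     than [del] from [t], against the gap. *)
  apply/eqP; rewrite eq_le cmin ?andbT//; rewrite leNgt; apply/negP => ct.
  have tc0 : 0 < t - c by rewrite subr_gt0.
  have [t' [At' t'0] t'c] := inf_adherent tc0 hS.
  have t't : t' < t by move: t'c; rewrite -/c; lra.
  have := gap _ (AB _ _ At At'); rewrite gtr0_norm ?subr_gt0// subr_eq0 gt_eqF//.
  have := cmin t' (conj At' t'0); move: tc; rewrite -/c => tc ct' /(_ isT); lra.
have c0 : 0 < c by rewrite -tE.
have Ac : A c by rewrite -tE.
exists c => // a Aa; exists (Num.floor (a / c)).
have Az (z : int) : A (z%:~R * c).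
  have An (m : nat) : A (m%:R * c).
    by elim: m => [|m IH]; [rewrite mul0r|rewrite -natr1 mulrDl mul1r; exact: AD].
  by case: z => m; [exact: An|rewrite NegzE rmorphN /= mulNr; apply/AN/An].
set z := Num.floor _; have Ar := AB _ _ Aa (Az z).
have r0 : 0 <= a - z%:~R * c by rewrite subr_ge0 -ler_pdivlMr// floor_le_tmp.
have rc : a - z%:~R * c < c.
  by rewrite ltrBlDl -{2}[c]mul1r -mulrDl -ltr_pdivrMr// -intrD1 floorD1_gt.
apply/eqP; rewrite -subr_eq0; apply: contraTT rc => r_neq0; rewrite -leNgt.
by apply: cmin; split=> //; rewrite lt_def r_neq0.
Qed.

Lemma normr_det_le (R : realType) m (B : 'M[R]_m) b :
  (forall i j, `|B i j| <= b) -> `|\det B| <= m`!%:R * b ^+ m.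
Proof.
move=> hB; apply: le_trans (ler_norm_sum _ _ _) _.
have h (s : 'S_m) : `|(-1) ^+ s * \prod_i B i (s i)| <= b ^+ m.
  rewrite normrM normrX normrN1 expr1n mul1r normr_prod.
  rewrite -[X in _ ^+ X]card_ord -prodr_const; apply: ler_prod => i _.
  by rewrite normr_ge0 hB.
apply: le_trans (ler_sum _ (fun s _ => h s)) _.
by rewrite sumr_const card_Sn mulr_natl.
Qed.

Section Nondegenerate.
Context {R : realType} {n : nat}.
Local Notation H := 'rV[R]_(n + n + 1).
Local Notation e := (@heis_axis R n).
Implicit Types (p q u v : H) (W : 'M[R]_(n + n + 1)).

Lemma bracket_form_block W : bracket_form e W -> W = block_mx (ulsubmx W) 0 0 0.
Proof.
move=> [WT]; rewrite -{1}[W]submxK /heis_axis mul_row_block !mul0mx !add0r !mul1mx.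
move=> /eqP; rewrite row_mx_eq0 => /andP[/eqP dl /eqP dr].
rewrite -{1}[W]submxK dl dr; congr (block_mx _ _ _ _).
apply/matrixP => i j; move/matrixP/(_ j i): dl.
move/matrixP/(_ (lshift 1 i) (rshift (n + n) j)): WT; rewrite !mxE => -> /eqP.
by rewrite oppr_eq0 => /eqP.
Qed.

Lemma bil_block_form W u v : bracket_form e W ->
  bil W u v = dot (lsubmx u *m ulsubmx W) (lsubmx v).
Proof.
move=> bW; rewrite {1}(bracket_form_block bW) /bil -{1}[u]hsubmxK mul_row_block.
by rewrite !mulmx0 !addr0 /dot -{1}[v]hsubmxK tr_row_mx mul_row_col mul0mx addr0.
Qed.

Lemma det_form_neq0 W : bracket_form e W -> (forall v, v *m W = 0 -> exists s, v = s *: e) ->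
  \det (ulsubmx W) != 0.
Proof.
move=> bW kW; apply/negP => /det0P[x x0 xW].
have [s] : exists s, row_mx x 0 = s *: e.
  apply: kW; rewrite (bracket_form_block bW) mul_row_block xW !mulmx0 !addr0.
  by rewrite row_mx0.
rewrite /heis_axis scale_row_mx scaler0 => /eq_row_mx[x_eq0 _].
by rewrite x_eq0 eqxx in x0.
Qed.

Lemma commutator_gmul W p q : bracket_form e W ->
  gmul e W (gmul e W p q) (gmul e W (- p) (- q)) = bil W p q *: e.
Proof.
move=> bW; rewrite {1}/gmul (bil_gmull bW) !(bil_gmulr bW) !bilNr !(bil_alt bW).
rewrite (bil_skew q p bW.1) /gmul !bilNl !bilNr; apply/rowP => i; rewrite !mxE; by field.
Qed.

(** In [det_form_ge], [\det M = \det B ^+ 2 * \det (ulsubmx W)]. The numerator bounds [\det M] from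
    below and the denominator bounds [\det B ^+ 2] from above, the entries of [B] being at most
    [r0 + s]. *)
Definition form_det_bound (del r0 : R) : R :=
  del ^+ (n + n) / ((n + n)`!%:R * (r0 + ((n + n)%:R * r0 + 1)) ^+ (n + n)) ^+ 2.

Lemma det_form_ge W L r0 del : bracket_form e W ->
  (forall v, v *m W = 0 -> exists s, v = s *: e) -> gsubgroup e W L -> 0 <= r0 -> 0 < del ->
  (forall p, exists2 g, L g & enorm (gmul e W g p) <= r0) ->
  (forall gamma, L gamma -> gamma != 0 -> del <= enorm gamma) ->
  form_det_bound del r0 <= `|\det (ulsubmx W)|.
Proof.
move=> bW kW [L0 LM LV] r00 del0 cob gap.
(* The horizontal part of the lattice element [gm i] lies within [r0] of [s] times the i-th basis
   vector; with this [s] the matrix [B] is strictly diagonally dominant. *)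
pose s := (n + n)%:R * r0 + 1.
have s0 : 0 < s by rewrite ltr_wpDl// mulr_ge0.
have /choice[gm hgm] : forall i : 'I_(n + n), exists g, L g /\
    enorm (gmul e W g (- (s *: delta_mx 0 (lshift 1 i)))) <= r0.
  by move=> i; have [g Lg h] := cob (- (s *: delta_mx 0 (lshift 1 i))); exists g.
pose B : 'M[R]_(n + n) := \matrix_(i, j) lsubmx (gm i) 0 j.
have hB i j : `|B i j - s *+ (j == i)| <= r0.
  have [_ h] := hgm i; apply: le_trans h; apply: le_trans (normr_coord_le _ (lshift 1 j)).
  have e0 : e 0 (lshift 1 j) = 0 by rewrite row_mxEl mxE.
  have gE y : gmul e W (gm i) y 0 (lshift 1 j) = gm i 0 (lshift 1 j) + y 0 (lshift 1 j).
    by rewrite /gmul mxE [X in _ + X]mxE e0 mulr0 addr0 mxE.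
  by rewrite gE !mxE /= (inj_eq (@lshift_inj _ _)) mulr_natr.
have dB : \det B != 0.
  apply/negP => /det0P[x x0 xB].
  have nx : 0 < `|x| by rewrite normr_gt0.
  suff : s * `|x| <= (n + n)%:R * r0 * `|x| by rewrite ler_pM2r// /s; lra.
  have [j xj] : exists j, `|x| = `|x 0 j|.
    have := mx_norm_neq0 (x := x); rewrite -[mx_norm x]/(`|x|) gt_eqF// => /(_ isT)[[i j] /=].
    by rewrite ord1 => ->; exists j.
  rewrite {1}xj -[s]gtr0_norm// -normrM.
  have -> : s * x 0 j = - \sum_k x 0 k * (B k j - s *+ (j == k)).
    have := congr1 (fun M : 'rV_(n + n) => M 0 j) xB; rewrite !mxE => xBj.
    under eq_bigr do rewrite mulrBr; rewrite sumrB xBj sub0r opprK.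
    rewrite (bigD1 j)//= eqxx mulr1n big1 ?addr0 1?mulrC// => k kj.
    by rewrite eq_sym (negPf kj) mulr0n mulr0.
  rewrite normrN; apply: le_trans (ler_norm_sum _ _ _) _.
  have hk k : `|x 0 k * (B k j - s *+ (j == k))| <= r0 * `|x|.
    rewrite normrM mulrC ler_pM// [leRHS]/Num.norm/= mx_normrE.
    by apply/bigmax_geP; right => /=; exists (0, k).
  apply: le_trans (ler_sum _ (fun k _ => hk k)) _.
  by rewrite sumr_const card_ord -mulrA mulr_natl.
pose M := B *m ulsubmx W *m B^T.
have ME i j : M i j = bil W (gm i) (gm j).
  rewrite (bil_block_form _ _ bW) /dot mxE [RHS]mxE; apply: eq_bigr => k _.
  rewrite !mxE; congr (_ * _); apply: eq_bigr => k' _; rewrite !mxE//.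
(* The lattice elements on the axis form a subgroup of the reals with gap [del], and commutators are
   among them. *)
have [c delc hc] : exists2 c, del <= c &
    forall a, L (a *: e) -> exists z : int, a = z%:~R * c.
  apply: (gap_subgroup (A := [set a | L (a *: e)]) del0) => /=.
  - by rewrite scale0r.
  - by move=> a b La Lb; rewrite -(gmul_scale bW) scaleNr; apply: LM => //; exact: LV.
  - move=> a La a0; rewrite -(enorm_axis (@heis_axis1 R n) a); apply: gap => //.
    rewrite scaler_eq0 negb_or a0 /=; apply: contraTneq (oner_neq0 R) => e0.
    by rewrite -(@heis_axis1 R n) e0 dot0l eqxx.
have /choice[z hz] : forall ij : 'I_(n + n) * 'I_(n + n), exists z : int, M ij.1 ij.2 = z%:~R * c.
  move=> [i j] /=; apply: hc; rewrite ME -(commutator_gmul _ _ bW).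
  have [[Li _] [Lj _]] := (hgm i, hgm j).
  by apply: (LM); apply: (LM) => //; exact: LV.
pose Z : 'M[int]_(n + n) := \matrix_(i, j) z (i, j).
have MZ : M = c *: map_mx intr Z.
  by apply/matrixP => i j; rewrite [RHS]mxE [map_mx _ _ _ _]mxE [Z _ _]mxE mulrC -hz.
have dM : \det M = \det B ^+ 2 * \det (ulsubmx W).
  by rewrite /M !det_mulmx det_tr; ring.
have dM0 : \det M != 0 by rewrite dM mulf_neq0 ?sqrf_eq0// det_form_neq0.
have c0 : 0 < c by exact: lt_le_trans delc.
(* The matrix [Z] is integral with nonzero determinant, so [|\det Z| >= 1]. *)
have dMge : del ^+ (n + n) <= `|\det M|.
  rewrite MZ detZ det_map_mx normrM normrX gtr0_norm//.
  have : \det Z != 0.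
    by apply: contraNneq dM0 => Z0; rewrite MZ detZ det_map_mx Z0 mulr0.
  rewrite -normr_gt0 gtz0_ge1 => Z1.
  apply: (@le_trans _ _ (c ^+ (n + n))); first by apply: lerXn2r => //; rewrite nnegrE ltW.
  apply: ler_peMr; first by rewrite exprn_ge0// ltW.
  by rewrite -intr_norm -[1]/(1%:~R) ler_int.
have Bb i j : `|B i j| <= r0 + s.
  rewrite -[B i j](subrK (s *+ (j == i))); apply: le_trans (ler_normD _ _) _.
  by apply: lerD => //; case: (j == i); rewrite ?mulr1n ?mulr0n ?normr0 ?gtr0_norm// ltW.
have dBb := normr_det_le Bb.
have dB2 : `|\det B| ^+ 2 <= ((n + n)`!%:R * (r0 + s) ^+ (n + n)) ^+ 2.
  by rewrite ler_pXn2r// nnegrE// (le_trans _ dBb).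
rewrite /form_det_bound -/s ler_pdivrMr; last first.
  by apply: lt_le_trans dB2; rewrite exprn_gt0// normr_gt0.
by rewrite mulrC; apply: le_trans dMge _; rewrite dM normrM normrX ler_wpM2r.
Qed.

End Nondegenerate.

(** * Symplectic bases *)

Section Darboux.
Context {R : realType}.

Lemma kernel_vector m k (A : 'M[R]_(m, k)) : (k < m)%N -> exists2 v : 'rV_m, v != 0 & v *m A = 0.
Proof.
move=> km; have : kermx A != 0.
  by rewrite -mxrank_eq0 mxrank_ker -lt0n subn_gt0 (leq_ltn_trans (rank_leq_col A)).
move=> /rowV0Pn[v vk v0]; exists v => //; exact/sub_kermxP.
Qed.

Section Extend.
Variables (m : nat) (Om : 'M[R]_m) (OmT : Om^T = - Om) (Omu : Om \in unitmx).

Lemma skew_tr j k (X : 'M[R]_(j, m)) (Y : 'M[R]_(k, m)) :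
  X *m Om *m Y^T = - (Y *m Om *m X^T)^T.
Proof. by rewrite !trmx_mul trmxK OmT mulNmx mulmxN opprK mulmxA. Qed.

Lemma skew_row0 (v : 'rV[R]_m) : v *m Om *m v^T = 0.
Proof.
apply/matrixP => i j; rewrite !ord1; have := skew_tr v v.
move/matrixP/(_ 0 0) => h; rewrite [RHS]mxE [X in - X]mxE in h.
by rewrite [RHS]mxE; lra.
Qed.

Definition symplectic_pair j (X Y : 'M[R]_(j, m)) : Prop :=
  [/\ X *m Om *m X^T = 0, Y *m Om *m Y^T = 0 & X *m Om *m Y^T = 1%:M].

(** As [2j < m], some nonzero [v] is orthogonal to all of [X] and [Y] for [Om]. A partner [u0] with
    [Om(v, u0) = 1] is obtained from [v *m Om] by rescaling. *)
Lemma symplectic_extend j (X Y : 'M[R]_(j, m)) : (j + j < m)%N -> symplectic_pair X Y ->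
  exists X' Y' : 'M[R]_(1 + j, m), symplectic_pair X' Y'.
Proof.
move=> jm [XX YY XY].
have YX : Y *m Om *m X^T = - 1%:M by rewrite skew_tr XY trmx1.
have [v v0] := kernel_vector (row_mx (Om *m X^T) (Om *m Y^T)) jm.
rewrite mul_mx_row !mulmxA => /eqP; rewrite row_mx_eq0 => /andP[/eqP vX /eqP vY].
pose w := v *m Om.
have w0 : w != 0.
  by apply: contraNneq v0 => w0; rewrite -(mulmxK Omu v) -/w w0 mul0mx.
pose u0 := (dot w w)^-1 *: w.
have wu0 : w *m u0^T = 1%:M.
  rewrite [LHS]mx11_scalar -/(dot w u0) dotZr mulVf//.
  by rewrite gt_eqF// dot_gt0.
(* Making [u0] orthogonal to [X] and [Y] does not change its pairing with [v], which is orthogonal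
   to both. *)
pose u := u0 - (u0 *m Om *m Y^T) *m X + (u0 *m Om *m X^T) *m Y.
have assoc k (a : 'rV[R]_j) (Z : 'M[R]_(j, m)) (T : 'M[R]_(k, m)) : a *m Z *m Om *m T^T = a *m (Z *m Om *m T^T).
  by rewrite !mulmxA.
have uX : u *m Om *m X^T = 0.
  rewrite /u !mulmxDl !mulNmx !assoc XX YX.
  by rewrite mulmx0 oppr0 addr0 mulmxN mulmx1 subrr.
have uY : u *m Om *m Y^T = 0.
  rewrite /u !mulmxDl !mulNmx !assoc YY XY.
  by rewrite mulmx0 addr0 mulmx1 subrr.
have vu : v *m Om *m u^T = 1%:M.
  have Xv : X *m Om *m v^T = 0 by rewrite (skew_tr X v) vX trmx0 oppr0.
  have Yv : Y *m Om *m v^T = 0 by rewrite (skew_tr Y v) vY trmx0 oppr0.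
  rewrite (skew_tr v u) /u !mulmxDl !mulNmx !assoc Xv Yv !mulmx0 subr0 addr0.
  by rewrite (skew_tr u0 v) -/w wu0 trmx1 linearN /= trmx1 opprK.
exists (col_mx v X), (col_mx u Y); split.
- rewrite tr_col_mx !mul_col_mx mul_mx_row mul_mx_row skew_row0 vX XX.
  by rewrite (skew_tr X v) vX trmx0 oppr0 !row_mx0 col_mx0.
- rewrite tr_col_mx !mul_col_mx mul_mx_row mul_mx_row skew_row0 uY YY.
  by rewrite (skew_tr Y u) uY trmx0 oppr0 !row_mx0 col_mx0.
- rewrite tr_col_mx !mul_col_mx mul_mx_row mul_mx_row vu vY XY.
  by rewrite (skew_tr X u) uX trmx0 oppr0 scalar_mx_block.
Qed.

End Extend.

Lemma darboux n (Om : 'M[R]_(n + n)) : Om^T = - Om -> Om \in unitmx ->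
  exists2 S, S \in unitmx & S *m Om *m S^T = block_mx 0 1%:M (- 1%:M) 0.
Proof.
move=> OmT Omu.
suff aux j : (j <= n)%N -> exists X Y : 'M[R]_(j, n + n), symplectic_pair Om X Y.
  have [X [Y [XX YY XY]]] := aux n (leqnn n).
  have E : col_mx X Y *m Om *m (col_mx X Y)^T = block_mx 0 1%:M (- 1%:M) 0.
    rewrite tr_col_mx !mul_col_mx !mul_mx_row XX YY XY (skew_tr OmT Y) XY trmx1.
    by [].
  exists (col_mx X Y) => //.
  have : col_mx X Y *m (Om *m (col_mx X Y)^T *m block_mx 0 (- 1%:M) 1%:M 0) = 1%:M.
    rewrite !mulmxA E mulmx_block !(mul0mx, mulmx0, mulmx1, mulmxN, add0r, addr0, opprK).
    by rewrite -scalar_mx_block.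
  by case/mulmx1_unit.
elim: j => [_|j IH jn].
  exists 0, 0; split; rewrite ?mul0mx//.
  by apply/matrixP => -[].
have [X [Y XY]] := IH (ltnW jn).
apply: symplectic_extend XY => //.
by rewrite -addnS leq_add// ltnW.
Qed.

End Darboux.

Lemma darboux_frame (R : realType) n (W : 'M[R]_(n + n + 1)) :
  bracket_form heis_axis W -> \det (ulsubmx W) != 0 -> exists Q, frame_iso W Q.
Proof.
move=> bW dW; pose Om := ulsubmx W.
have OmT : Om^T = - Om.
  by apply/matrixP => i j; move/matrixP/(_ (lshift 1 i) (lshift 1 j)): bW.1; rewrite !mxE.
have [||S Su SE] := @darboux _ _ Om; rewrite ?unitmxE ?unitfE//.
exists (block_mx S 0 0 1%:M); split.
  by rewrite unitmxE det_ublock det1 mulr1 -unitmxE.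
have lsE p : lsubmx (p *m block_mx S 0 0 1%:M) = lsubmx p *m S.
  by rewrite -{1}[p]hsubmxK mul_row_block !mulmx0 addr0 row_mxKl.
move=> p q; rewrite /gmul !mulmxDl; congr (_ + _).
have eQ : heis_axis *m block_mx S 0 0 1%:M = @heis_axis R n.
  by rewrite /heis_axis mul_row_block !mul0mx !mulmx0 !add0r mul1mx.
rewrite -scalemxAl eQ; congr (_ * _ *: _); rewrite (bil_block_form _ _ bW) (bil_block_form _ _ heis_bracket_form).
rewrite !lsE [RHS]/dot [LHS]/dot trmx_mul /heis_form block_mxKul -SE.
by rewrite !mulmxA.
Qed.

(** * Constructing Heisenberg manifolds *)

Section PolynomialFunctions.
Context {R : realType} {N : nat}.

(** A class of differentiable functions stable under partial derivatives, whence all iterated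
    derivatives exist. The coefficients of [gmetric] belong to it. *)
Inductive polynomial_fun : ('rV[R]_N -> R) -> Prop :=
| polynomial_cst c : polynomial_fun (fun _ => c)
| polynomial_coord i : polynomial_fun (fun p => p 0 i)
| polynomial_add f g : polynomial_fun f -> polynomial_fun g -> polynomial_fun (fun p => f p + g p)
| polynomial_mul f g : polynomial_fun f -> polynomial_fun g -> polynomial_fun (fun p => f p * g p).

Lemma polynomial_differentiable f p : polynomial_fun f -> differentiable f p.
Proof.
elim=> [c|i|{}f g _ df _ dg|{}f g _ df _ dg].
- exact: differentiable_cst.
- exact: differentiable_coord.
- exact: differentiableD.
- exact: differentiableM.
Qed.

Lemma polynomial_partial i f : polynomial_fun f -> polynomial_fun (partial i f).
Proof.
elim=> [c|j|{}f g pf df pg dg|{}f g pf df pg dg].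
- rewrite (_ : partial i _ = fun _ => 0); first exact: polynomial_cst.
  by apply/funext => p; rewrite /partial; exact: derive_cst.
- rewrite (_ : partial i _ = fun _ => (delta_mx 0 i : 'rV[R]_N) 0 j); first exact: polynomial_cst.
  apply/funext => p; rewrite /partial.
  have -> : (fun q : 'rV[R]_N => q 0 j) = (fun q => 0 + dot q (delta_mx 0 j)).
    by apply/funext => q; rewrite add0r dot_delta.
  by have D := is_derive_dotr p (delta_mx 0 i) (delta_mx 0 j) (0 : R);
    rewrite (@derive_val _ _ _ _ _ _ _ D) dot_delta.
- rewrite (_ : partial i _ = fun p => partial i f p + partial i g p); first exact: polynomial_add.
  by apply/funext => p; rewrite /partial -deriveD//; apply: diff_derivable;
    exact: polynomial_differentiable.
- rewrite (_ : partial i _ = fun p => partial i f p * g p + f p * partial i g p).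
    by apply: polynomial_add; apply: polynomial_mul.
  apply/funext => p; rewrite /partial.
  have Df : is_derive p (delta_mx 0 i) f ('D_(delta_mx 0 i) f p).
    by apply: derivableP; apply: diff_derivable; exact: polynomial_differentiable.
  have Dg : is_derive p (delta_mx 0 i) g ('D_(delta_mx 0 i) g p).
    by apply: derivableP; apply: diff_derivable; exact: polynomial_differentiable.
  by have D := is_derive_mulf Df Dg; rewrite (@derive_val _ _ _ _ _ _ _ D).
Qed.

Lemma polynomial_smooth f : polynomial_fun f -> smooth f.
Proof.
move=> pf s p; apply: polynomial_differentiable.
by elim: s => //= i s IH; exact: polynomial_partial.
Qed.

Lemma polynomial_bil (W : 'M[R]_N) v : polynomial_fun (fun p => bil W p v).
Proof.
rewrite (_ : (fun p => bil W p v) = (fun p => \sum_i p 0 i * (v *m W^T) 0 i)); last first.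
  by apply/funext => p; rewrite /bil dot_mulmx dotE.
elim: (index_enum _) => [|i s IH].
  rewrite (_ : (fun p => _) = fun _ => 0); first exact: polynomial_cst.
  by apply/funext => p; rewrite big_nil.
rewrite (_ : (fun p => _) = fun p : 'rV[R]_N => p 0 i * (v *m W^T) 0 i + \sum_(j <- s) p 0 j * (v *m W^T) 0 j).
  apply: polynomial_add => //; apply: polynomial_mul; [exact: polynomial_coord|exact: polynomial_cst].
by apply/funext => p; rewrite big_cons.
Qed.

Lemma gmetric_smooth e (W G : 'M[R]_N) i j : G^T = G ->
  smooth (fun p => gmetric e W G p i j).
Proof.
move=> GT; apply: polynomial_smooth.
have -> : (fun p => gmetric e W G p i j) = (fun p => (G i j
   + (- 2^-1) * (bil W p (delta_mx 0 j) * bil G e (delta_mx 0 i)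
       + bil W p (delta_mx 0 i) * bil G e (delta_mx 0 j)))
   + (2^-1 * 2^-1 * bil G e e) * (bil W p (delta_mx 0 i) * bil W p (delta_mx 0 j))).
  by apply/funext => p; rewrite gmetricE// mulNr.
have c x : polynomial_fun (fun _ => x) by exact: polynomial_cst.
have b v : polynomial_fun (fun p => bil W p v) by exact: polynomial_bil.
by do ?[apply: polynomial_add => //|apply: polynomial_mul => //].
Qed.

End PolynomialFunctions.

Section HeisManifold.
Context {R : realType} {n : nat}.
Local Notation H := 'rV[R]_(n + n + 1).
Local Notation e := (@heis_axis R n).
Local Notation W0 := (@heis_form R n).

Lemma gmetric_left_invariant_metric (Q : 'M[R]_(n + n + 1)) : Q \in unitmx ->
  left_invariant_metric (gmetric e W0 (Q *m Q^T)).
Proof.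
move=> uQ; have GT : (Q *m Q^T)^T = Q *m Q^T by rewrite trmx_mul trmxK.
split; last exact: gmetric_left_invariant.
split=> [p|p u u0|i j]; last exact: gmetric_smooth.
  by rewrite /gmetric trmx_mul trmxK trmx_mul GT mulmxA.
rewrite tensor_form_gmetric1 dot_gt0//.
have uF : frame e W0 p \in unitmx by rewrite unitmxE (det_frame heis_bracket_form) unitr1.
apply: contraNneq u0 => uFQ; rewrite -[u](mulmxK uF) -[u *m _](mulmxK uQ) uFQ.
by rewrite !mul0mx.
Qed.

Section FrameLattice.
Variables (W Q : 'M[R]_(n + n + 1)) (L : set H).
Hypotheses (iQ : frame_iso W Q) (LG : gsubgroup e W L).

Lemma frame_lattice_one : L (heis_one *m Q).
Proof. by rewrite mul0mx; case: LG. Qed.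

Lemma frame_lattice_mul p q : L (p *m Q) -> L (q *m Q) -> L (heis_mul p q *m Q).
Proof. by move=> Lp Lq; rewrite heis_mulE -(iQ.2 p q); case: LG => _ LM _; exact: LM. Qed.

Lemma frame_lattice_inv p : L (p *m Q) -> L (heis_inv p *m Q).
Proof. by rewrite mulNmx; case: LG => _ _; apply. Qed.

Definition frame_lattice : heis_subgroup R n :=
  HeisSubgroup frame_lattice_one frame_lattice_mul frame_lattice_inv.

Lemma continuous_frame_gmul gamma :
  continuous (fun p : H => enorm (gmul e W0 gamma p *m Q)).
Proof.
move=> p; apply: (@cvg_enorm R _ (nbhs p)).
apply: (@cvg_mulmx R _ (nbhs p) _ _ _ _ (gmul e W0 gamma) (fun=> Q)); last exact: cvg_cst.
exact: continuous_gmul.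
Qed.

(** Discreteness is the gap applied to [gamma^-1 p] for [p] near [gamma]. For cocompactness, the
    quotient is the continuous image of the compact set of points with [enorm (p *m Q) <= r]. *)
Lemma frame_lattice_lattice r del : 0 < del ->
  (forall p, exists2 g, L g & enorm (gmul e W g p) <= r) ->
  (forall gamma, L gamma -> gamma != 0 -> del <= enorm gamma) ->
  lattice frame_lattice.
Proof.
move=> del0 cob gap; split=> [gamma Lg|].
  have /(@cvgr_lt _ _ _ _ _ _)/(_ del) := @continuous_frame_gmul (- gamma) gamma.
  rewrite (gmulNg heis_bracket_form) mul0mx enorm0 => /(_ del0).
  apply: filterS => p /= pd Lp.
  have Lgp : L (gmul e W0 (- gamma) p *m Q).
    by rewrite -heis_mulE; apply: frame_lattice_mul => //; exact: frame_lattice_inv.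
  have : gmul e W0 (- gamma) p *m Q = 0.
    by apply: contrapT => /eqP /(gap _ Lgp); rewrite leNgt pd.
  move=> /(congr1 (fun x => x *m invmx Q)); rewrite mul0mx mulmxK ?iQ.1//.
  by move/(gmul_eq0 heis_bracket_form); rewrite opprK.
pose K := [set p : H | enorm (p *m Q) <= r].
have cK : compact K.
  apply: bounded_closed_compact.
    exists ((n + n + 1)%:R ^+ 2 * `|invmx Q| * r); split; first exact: num_real.
    move=> x rx p /= pK; apply: le_trans (norm_le_enorm _) _; apply: le_trans (ltW rx).
    rewrite -[p](mulmxK iQ.1); apply: le_trans (enorm_mulmx_le (c := `|invmx Q|) _ _) _.
      move=> i j; rewrite [leRHS]/Num.norm/= mx_normrE.
      by apply/bigmax_geP; right => /=; exists (i, j).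
    by rewrite ler_wpM2l// mulr_ge0.
  rewrite (_ : K = (fun p => enorm (gmul e W0 0 p *m Q)) @^-1` [set x | x <= r]).
    by apply: closed_comp => [p _|]; [exact: continuous_frame_gmul|exact: closed_le].
  by apply/seteqP; split=> p; rewrite /K /= gmul0g.
rewrite (_ : [set: _] = quotient_proj frame_lattice @` K).
  apply: continuous_compact cK; apply: continuous_subspaceT; exact: pi_continuous.
apply/seteqP; split=> // a _; have [p <-] := quotient_proj_surj a.
have [g Lg gr] := cob (p *m Q).
exists (gmul e W0 (g *m invmx Q) p).
  by rewrite /K /= -iQ.2 mulmxKV ?iQ.1.
by apply/esym/quotient_projP; exists (g *m invmx Q) => //=; rewrite mulmxKV ?iQ.1.
Qed.

End FrameLattice.

End HeisManifold.

(** * Limits of lattices and of quotient distances *)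

Section Ultralimits.
Context {R : realType} (U : set_system nat) (UU : UltraFilter U).
Let UF : ProperFilter U. Proof. exact: ultra_proper. Qed.
Local Existing Instance UF.

(** A cluster point of an ultrafilter is a limit, since the ultrafilter contains each set or its
    complement. *)
Lemma ultra_cvg (T : topologicalType) (K : set T) (f : nat -> T) :
  compact K -> (\forall k \near U, K (f k)) -> exists2 l, K l & f k @[k --> U] --> l.
Proof.
move=> cK Kf; have [l [Kl cl]] := cK (f @ U) _ Kf.
exists l => // B Bl; have [//|UB] := in_ultra_setVsetC (f @^-1` B) UU.
by have [x []] := cl (~` B) B UB Bl.
Qed.

Lemma ultra_cvgr (f : nat -> R) c : (\forall k \near U, `|f k| <= c) ->
  exists l : R, f k @[k --> U] --> l.
Proof.
move=> fc; have [|l _ h] := @ultra_cvg _ `[- c, c]%classic f (@segment_compact _ _ _).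
  by apply: filterS fc => k; rewrite /= in_itv /= ler_norml.
by exists l.
Qed.

Lemma ultra_cvg_mx m n (f : nat -> 'M[R]_(m, n)) c :
  (\forall k \near U, forall i j, `|f k i j| <= c) ->
  exists l : 'M[R]_(m, n), f k @[k --> U] --> l.
Proof.
move=> fc; have /choice[l hl] : forall ij : 'I_m * 'I_n, exists l : R, f k ij.1 ij.2 @[k --> U] --> l.
  by move=> [i j]; apply: (ultra_cvgr (c := c)); apply: filterS fc => k.
exists (\matrix_(i, j) l (i, j)); apply: cvg_mxP => i j; rewrite mxE.
exact: (hl (i, j)).
Qed.

Lemma ultra_cvg_rV N (f : nat -> 'rV[R]_N) c : (\forall k \near U, enorm (f k) <= c) ->
  exists l : 'rV[R]_N, f k @[k --> U] --> l.
Proof.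
move=> fc; apply: (ultra_cvg_mx (c := c)); apply: filterS fc => k fk i j.
by rewrite ord1 (le_trans (normr_coord_le _ _)).
Qed.

Lemma cvg_enorm_lt N (f : nat -> 'rV[R]_N) (l : 'rV[R]_N) eps : 0 < eps -> f k @[k --> U] --> l ->
  \forall k \near U, enorm (f k - l) < eps.
Proof.
move=> eps0 fl; have : enorm (f k - l) @[k --> U] --> enorm (l - l).
  by apply: cvg_enorm; apply: cvgB fl _; exact: cvg_cst.
by rewrite subrr enorm0 => /cvgr_lt/(_ _ eps0).
Qed.

Lemma cvg_enorm_le N (f : nat -> 'rV[R]_N) (l : 'rV[R]_N) c :
  f k @[k --> U] --> l -> (\forall k \near U, enorm (f k) <= c) -> enorm l <= c.
Proof.
move=> fl fc; rewrite leNgt; apply/negP => cl.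
have h : \forall k \near U, c < enorm (f k) by exact: (cvgr_gt _ (cvg_enorm fl)).
have [k [/= h1]] := filter_ex (filterI h fc).
by rewrite leNgt h1.
Qed.

Lemma cvg_enorm_ge N (f : nat -> 'rV[R]_N) (l : 'rV[R]_N) c :
  f k @[k --> U] --> l -> (\forall k \near U, c <= enorm (f k)) -> c <= enorm l.
Proof.
move=> fl fc; rewrite leNgt; apply/negP => cl.
have h : \forall k \near U, enorm (f k) < c by exact: (cvgr_lt _ (cvg_enorm fl)).
have [k [/= h1]] := filter_ex (filterI h fc).
by rewrite leNgt h1.
Qed.

End Ultralimits.

(** * Transfer of curves between nearby brackets *)

Section Transfer.
Context {R : realType} {N : nat} (e : 'rV[R]_N) (e1 : dot e e = 1).
Implicit Types (W : 'M[R]_N) (p q : 'rV[R]_N).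

(** Here [r] bounds the points of a curve of length [len] starting within [rad] of 0. The
    denominator is the coefficient of the tolerance in [frame_length_perturb] with [kap = al], once
    the tolerance is at most 1, so that the excess length is at most [eta]. *)
Definition transfer_tol (C len rad eta : R) : R :=
  let r := rad + (2 + 2^-1 * C * (rad + len)) * len in
  Num.min 1 (eta / (2^-1 * (r + 2 * C) * len + 1 + 2^-1 * C * (r + 2))).

Lemma transfer_tol_gt0 C len rad eta : 0 <= C -> 0 <= len -> 0 <= rad -> 0 < eta ->
  0 < transfer_tol C len rad eta.
Proof.
move=> C0 l0 r0 eta0; rewrite /transfer_tol; set r := rad + _.
have rr0 : 0 <= r by rewrite /r addr_ge0// mulr_ge0// addr_ge0// !mulr_ge0// addr_ge0.
rewrite lt_min ltr01 divr_gt0//.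
have h1 : 0 <= 2^-1 * (r + 2 * C) * len by rewrite !mulr_ge0// addr_ge0// mulr_ge0.
have h2 : 0 <= 2^-1 * C * (r + 2) by rewrite !mulr_ge0// addr_ge0.
by lra.
Qed.

Lemma curve_transfer W W' C len rad eta c p q :
  bracket_form e W -> bracket_form e W' -> 0 <= C ->
  (forall u v, `|bil W u v| <= C * enorm u * enorm v) ->
  (forall u v, `|bil W' u v| <= C * enorm u * enorm v) ->
  (forall u v, `|bil (W' - W) u v| <= transfer_tol C len rad eta * enorm u * enorm v) ->
  0 < eta -> piecewise_C1 c -> frame_length e W c <= len -> enorm (c 0) <= rad ->
  enorm (p - c 0) <= transfer_tol C len rad eta / 2 ->
  enorm (q - c 1) <= transfer_tol C len rad eta / 2 ->
  exists c', [/\ piecewise_C1 c', c' 0 = p, c' 1 = q &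
    frame_length e W' c' <= frame_length e W c + eta].
Proof.
move=> bW bW' C0 WC W'C WW' eta0 pc lc crad pp qq.
have l0 : 0 <= frame_length e W c by exact: curve_length_ge0.
have len0 : 0 <= len by exact: le_trans lc.
have rad0 : 0 <= rad by apply: le_trans crad; exact: enorm_ge0.
have tau0 := transfer_tol_gt0 C0 len0 rad0 eta0.
set tau := transfer_tol _ _ _ _ in WW' pp qq tau0.
pose r := rad + (2 + 2^-1 * C * (rad + len)) * len.
have r0 : 0 <= r by rewrite /r addr_ge0// mulr_ge0// addr_ge0// !mulr_ge0// addr_ge0.
(* Translation by [a] corrects the start, the linear drift [b] the end. The halves in the hypotheses
   keep [b] within the tolerance. *)
pose a := p - c 0; pose b := (q - c 1) - (p - c 0).
have al : enorm a <= tau by apply: le_trans pp _; lra.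
have bl : enorm b <= tau.
  by apply: le_trans (ler_enormD _ _) _; rewrite enormN; lra.
have cr t : 0 <= t <= 1 -> enorm (c t) <= r.
  move=> t01; rewrite -[c t](subrK (c 0)) addrC; apply: le_trans (ler_enormD _ _) _.
  rewrite /r lerD//; apply: le_trans (frame_curve_bound e1 bW C0 WC pc t01) _.
  apply: ler_pM => //.
    by rewrite addr_ge0// !mulr_ge0// addr_ge0// enorm_ge0.
  by rewrite lerD2l ler_wpM2l ?mulr_ge0// lerD.
exists (fun t => c t + t *: b + a); split.
- rewrite (_ : (fun t => _) = (fun t => c t *m 1%:M + t *: b + a)).
    exact: piecewise_C1_affine.
  by apply/funext => t; rewrite mulmx1.
- by rewrite scale0r addr0 /a addrC subrK.
- by rewrite scale1r /b /a -addrA subrK addrC subrK.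
apply: le_trans (frame_length_perturb e1 bW C0 bW' W'C WW' (ltW tau0) pc cr al bl) _.
have tau1 : tau <= 1 by rewrite /tau /transfer_tol ge_min lexx.
have h1 : 0 <= 2^-1 * (r + 2 * C) * len by rewrite !mulr_ge0// addr_ge0// mulr_ge0.
have h2 : 0 <= 2^-1 * C * (r + 2) by rewrite !mulr_ge0// addr_ge0.
have htau : tau * (2^-1 * (r + 2 * C) * len + 1 + 2^-1 * C * (r + 2)) <= eta.
  rewrite -ler_pdivlMr; last by lra.
  by rewrite /tau /transfer_tol -/r ge_min lexx orbT.
set x := frame_length e W c in l0 lc *.
have hA : tau * (r + 2 * C) * x <= tau * (r + 2 * C) * len.
  by apply: ler_wpM2l => //; rewrite mulr_ge0 ?(ltW tau0)// addr_ge0// mulr_ge0.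
have hB : C * tau * tau <= C * tau * 1.
  by apply: ler_wpM2l => //; rewrite mulr_ge0 ?(ltW tau0).
by apply: le_trans (_ : x + tau * (2^-1 * (r + 2 * C) * len + 1 + 2^-1 * C * (r + 2)) <= _);
  lra.
Qed.

End Transfer.

Section Limit.
Context {R : realType} {n : nat}.
Local Notation H := 'rV[R]_(n + n + 1).
Local Notation e := (@heis_axis R n).
Implicit Types (p q u v gamma : H).

Lemma bil_le_enorm (W : 'M[R]_(n + n + 1)) C : (forall v : H, enorm (v *m W) <= C * enorm v) ->
  forall u v : H, `|bil W u v| <= C * enorm u * enorm v.
Proof. by move=> h u v; apply: le_trans (normr_dot_le _ _) _; rewrite ler_wpM2r ?enorm_ge0. Qed.

Lemma enorm_gmul_le (W : 'M[R]_(n + n + 1)) C u v :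
  (forall u v : H, `|bil W u v| <= C * enorm u * enorm v) ->
  enorm (gmul e W u v) <= enorm u + enorm v + 2^-1 * (C * enorm u * enorm v).
Proof.
move=> h; apply: le_trans (ler_enormD _ _) _; apply: lerD; first exact: ler_enormD.
by rewrite (enorm_axis heis_axis1) normrM ger0_norm ?invr_ge0// ler_wpM2l.
Qed.

Lemma enorm_gmulN_le (W : 'M[R]_(n + n + 1)) C u v : bracket_form e W ->
  (forall u v : H, `|bil W u v| <= C * enorm u * enorm v) ->
  enorm (gmul e W u (- v)) <= (1 + 2^-1 * (C * enorm v)) * enorm (u - v).
Proof.
move=> bW h; rewrite /gmul (_ : bil W u (- v) = - bil W (u - v) v); last first.
  by rewrite bilBl (bil_alt bW) subr0 bilNr.
apply: le_trans (ler_enormD _ _) _; rewrite mulrDl mul1r lerD2l.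
rewrite (enorm_axis heis_axis1) normrM normrN ger0_norm ?invr_ge0// -mulrA ler_wpM2l//.
by rewrite mulrAC.
Qed.

Variables (U : set_system nat) (UU : UltraFilter U).
Let UF : ProperFilter U. Proof. exact: ultra_proper. Qed.
Local Existing Instance UF.

Variables (W : nat -> 'M[R]_(n + n + 1)) (L : nat -> set H) (d : nat -> H -> H -> R).
Variables (C r0 del D cdet : R).
Hypotheses (C0 : 0 <= C) (r00 : 0 <= r0) (del0 : 0 < del) (D0 : 0 <= D) (cdet0 : 0 < cdet).
Hypotheses (bW : forall k, bracket_form e (W k))
  (WC : forall k v, enorm (v *m W k) <= C * enorm v)
  (LG : forall k, gsubgroup e (W k) (L k))
  (cob : forall k p, exists2 g, L k g & enorm (gmul e (W k) g p) <= r0)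
  (gap : forall k gamma, L k gamma -> gamma != 0 -> del <= enorm gamma)
  (detW : forall k, cdet <= `|\det (ulsubmx (W k))|)
  (spec : forall k, qdist_spec (W k) (L k) (d k))
  (dD : forall k p q, d k p q <= D).

Let WCb k := bil_le_enorm (WC k).

Lemma limit_form : exists Wl : 'M[R]_(n + n + 1), W k @[k --> U] --> Wl.
Proof.
apply: (ultra_cvg_mx UU (c := C)); apply: nearW => k i j.
rewrite -bil_delta; apply: le_trans (WCb _ _ _) _.
by rewrite /enorm !dot_delta !mxE !eqxx sqrtr1 !mulr1.
Qed.

Variables (Wl : 'M[R]_(n + n + 1)) (WWl : W k @[k --> U] --> Wl).

(** Bounded sequences converge along [U], so every bounded choice of elements of the [L k]
    contributes a point. *)
Definition limit_lattice : set H :=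
  [set v | exists2 g : nat -> H, (forall k, L k (g k)) & g k @[k --> U] --> v].

Lemma limit_bracket : bracket_form e Wl.
Proof.
split.
  apply: (@cvg_unique _ (@norm_hausdorff _ _) ((fun k => (W k)^T) @ U)).
    exact: cvg_trmx.
  rewrite (_ : (fun k => _) = (fun k => - W k)); first exact: cvgN.
  by apply/funext => k; case: (bW k).
apply: (@cvg_unique _ (@norm_hausdorff _ _) ((fun k => e *m W k) @ U)).
  by apply: cvg_mulmx => //; exact: cvg_cst.
rewrite (_ : (fun k => _) = (fun k => 0)); first exact: cvg_cst.
by apply/funext => k; case: (bW k).
Qed.

Lemma limit_bound v : enorm (v *m Wl) <= C * enorm v.
Proof.
apply: (cvg_enorm_le UU (f := fun k => v *m W k)).
  by apply: cvg_mulmx => //; exact: cvg_cst.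
exact: nearW.
Qed.

Let WlCb := bil_le_enorm limit_bound.

Lemma limit_det : \det (ulsubmx Wl) != 0.
Proof.
have h : `|\det (ulsubmx (W k))| @[k --> U] --> `|\det (ulsubmx Wl)|.
  apply: cvg_norm; apply: cvg_det; apply: cvg_mxP => i j; rewrite !mxE.
  by under eq_fun do rewrite !mxE; exact: cvg_coord.
rewrite -normr_gt0; apply: (lt_le_trans cdet0); rewrite leNgt; apply/negP => lt_c.
have [k] := filter_ex (cvgr_lt _ h _ lt_c).
by rewrite ltNge detW.
Qed.

Lemma form_near tau : 0 < tau ->
  \forall k \near U, forall u v, `|bil (Wl - W k) u v| <= tau * enorm u * enorm v.
Proof.
move=> tau0; pose N : R := (n + n + 1)%:R ^+ 2.
have N0 : 0 < N by rewrite exprn_gt0// ltr0n addn1.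
have tN : 0 < tau / N by rewrite divr_gt0.
move/cvgrPdist_lt/(_ _ tN): WWl; apply: filterS => k hk u v.
have h : forall i j, `|(Wl - W k) i j| <= tau / N.
  move=> i j; apply: le_trans (ltW hk); rewrite [leRHS]/Num.norm/= mx_normrE.
  by apply/bigmax_geP; right => /=; exists (i, j).
by have := normr_bil_le u v h; rewrite -/N mulrCA mulfV ?gt_eqF// mulr1.
Qed.

Lemma limit_gsubgroup : gsubgroup e Wl limit_lattice.
Proof.
split.
- by exists (fun=> 0); [move=> k; case: (LG k)|exact: cvg_cst].
- move=> p q [g Lg gp] [g' Lg' gq]; exists (fun k => gmul e (W k) (g k) (g' k)).
    by move=> k; case: (LG k) => _ LM _; exact: LM.
  exact: cvg_gmul.
- move=> p [g Lg gp]; exists (fun k => - g k); last exact: cvgN.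
  by move=> k; case: (LG k) => _ _; apply.
Qed.

Lemma limit_lattice_cvg (g : nat -> H) c : (forall k, L k (g k)) ->
  (\forall k \near U, enorm (g k) <= c) -> exists2 gamma, limit_lattice gamma & g k @[k --> U] --> gamma.
Proof.
by move=> Lg gc; have [l gl] := ultra_cvg_rV UU gc; exists l => //; exists g.
Qed.

(** The elements [g k] that bring [p] near 0 are bounded, since [g k] is [(g k p) p^-1]; hence they
    have a limit. *)
Lemma limit_cobounded p : exists2 g, limit_lattice g & enorm (gmul e Wl g p) <= r0.
Proof.
have /choice[g hg] : forall k, exists g, L k g /\ enorm (gmul e (W k) g p) <= r0.
  by move=> k; have [g] := cob k p; exists g.
have [|gamma Lgam gcv] := @limit_lattice_cvg g
    (r0 + enorm p + 2^-1 * (C * r0 * enorm p)) (fun k => (hg k).1).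
  apply: nearW => k; rewrite -(gmulgK (bW k) p (g k)).
  apply: le_trans (enorm_gmul_le _ _ (@WCb k)) _; rewrite enormN.
  have [_ h] := hg k; apply: lerD; first by rewrite lerD2r.
  by rewrite ler_wpM2l// ler_wpM2r ?enorm_ge0// ler_wpM2l.
exists gamma => //; apply: (cvg_enorm_le UU (f := fun k => gmul e (W k) (g k) p)).
  by apply: cvg_gmul => //; exact: cvg_cst.
by apply: nearW => k; exact: (hg k).2.
Qed.

Lemma limit_gap gamma : limit_lattice gamma -> gamma != 0 -> del <= enorm gamma.
Proof.
move=> [g Lg gl] g0; apply: (cvg_enorm_ge UU gl).
have : \forall k \near U, 0 < enorm (g k).
  by apply: (cvgr_gt _ (cvg_enorm gl)); rewrite lt_def enorm_eq0 g0 enorm_ge0.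
by apply: filterS => k gk; apply: gap => //; rewrite -enorm_eq0 gt_eqF.
Qed.

Variables (dl : H -> H -> R) (specl : qdist_spec Wl limit_lattice dl).

(** Almost shortest curves of the k-th quotient have length at most [D + h], so the lattice elements
    at their ends are bounded and converge to some [gam]. For almost all [k] such a curve is
    transferred to [Wl] and ends at [gam q]. *)
Lemma cvg_qdist_ge (p q : H) (pk qk : nat -> H) eta : 0 < eta ->
  pk k @[k --> U] --> p -> qk k @[k --> U] --> q ->
  \forall k \near U, dl p q <= d k (pk k) (qk k) + eta.
Proof.
move=> eta0 pkp qkq; pose h := eta / 2; have h0 : 0 < h by rewrite divr_gt0.
have /choice[cg hcg] : forall k, exists cg : (R -> H) * H, [/\ L k cg.2, piecewise_C1 cg.1,
    cg.1 0 = pk k, cg.1 1 = gmul e (W k) cg.2 (qk k) &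
    frame_length e (W k) cg.1 < d k (pk k) (qk k) + h].
  by move=> k; have [c [g Hcg]] := (spec k).2 (pk k) (qk k) h h0; exists (c, g).
pose c k := (cg k).1; pose g k := (cg k).2.
have Lg k : L k (g k) by case: (hcg k).
have pc k : piecewise_C1 (c k) by case: (hcg k).
have ck0 k : c k 0 = pk k by case: (hcg k).
have ck1 k : c k 1 = gmul e (W k) (g k) (qk k) by case: (hcg k).
have lc k : frame_length e (W k) (c k) < d k (pk k) (qk k) + h by case: (hcg k).
pose len := D + h; have len0 : 0 <= len by rewrite addr_ge0// ltW.
have lenk k : frame_length e (W k) (c k) <= len.
  by apply: le_trans (ltW (lc k)) _; rewrite lerD2r.
pose rad := enorm p + 1; have rad0 : 0 <= rad by rewrite addr_ge0// enorm_ge0.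
have near_pk : \forall k \near U, enorm (pk k) <= rad.
  apply: filterS (cvg_enorm_lt UU ltr01 pkp) => k hk.
  rewrite -[pk k](subrK p); apply: le_trans (ler_enormD _ _) _.
  by rewrite addrC lerD2l ltW.
have near_qk : \forall k \near U, enorm (qk k) <= enorm q + 1.
  apply: filterS (cvg_enorm_lt UU ltr01 qkq) => k hk.
  rewrite -[qk k](subrK q); apply: le_trans (ler_enormD _ _) _.
  by rewrite addrC lerD2l ltW.
pose rr := rad + (2 + 2^-1 * C * (rad + len)) * len.
have rr0 : 0 <= rr by rewrite addr_ge0// mulr_ge0// addr_ge0// !mulr_ge0// addr_ge0.
have [|gam Lgam gcv] := @limit_lattice_cvg g
    (rr + (enorm q + 1) + 2^-1 * (C * rr * (enorm q + 1))) Lg.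
  apply: filterS2 near_pk near_qk => k pkr qkr.
  have ck1r : enorm (c k 1) <= rr.
    have h01 : 0 <= (1 : R) <= 1 by rewrite ler01 lexx.
    have := frame_curve_bound heis_axis1 (bW k) C0 (@WCb k) (pc k) h01.
    rewrite ck0 => hc; rewrite -[c k 1](subrK (pk k)) addrC.
    apply: le_trans (ler_enormD _ _) _; apply: lerD => //; apply: le_trans hc _.
    apply: ler_pM => //; first by rewrite addr_ge0// !mulr_ge0// addr_ge0 ?enorm_ge0// curve_length_ge0.
      exact: curve_length_ge0.
    by rewrite lerD2l ler_wpM2l ?mulr_ge0// lerD.
  rewrite -(gmulgK (bW k) (qk k) (g k)) -ck1.
  apply: le_trans (enorm_gmul_le _ _ (@WCb k)) _; rewrite enormN.
  apply: lerD; first exact: lerD.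
  by rewrite ler_wpM2l// ler_pM ?mulr_ge0 ?enorm_ge0// ler_wpM2l.
have tau0 := transfer_tol_gt0 C0 len0 rad0 h0; set tau := transfer_tol _ _ _ _ in tau0.
have tau2 : 0 < tau / 2 by rewrite divr_gt0.
have endq : \forall k \near U, enorm (gmul e (W k) (g k) (qk k) - gmul e Wl gam q) < tau / 2.
  by apply: (cvg_enorm_lt UU tau2); exact: cvg_gmul.
apply: filterS3 (filterI (form_near tau0) near_pk) (cvg_enorm_lt UU tau2 pkp) endq.
move=> k [fn pkr] pn qn.
have pn' : enorm (p - c k 0) <= tau / 2.
  by rewrite ck0 -enormN opprB ltW.
have qn' : enorm (gmul e Wl gam q - c k 1) <= tau / 2.
  by rewrite ck1 -enormN opprB ltW.
have ck0r : enorm (c k 0) <= rad by rewrite ck0.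
have [c' [pc' c'0 c'1 lc']] := curve_transfer heis_axis1 (bW k) limit_bracket C0
  (@WCb k) WlCb fn h0 (pc k) (lenk k) ck0r pn' qn'.
apply: le_trans (specl.1 c' p q gam Lgam pc' c'0 c'1) _; apply: le_trans lc' _.
by have := lc k; rewrite /h; lra.
Qed.

(** Conversely, one almost shortest curve for [Wl] is transferred to all nearby [W k]; its lattice
    element is by definition a limit of elements [g k]. *)
Lemma cvg_qdist_le (p q : H) (pk qk : nat -> H) eta : 0 < eta ->
  pk k @[k --> U] --> p -> qk k @[k --> U] --> q ->
  \forall k \near U, d k (pk k) (qk k) <= dl p q + eta.
Proof.
move=> eta0 pkp qkq; pose h := eta / 2; have h0 : 0 < h by rewrite divr_gt0.
have [c [gam [[g Lg gcv] pc c0 c1 lc]]] := specl.2 p q h h0.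
pose len := frame_length e Wl c; have len0 : 0 <= len by exact: curve_length_ge0.
pose rad := enorm p; have rad0 : 0 <= rad by exact: enorm_ge0.
have tau0 := transfer_tol_gt0 C0 len0 rad0 h0; set tau := transfer_tol _ _ _ _ in tau0.
have tau2 : 0 < tau / 2 by rewrite divr_gt0.
have endq : \forall k \near U, enorm (gmul e (W k) (g k) (qk k) - gmul e Wl gam q) < tau / 2.
  by apply: (cvg_enorm_lt UU tau2); exact: cvg_gmul.
apply: filterS3 (form_near tau0) (cvg_enorm_lt UU tau2 pkp) endq.
move=> k fn pn qn.
have fn' u v : `|bil (W k - Wl) u v| <= tau * enorm u * enorm v.
  by rewrite bilB_mx distrC -bilB_mx.
have pn' : enorm (pk k - c 0) <= tau / 2 by rewrite c0 ltW.
have qn' : enorm (gmul e (W k) (g k) (qk k) - c 1) <= tau / 2 by rewrite c1 ltW.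
have c0r : enorm (c 0) <= rad by rewrite c0.
have [c' [pc' c'0 c'1 lc']] := curve_transfer heis_axis1 limit_bracket (bW k) C0
  WlCb (@WCb k) fn' h0 pc (lexx _) c0r pn' qn'.
apply: le_trans ((spec k).1 c' _ _ (g k) (Lg k) pc' c'0 c'1) _; apply: le_trans lc' _.
by have := lc; rewrite /h; lra.
Qed.

(** The distance is an infimum, so zero distance only gives translates of [q] arbitrarily close to
    [p]. The gap makes all sufficiently close ones coincide. *)
Lemma limit_qdist_eq0 p q : dl p q = 0 -> exists2 gamma, limit_lattice gamma & gmul e Wl gamma q = p.
Proof.
move=> d0.
(* Curves of length [eta <= 1] from [p] end at lattice translates of [q] close to [p]. *)
pose B := (2 + 2^-1 * C * (enorm p + 1)).
have B0 : 0 < B by rewrite ltr_wpDr// !mulr_ge0// addr_ge0// enorm_ge0.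
have ex eta : 0 < eta -> eta <= 1 -> exists2 gamma, limit_lattice gamma &
    enorm (gmul e Wl gamma q - p) <= B * eta.
  move=> eta0 eta1; have [c [gam [Lgam pc c0 c1 lc]]] := specl.2 p q eta eta0.
  exists gam => //; rewrite d0 add0r in lc.
  have h01 : 0 <= (1 : R) <= 1 by rewrite ler01 lexx.
  have := frame_curve_bound heis_axis1 limit_bracket C0 WlCb pc h01; rewrite c0 c1.
  move/le_trans; apply; apply: ler_pM => //; last exact: ltW.
  - by rewrite addr_ge0// !mulr_ge0// addr_ge0 ?enorm_ge0// curve_length_ge0.
  - exact: curve_length_ge0.
  by rewrite lerD2l ler_wpM2l ?mulr_ge0// lerD2l (le_trans (ltW lc)).
pose M := 1 + 2^-1 * (C * (enorm p + B)).
have M0 : 0 < M by rewrite ltr_wpDr// !mulr_ge0// addr_ge0 ?enorm_ge0// ltW.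
(* Chosen so that the quotient of two such lattice elements has norm at most [del / 2]. *)
pose eta0 := Num.min 1 (del / (4 * M * B)).
have eta00 : 0 < eta0 by rewrite lt_min ltr01 divr_gt0// !mulr_gt0.
have eta01 : eta0 <= 1 by rewrite ge_min lexx.
have [gam Lgam hgam] := ex eta0 eta00 eta01.
exists gam => //; set x := gmul e Wl gam q in hgam *.
have xr : enorm x <= enorm p + B.
  rewrite -[x](subrK p) addrC; apply: le_trans (ler_enormD _ _) _; rewrite lerD2l.
  by apply: le_trans hgam _; rewrite ler_piMr// ltW.
apply/eqP; rewrite -subr_eq0; apply/negPn/negP => xp.
have xp0 : 0 < enorm (x - p) by rewrite lt_def enorm_eq0 xp enorm_ge0.
(* Chosen so that the second translate is at most half as far from [p] as the first; being equal to
   it, it must be [p]. *)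
pose eta1 := Num.min eta0 (enorm (x - p) / (2 * B)).
have eta10 : 0 < eta1 by rewrite lt_min eta00 divr_gt0// mulr_gt0.
have eta1le : eta1 <= eta0 by rewrite ge_min lexx.
have [gam' Lgam' hgam'] := ex eta1 eta10 (le_trans eta1le eta01).
set x' := gmul e Wl gam' q in hgam'.
have [_ LM LV] := limit_gsubgroup.
have Lg : limit_lattice (gmul e Wl gam' (- gam)) by apply: LM => //; exact: LV.
have gE : gmul e Wl gam' (- gam) = gmul e Wl x' (- x).
  have -> : - x = gmul e Wl (- q) (- gam).
    apply/esym/(gmul_eq0 limit_bracket).
    by rewrite (gmulA limit_bracket) (gmulgK limit_bracket) (gmulgN limit_bracket).
  by rewrite (gmulA limit_bracket) (gmulgK limit_bracket).
have gsmall : enorm (gmul e Wl gam' (- gam)) < del.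
  rewrite gE; apply: le_lt_trans (enorm_gmulN_le _ _ limit_bracket WlCb) _.
  have xx' : enorm (x' - x) <= B * eta1 + B * eta0.
    rewrite -(subrKA p); apply: le_trans (ler_enormD _ _) _; apply: lerD => //.
    by rewrite -enormN opprB.
  apply: (@le_lt_trans _ _ (M * (2 * (B * eta0)))).
    apply: ler_pM => //; [by rewrite addr_ge0// !mulr_ge0// enorm_ge0|exact: enorm_ge0| |].
      by rewrite /M lerD2l ler_wpM2l// ler_wpM2l.
    apply: le_trans xx' _; have : B * eta1 <= B * eta0 by rewrite ler_pM2l.
    by lra.
  have : eta0 <= del / (4 * M * B) by rewrite ge_min lexx orbT.
  rewrite ler_pdivlMr ?mulr_gt0// => h.
  have -> : M * (2 * (B * eta0)) = 2^-1 * (eta0 * (4 * M * B)) by field.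
  by move: h del0; set y := eta0 * _ => *; lra.
have g0 : gmul e Wl gam' (- gam) = 0.
  by apply: contrapT => /eqP /(limit_gap Lg); rewrite leNgt gsmall.
have gg : gam' = gam by move/(gmul_eq0 limit_bracket)/oppr_inj: g0 => ->.
have : enorm (x - p) <= B * (enorm (x - p) / (2 * B)).
  have -> : x = x' by rewrite /x /x' gg.
  apply: le_trans hgam' _; rewrite ler_pM2l//.
  by rewrite /eta1 /x /x' gg ge_min lexx orbT.
have -> : B * (enorm (x - p) / (2 * B)) = 2^-1 * enorm (x - p) by field; rewrite gt_eqF.
by lra.
Qed.

End Limit.

(** * Gromov--Hausdorff approximations and the theorem *)

(** Each [phi y] is within [eps] of [y] in a common metric space [Z], whence the errors [2 * eps].
    The embedding also supplies the triangle inequality for [dX], which is not proved from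
    curves. *)
Lemma gh_approximation (R : realType) (X Y : Type) (dX : X -> X -> R) (dY : Y -> Y -> R) eps :
  (gh_dist dX dY < eps%:E)%E ->
  (forall x y z, dX x z <= dX x y + dX y z) /\
  exists phi : Y -> X, (forall y y', `|dX (phi y) (phi y') - dY y y'| <= 2 * eps) /\
    forall x, exists y, dX x (phi y) <= 2 * eps.
Proof.
move=> /ereal_inf_lt[_ [Z [i [j [pi pj ->]]]]].
rewrite /hausdorff_dist gt_max => /andP[hX hY].
split=> [x y z|]; first by rewrite -!pi; exact: metric_triangle.
have nearX x : exists y, mdist (i x) (j y) < eps.
  have : (ereal_inf [set (mdist (i x) b)%:E | b in range j] < eps%:E)%E.
    by apply: le_lt_trans hX; apply: ereal_sup_ubound; exists (i x) => //; exists x.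
  by move=> /ereal_inf_lt[_ [_ [y _ <-] <-]]; rewrite lte_fin => h; exists y.
have /choice[phi hphi] : forall y, exists x, mdist (i x) (j y) < eps.
  move=> y; have : (ereal_inf [set (mdist a (j y))%:E | a in range i] < eps%:E)%E.
    by apply: le_lt_trans hY; apply: ereal_sup_ubound; exists (j y) => //; exists y.
  by move=> /ereal_inf_lt[_ [_ [x _ <-] <-]]; rewrite lte_fin => h; exists x.
exists phi; split=> [y y'|x].
  rewrite -pi -pj ler_norml; have h := hphi y; have h' := hphi y'.
  have t1 := metric_triangle (i (phi y)) (j y) (i (phi y')).
  have t2 := metric_triangle (j y) (j y') (i (phi y')).
  have t3 := metric_triangle (j y) (i (phi y)) (j y').
  have t4 := metric_triangle (i (phi y)) (i (phi y')) (j y').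
  rewrite (metric_sym (j y') (i (phi y'))) in t2.
  rewrite (metric_sym (j y) (i (phi y))) in t3.
  by apply/andP; split; lra.
have [y hy] := nearX x; exists y; rewrite -pi.
apply: le_trans (metric_triangle _ (j y) _) _.
by rewrite (metric_sym (j y)); have := hphi y; lra.
Qed.

Lemma isometric_onto (R : realType) (X : metricType R) (Y : Type) (dY : Y -> Y -> R)
    (f : X -> Y) :
  dist_preserving mdist dY f -> (forall y, exists x, f x = y) -> isometric (@mdist R X) dY.
Proof.
move=> fd fs; exists f; split=> //.
have finj : injective f.
  by move=> x x' fx; apply: mdist_positivity; rewrite -fd fx fd mdistxx.
have /choice[h fh] : forall y, exists x, f x = y by [].
by exists h => [x|y]; [apply: finj; rewrite fh|].
Qed.

Lemma le_of_close (R : realType) (a b x c eta : R) :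
  `|b - x| <= c -> c < eta / 2 -> a <= b + eta / 2 -> a <= eta + x.
Proof. by rewrite ler_norml => /andP[h1 h2] h3 h4; lra. Qed.

Lemma ge_of_close (R : realType) (a b x c eta : R) :
  `|b - x| <= c -> c < eta / 2 -> b <= a + eta / 2 -> x <= eta + a.
Proof. by rewrite ler_norml => /andP[h1 h2] h3 h4; lra. Qed.

Lemma le_of_chain (R : realType) (a b b1 b2 x c eta : R) :
  a <= b + eta / 4 -> b <= b1 + b2 -> b1 <= c -> `|b2 - x| <= c -> c < eta / 4 ->
  x < eta / 4 -> a <= eta + 0.
Proof. by rewrite ler_norml => h1 h2 h3 /andP[h4 h5] h6 h7; lra. Qed.

(** Adding the harmonic sequence makes the inequality strict, as required to pick an element from
    the infimum that defines [gh_dist]. Finitely many terms may be infinite. *)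
Lemma small_sequence (R : realType) (u : nat -> \bar R) : u k @[k --> \oo] --> 0%E ->
  exists2 eps : nat -> R, eps k @[k --> \oo] --> 0 & \forall k \near \oo, (u k < (eps k)%:E)%E.
Proof.
move=> /fine_cvgP[ufin u0]; exists (fun k => fine (u k) + harmonic k).
  by rewrite -[0]addr0; apply: cvgD => //; exact: cvg_harmonic.
apply: filterS ufin => k uk; rewrite -{1}(fineK uk) lte_fin ltrDl.
by rewrite invr_gt0.
Qed.

Theorem theorem1p1 (R : realType) (n : nat) (hn : (1 <= n)%N)
    (Gamma : nat -> heis_subgroup R n)
    (g : nat -> 'rV[R]_(n + n + 1) -> 'M[R]_(n + n + 1))
    (hGamma : forall k, lattice (Gamma k))
    (hg : forall k, left_invariant_metric (g k))
    (X : metricType R) (hX : compact [set: X])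
    (hlim : (fun k => gh_dist (quotient_dist (Gamma := Gamma k) (g k))
                              (@mdist R X)) @ \oo --> 0%E)
    (D V K : R) (hD : 0 < D) (hV : 0 < V)
    (hdiam : forall k,
       (diameter (quotient_dist (Gamma := Gamma k) (g k)) <= D%:E)%E)
    (hvol : forall k, (V%:E <= quotient_volume (Gamma k) (g k))%E)
    (hric : forall k, ricci_ge (g k) K) :
  exists (Gamma' : heis_subgroup R n)
         (g' : 'rV[R]_(n + n + 1) -> 'M[R]_(n + n + 1)),
    [/\ lattice Gamma', left_invariant_metric g'
      & isometric (@mdist R X) (quotient_dist (Gamma := Gamma') g')].
Proof.
have [eps eps0 gh_eps] := small_sequence hlim.
(* What holds eventually holds along [U], and the representatives of all points of [X] converge
   along this same [U]. *)
have [U [UU ooU]] := @ultraFilterLemma _ \oo _.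
have UF : ProperFilter U by exact: ultra_proper.
have near_gh : \forall k \near U, (gh_dist (quotient_dist (Gamma := Gamma k) (g k))
    (@mdist R X) < (eps k)%:E)%E by exact: ooU.
have near_eps eta : 0 < eta -> \forall k \near U, eps k < eta.
  by move=> eta0; apply: ooU; exact: (cvgr_lt _ eps0).
pose C := Num.sqrt (2 * `|K|).
pose r0 := (2 + 2^-1 * C * (D + 1)) * (D + 1).
pose del := @systole_bound R n (r0 + (3 + 3 * (C * r0 + 1)) * (r0 + 2) + 1) V.
have C0 : 0 <= C by exact: sqrtr_ge0.
have r00 : 0 <= r0.
  by rewrite mulr_ge0 ?addr_ge0 ?mulr_ge0 ?addr_ge0// ltW.
have r1_gt0 : 0 < r0 + (3 + 3 * (C * r0 + 1)) * (r0 + 2) + 1.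
  move: (r0) r00 => x x0.
  by rewrite ltr_wpDl// addr_ge0// mulr_ge0 ?addr_ge0 ?mulr_ge0 ?addr_ge0 ?mulr_ge0.
have del0 : 0 < del.
  by rewrite lt_min ltr01 divr_gt0 ?mulr_gt0// exprn_gt0// mulr_gt0.
have cdet0 : 0 < @form_det_bound R n del r0.
  move: (r0) r00 (del) del0 => x x0 y y0; rewrite /form_det_bound.
  rewrite divr_gt0 ?exprn_gt0// mulr_gt0 ?ltr0n ?fact_gt0// exprn_gt0//.
  by rewrite ltr_wpDl// ltr_wpDl// mulr_ge0.
have /choice[P /choice[W hPW]] := fun k => @normalization R n (Gamma k) (g k) D V K
  (hGamma k) (hg k) hD hV (hdiam k) (hvol k) (hric k).
pose L k : set 'rV[R]_(n + n + 1) := [set v | Gamma k (v *m invmx (P k))].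
pose d k (p q : 'rV[R]_(n + n + 1)) := quotient_dist (g k)
  (quotient_proj (Gamma k) (p *m invmx (P k))) (quotient_proj (Gamma k) (q *m invmx (P k))).
have iP k : frame_iso (W k) (P k) by case: (hPW k).
have bW k : bracket_form heis_axis (W k) by case: (hPW k) => _ [].
have kW k : forall v, v *m W k = 0 -> exists s, v = s *: heis_axis by case: (hPW k) => _ [].
have WC k : forall v, enorm (v *m W k) <= C * enorm v by case: (hPW k).
have LG k : gsubgroup heis_axis (W k) (L k) by case: (hPW k) => _ _ _ [].
have cob k : forall p, exists2 g, L k g & enorm (gmul heis_axis (W k) g p) <= r0.
  by case: (hPW k) => _ _ _ [].
have gap k : forall gamma, L k gamma -> gamma != 0 -> del <= enorm gamma.
  by case: (hPW k) => _ _ _ [].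
have spec k : qdist_spec (W k) (L k) (d k) by case: (hPW k).
have dD k p q : d k p q <= D.
  rewrite -lee_fin; apply: le_trans (hdiam k); apply: ereal_sup_ubound.
  by exists (quotient_proj (Gamma k) (p *m invmx (P k))) => //;
     exists (quotient_proj (Gamma k) (q *m invmx (P k))).
have detW k := det_form_ge (bW k) (@kW k) (LG k) r00 del0 (@cob k) (@gap k).
have triangle : \forall k \near U, forall p q r, d k p r <= d k p q + d k q r.
  by apply: filterS near_gh => k /gh_approximation[tri _] p q r; exact: tri.
(* Representatives in a fixed ball, so that they have limits. *)
have lift k (a : heis_quotient (Gamma k)) :
    exists2 p, quotient_proj (Gamma k) (p *m invmx (P k)) = a & enorm p <= r0.
  have [p <-] := quotient_proj_surj a; have [gam Lgam h] := cob k (p *m P k).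
  exists (gmul heis_axis (W k) gam (p *m P k)) => //.
  apply/esym/quotient_projP; exists (gam *m invmx (P k)) => //.
  by rewrite -{1}[gam](mulmxKV (iP k).1) (iP k).2 mulmxK ?(iP k).1.
(* The approximation property holds only for almost all [k]; for the others [F] is the constant 0,
   which keeps it bounded for every [k]. *)
have /choice[F hF] : forall k, exists F : X -> 'rV[R]_(n + n + 1),
    (forall x, enorm (F x) <= r0) /\
    ((gh_dist (quotient_dist (Gamma := Gamma k) (g k)) (@mdist R X) < (eps k)%:E)%E ->
     (forall x y, `|d k (F x) (F y) - mdist x y| <= 2 * eps k) /\
     forall p, exists x, d k p (F x) <= 2 * eps k).
  move=> k; have [hk|nhk] := pselect ((gh_dist (quotient_dist (Gamma := Gamma k) (g k))
      (@mdist R X) < (eps k)%:E)%E); last first.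
    by exists (fun=> 0); split=> // x; rewrite enorm0.
  have [_ [phi [phi1 phi2]]] := gh_approximation hk.
  have /choice[F hF] : forall x, exists p, quotient_proj (Gamma k) (p *m invmx (P k)) = phi x
      /\ enorm p <= r0 by move=> x; have [p] := lift k (phi x); exists p.
  exists F; split=> [x|_]; first exact: (hF x).2.
  split=> [x y|p]; first by rewrite /d (hF x).1 (hF y).1.
  have [x hx] := phi2 (quotient_proj (Gamma k) (p *m invmx (P k))).
  by exists x; rewrite /d (hF x).1.
have Fdist : \forall k \near U, forall x y, `|d k (F k x) (F k y) - mdist x y| <= 2 * eps k.
  by apply: filterS near_gh => k /(hF k).2[].
have Fonto : \forall k \near U, forall p, exists x, d k p (F k x) <= 2 * eps k.
  by apply: filterS near_gh => k /(hF k).2[].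
have [Wl WWl] := limit_form UU WC.
pose Ll := limit_lattice U L.
have bWl := limit_bracket UU bW WWl.
have LGl : gsubgroup heis_axis Wl Ll := limit_gsubgroup UU LG WWl.
have [Q iQ] := darboux_frame bWl (limit_det UU cdet0 detW WWl).
pose Gam' := frame_lattice iQ LGl; pose g' := gmetric heis_axis heis_form (Q *m Q^T).
pose dl (p q : 'rV[R]_(n + n + 1)) := quotient_dist g'
  (quotient_proj Gam' (p *m invmx Q)) (quotient_proj Gam' (q *m invmx Q)).
have specl : qdist_spec Wl Ll dl.
  have := quotient_dist_spec Gam' iQ; congr qdist_spec.
  by apply/funext => v; rewrite /= mulmxKV ?iQ.1.
have /choice[Fl hFl] : forall x : X, exists p : 'rV[R]_(n + n + 1), F k x @[k --> U] --> p.
  by move=> x; apply: (ultra_cvg_rV UU (c := r0)); apply: nearW => k; exact: (hF k).1.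
have near_eps' eta : 0 < eta -> \forall k \near U, 2 * eps k < eta.
  move=> eta0; have eta2 : 0 < eta / 2 by rewrite divr_gt0.
  by apply: filterS (near_eps _ eta2) => k; rewrite ltr_pdivlMr// mulrC.
exists Gam', g'; split.
- exact: frame_lattice_lattice del0 (limit_cobounded UU C0 bW WC cob WWl) (limit_gap UU gap).
- exact: gmetric_left_invariant_metric iQ.1.
apply: (@isometric_onto _ _ _ _ (fun x => quotient_proj Gam' (Fl x *m invmx Q))).
  move=> x y; rewrite -/(dl (Fl x) (Fl y)); apply/eqP; rewrite eq_le; apply/andP; split.
    apply/ler_addgt0Pl => eta eta0; have eta2 : 0 < eta / 2 by rewrite divr_gt0.
    have [k [[h1 h2] h3]] := filter_ex (filterI (filterI Fdist (near_eps' _ eta2))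
      (cvg_qdist_ge UU C0 (ltW hD) bW WC spec dD WWl specl eta2 (hFl x) (hFl y))).
    exact: le_of_close (h1 x y) h2 h3.
  apply/ler_addgt0Pl => eta eta0; have eta2 : 0 < eta / 2 by rewrite divr_gt0.
  have [k [[h1 h2] h3]] := filter_ex (filterI (filterI Fdist (near_eps' _ eta2))
    (cvg_qdist_le UU C0 bW WC spec WWl specl eta2 (hFl x) (hFl y))).
  exact: ge_of_close (h1 x y) h2 h3.
move=> a; have [p <-] := quotient_proj_surj a; pose v := p *m Q.
(* The point [x0] is a default value for the indices at which [F k] is not almost onto. *)
have [k0 Fk0] := filter_ex Fonto; have [x0 _] := Fk0 0.
have /choice[xk hxk] : forall k, exists x, (forall p, exists x, d k p (F k x) <= 2 * eps k) ->
    d k v (F k x) <= 2 * eps k.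
  move=> k; have [h|nh] := pselect (forall p, exists x, d k p (F k x) <= 2 * eps k).
    by have [x hx] := h v; exists x.
  by exists x0.
(* Surjectivity uses the compactness of [X]: points [xk k] whose images are close to [v] converge to
   some [x], and the triangle inequality in the k-th quotient gives [dl v (Fl x) = 0]. *)
have [|x _ xkx] := ultra_cvg UU (f := xk) hX; first exact: nearW.
exists x.
have dvx : dl v (Fl x) = 0.
  apply/eqP; rewrite eq_le; apply/andP; split; apply/ler_addgt0Pl => eta eta0.
    have eta2 : 0 < eta / 4 by rewrite divr_gt0.
    have vcv : (fun=> v) k @[k --> U] --> v by exact: cvg_cst.
    have xkd : \forall k \near U, mdist x (xk k) < eta / 4.
      by apply: filterS (cvg_ball xkx eta2) => k; rewrite ballEmdist.
    have [k [[[h1 h2] [h3 h4]] [h5 h6]]] := filter_ex (filterI (filterI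
      (filterI Fdist (near_eps' _ eta2)) (filterI Fonto triangle)) (filterI xkd
      (cvg_qdist_ge UU C0 (ltW hD) bW WC spec dD WWl specl eta2 vcv (hFl x)))).
    rewrite /= metric_sym in h5.
    exact: le_of_chain h6 (h4 v (F k (xk k)) (F k x)) (hxk k h3) (h1 (xk k) x) h2 h5.
  have [c [gam [_ _ _ _ lc]]] := specl.2 v (Fl x) eta eta0.
  by have := curve_length_ge0 (gmetric heis_axis Wl 1%:M) c; rewrite /frame_length in lc; lra.
have [gam Lgam gE] := limit_qdist_eq0 UU C0 del0 bW WC LG gap WWl specl dvx.
apply/quotient_projP; exists (gam *m invmx Q); first by rewrite /= mulmxKV ?iQ.1.
rewrite -[p](mulmxK iQ.1) -/v -gE -[in LHS](mulmxKV iQ.1 gam) -[in LHS](mulmxKV iQ.1 (Fl x)).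
by rewrite iQ.2 mulmxK ?iQ.1.
Qed.
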